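(* Let $A_\Gamma$ be the right-angled Artin group of a finite simplicial graph $\Gamma$. There is an algorithm that takes in two tuples $U$ and $V$ of conjugacy classes from $A_\Gamma$, and a vertex $a$ in $\Gamma$, and produces an automorphism $\alpha$ in $\Omega_{[a]}$ with $\alpha\cdot U=V$ or determines that no such automorphism exists. In particular, it is possible to determine (algorithmically) whether a tuple $U$ can be shortened by an automorphism from $\Omega_{[a]}$, i.e. whether there is $\alpha\in\Omega_{[a]}$ with $|\alpha\cdot U|<|U|$.
   Context: Let $X$ be the vertex set of the finite simplicial graph $\Gamma$. $A_\Gamma$ is the group with generating set $X$, whose only relations are that two generators commute if and only if they are adjacent in $\Gamma$. The length of an element of $A_\Gamma$ is word length with respect to $X$; the length of a conjugacy class is the minimum length of a representative; the length $|U|$ of a tuple $U$ of conjugacy classes is the sum of the lengths of its entries. $\operatorname{Aut}(A_\Gamma)$ acts entrywise on tuples of conjugacy classes. For $a\in X$, the star $\operatorname{st}(a)$ is the set consisting of $a$ and all vertices adjacent to $a$, and $[a]=\{b\in X:\operatorname{st}(b)=\operatorname{st}(a)\}$. $\Omega_{[a]}$ is the subgroup of all $\alpha\in\operatorname{Aut}(A_\Gamma)$ such that (i) for each $b\in X\setminus[a]$ there are $u,v\in\langle[a]\rangle$ with $\alpha(b)=ubv$, and (ii) for each $b\in[a]$, $\alpha(b)\in\langle[a]\rangle$. *)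

(* Defs.v *)
From HB Require Import structures.
From mathcomp Require Import all_boot.
From mathcomp Require Import boolp classical_sets.

Set Implicit Arguments.
Unset Strict Implicit.
Unset Printing Implicit Defensive.

Local Open Scope classical_set_scope.
Local Open Scope group_scope.
Local Open Scope quotient_scope.

(* The general recursive functions nat^n -> nat: Kleene's closure of zero,
   successor and projections under composition, primitive recursion and
   minimization of regular functions. The last three rules specify the new
   function h by its defining equations. *)
Inductive recursive : forall n, (n.-tuple nat -> nat) -> Prop :=
| rec_zero n : @recursive n (fun _ => 0%N)
| rec_succ : @recursive 1 (fun v => (thead v).+1)
| rec_proj n (i : 'I_n) : @recursive n (fun v => tnth v i)
| rec_comp m n (f : m.-tuple nat -> nat) (g : 'I_m -> n.-tuple nat -> nat)
    (h : n.-tuple nat -> nat) :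
    recursive f -> (forall i, recursive (g i)) ->
    (forall v, h v = f [tuple g i v | i < m]) ->
    recursive h
| rec_prim n (f : n.-tuple nat -> nat) (g : n.+2.-tuple nat -> nat)
    (h : n.+1.-tuple nat -> nat) :
    recursive f -> recursive g ->
    (forall v, h (cons_tuple 0%N v) = f v) ->
    (forall k v, h (cons_tuple k.+1 v) =
                 g (cons_tuple k (cons_tuple (h (cons_tuple k v)) v))) ->
    recursive h
| rec_min n (f : n.+1.-tuple nat -> nat) (h : n.-tuple nat -> nat) :
    recursive f ->
    (forall v, f (cons_tuple (h v) v) = 0%N) ->
    (forall v k, (k < h v)%N -> f (cons_tuple k v) <> 0%N) ->
    recursive h.

(* Data are coded by MathComp's pickle. This is an effective Goedel numbering
   for the types built from bool and finite types by seq, product, option and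
   {ffun _ -> _} with finite domain, and is meant to be used only at those. *)
Definition computable (T1 T2 : countType) (f : T1 -> T2) : Prop :=
  exists2 g : 1.-tuple nat -> nat,
    recursive g & forall x, g [tuple pickle x] = pickle (f x).

Record sgraph := SGraph {
  vertex :> finType;
  adj : rel vertex;
  adj_sym : symmetric adj;
  adj_irr : irreflexive adj
}.
Arguments adj {_}.

(* The letter (x, true) stands for x and (x, false) for its inverse. *)
Definition word (G : sgraph) := seq (vertex G * bool).

Section RAAG.
Variable G : sgraph.
Implicit Types u v w : word G.

Inductive weq : word G -> word G -> Prop :=
| weq_refl w : weq w w
| weq_sym u v : weq u v -> weq v u
| weq_trans v u w : weq u v -> weq v w -> weq u w
| weq_cat u u' v v' : weq u u' -> weq v v' -> weq (u ++ v) (u' ++ v')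
| weq_cancel x b : weq [:: (x, b); (x, ~~ b)] [::]
| weq_adj x y : adj x y ->
    weq [:: (x, true); (y, true)] [:: (y, true); (x, true)].

Definition weqb u v : bool := `[< weq u v >].

Lemma weqbP u v : reflect (weq u v) (weqb u v).
Proof. exact: asboolP. Qed.

Lemma weqb_refl : reflexive weqb.
Proof. by move=> w; apply/weqbP/weq_refl. Qed.

Lemma weqb_sym : symmetric weqb.
Proof. by move=> u v; apply/weqbP/weqbP; apply: weq_sym. Qed.

Lemma weqb_trans : transitive weqb.
Proof.
by move=> v u w /weqbP uv /weqbP vw; apply/weqbP; apply: weq_trans vw.
Qed.

Canonical weq_equiv := EquivRel weqb weqb_refl weqb_sym weqb_trans.

Definition raag := {eq_quot weq_equiv}.

HB.instance Definition _ := EqQuotient.on raag.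
HB.instance Definition _ := Choice.on raag.

Definition winv w : word G := rev [seq (l.1, ~~ l.2) | l <- w].

Lemma winv_cat u v : winv (u ++ v) = winv v ++ winv u.
Proof. by rewrite /winv map_cat rev_cat. Qed.

Lemma winvK : involutive winv.
Proof.
move=> w; rewrite /winv map_rev revK -map_comp -[RHS]map_id.
by apply: eq_map => -[x b] /=; rewrite negbK.
Qed.

Lemma weq_mulV w : weq (w ++ winv w) [::].
Proof.
elim: w => [|[x b] w IHw]; first exact: weq_refl.
rewrite -cat1s winv_cat -catA (catA w).
apply: weq_trans (weq_cancel x b).
apply: (@weq_cat [:: _] [:: _] _ [:: _]); first exact: weq_refl.
by have := weq_cat IHw (weq_refl (winv [:: (x, b)])); rewrite cat0s.
Qed.

Lemma weq_winv u v : weq u v -> weq (winv u) (winv v).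
Proof.
move=> uv.
have H1 : weq (winv u ++ (v ++ winv v)) (winv u).
  rewrite -[X in weq _ X]cats0.
  by apply: weq_cat (weq_mulV v); apply: weq_refl.
apply: weq_trans (weq_sym H1) _; rewrite catA -[X in weq _ X]cat0s.
apply: weq_cat (weq_refl _).
apply: weq_trans (weq_cat (weq_refl _) (weq_sym uv)) _.
by have := weq_mulV (winv u); rewrite winvK.
Qed.

Definition raag_one : raag := \pi_raag [::].
Definition raag_mul (g h : raag) : raag := \pi_raag (repr g ++ repr h).
Definition raag_inv (g : raag) : raag := \pi_raag (winv (repr g)).

Lemma raag_piP u v : weq u v <-> \pi_raag u = \pi_raag v.
Proof. by rewrite (rwP (weqbP u v)); split => /eqmodP. Qed.

Lemma weq_repr w : weq (repr (\pi_raag w)) w.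
Proof. by apply/raag_piP; rewrite reprK. Qed.

Lemma raag_mulE u v : raag_mul (\pi_raag u) (\pi_raag v) = \pi_raag (u ++ v).
Proof. by apply/raag_piP; apply: weq_cat; apply: weq_repr. Qed.

Lemma raag_invE u : raag_inv (\pi_raag u) = \pi_raag (winv u).
Proof. by apply/raag_piP; apply: weq_winv; apply: weq_repr. Qed.

Lemma raag_mulA : associative raag_mul.
Proof.
move=> f g h; rewrite -[f]reprK -[g]reprK -[h]reprK.
rewrite (raag_mulE (repr g)) (raag_mulE (repr f) (repr g)).
by rewrite !raag_mulE catA.
Qed.

Lemma raag_mul1 : left_id raag_one raag_mul.
Proof. by move=> g; rewrite -[g]reprK raag_mulE. Qed.

Lemma raag_mulr1 : right_id raag_one raag_mul.
Proof. by move=> g; rewrite -[g]reprK raag_mulE cats0. Qed.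

Lemma raag_mulVr : right_inverse raag_one raag_inv raag_mul.
Proof.
by move=> g; rewrite -[g]reprK raag_invE raag_mulE; apply/raag_piP/weq_mulV.
Qed.

Lemma raag_mulV : left_inverse raag_one raag_inv raag_mul.
Proof.
move=> g; rewrite -[g]reprK raag_invE raag_mulE -[X in _ ++ X]winvK.
exact/raag_piP/weq_mulV.
Qed.

HB.instance Definition _ :=
  isGroup.Build raag raag_mulA raag_mul1 raag_mulr1 raag_mulV raag_mulVr.

Definition wval w : raag := \pi_raag w.

Definition gen (x : G) : raag := wval [:: (x, true)].

End RAAG.

Definition generated (gT : groupType) (S : set gT) : set gT :=
  smallest (fun H : set gT => group_closed [in H]) S.

Definition automorphism (gT : groupType) (alpha : gT -> gT) : Prop :=
  {morph alpha : x y / x * y} /\ bijective alpha.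

Definition cclass (gT : groupType) (g : gT) : set gT := [set g ^ h | h in setT].

(* The minimum of S, and 0 if S is empty. *)
Definition min_nat (S : set nat) : nat :=
  if pselect (exists n, n \in S) is left neS then ex_minn neS else 0%N.

Section Omega.
Variable G : sgraph.

Definition len (g : raag G) : nat :=
  min_nat [set size w | w in [set w | wval w = g]].

Definition class_len (C : set (raag G)) : nat := min_nat [set len g | g in C].

Definition tuple_len (U : seq (set (raag G))) : nat :=
  (\sum_(C <- U) class_len C)%N.

Definition aut_act (alpha : raag G -> raag G) (U : seq (set (raag G))) :=
  [seq alpha @` C | C <- U].

Definition star (a : G) : {set G} := [set b | (b == a) || adj a b]%SET.

Definition star_class (a : G) : {set G} := [set b | star b == star a]%SET.

Definition star_subgroup (a : G) : set (raag G) :=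
  generated [set gen b | b in [set b | b \in star_class a]].

Definition Omega (a : G) (alpha : raag G -> raag G) : Prop :=
  [/\ automorphism alpha,
      forall b, b \notin star_class a ->
        exists u v, [/\ star_subgroup a u, star_subgroup a v &
                        alpha (gen b) = u * gen b * v] &
      forall b, b \in star_class a -> star_subgroup a (alpha (gen b))].

(* Algorithms receive a conjugacy class through a word representing one of its
   elements, and return an automorphism through the images of the generators. *)
Definition classes_of (U : seq (word G)) : seq (set (raag G)) :=
  [seq cclass (wval w) | w <- U].

Definition represents (phi : {ffun G -> word G}) (alpha : raag G -> raag G) :=
  forall x, alpha (gen x) = wval (phi x).

End Omega.

(* Main.v *)
Require Import Defs.
From HB Require Import structures.
From mathcomp Require Import all_boot all_algebra.
From mathcomp Require Import zify ring.
From mathcomp Require Import boolp classical_sets.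

Set Implicit Arguments.
Unset Strict Implicit.
Unset Printing Implicit Defensive.

Import GRing.Theory Num.Theory.

(** Write K for the class [a], which is a clique, and N for the set of vertices
outside the star of a. The subgroup generated by K is free abelian, so an
automorphism of the group Omega is given by integers: an exponent vector for
the image of each vertex of K, and two vectors u_b, v_b for every other vertex
b, which is sent to u_b b v_b. Which integers occur? The images of adjacent
generators must commute, which is a list of linear equations ([comm_eqs],
[comm_eqs_necessary]), and the square matrix of the action on K must have
determinant 1 or -1. These conditions are sufficient ([Omega_induced]) and
necessary ([Omega_coefs]).

The letters of N cut a word into gaps, within which the letters of K commute
with everything. Therefore the conjugacy class of a cyclic word only depends on
the word of its other letters and on the labels of the gaps, the exponent sums
of the vertices of K in them ([eqlab_conjw]). An automorphism of Omega leaves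
the other letters in place, and the labels of the image are linear in its
integers ([label_wsub]). To carry a word to a given word up to equality of
labels is thus a linear system in which one square block of unknowns has to be
unimodular. The target is however a whole conjugacy class, and the number of
systems must be made finite. This is done by [exists_min_image]: the labels of
the image of a shortest representative of a class are also those of some word
which is itself shortest in its class. It rests on the theory of cancellation
of cyclic words: two words are conjugate if and only if rotations, commutations
and cancellations lead from both to a common word ([conjwP], from the
confluence [reach_confluent]), so that a word is shortest in its class when
nothing can be cancelled. A cancellation of two letters outside K in the image
would come from one in the original word, because the action on K is
injective; cancellations of letters of K do not change the labels.

A linear system with a unimodular block is solvable in integers if and only if
it is solvable modulo every positive number ([local_global]): the Smith normal
form reduces this to lifting a matrix of determinant 1 or -1 modulo a power of
m, some columns of which are prescribed, to an invertible integer matrix.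

Consequently each answer has a certificate. If an automorphism exists, its
integers can be checked by deciding conjugacy. If none exists, then some modulus
excludes all of the finitely many targets at once ([accepts_or_refutes]), and
there are only finitely many residues of the integers to test. A search for the
first certificate of either kind is the algorithm. As for shortening, only
finitely many tuples of words are shorter than the given one, and each of them
is a possible target.

Computability of all this is derived from closure properties of the recursive
functions, the data being coded by numbers. *)

(** * Recursive functions of numbers *)

Section Recursive.

Lemma rec_ext n (f g : n.-tuple nat -> nat) :
  recursive f -> f =1 g -> recursive g.
Proof.
move=> rf fg.
apply: (@rec_comp 1 n _ (fun _ => f) g (rec_proj ord0)) => // v.
by rewrite tnth_mktuple fg.
Qed.

Lemma rec_nth n i : i < n -> @recursive n (fun v => nth 0 v i).
Proof.
move=> ltin; apply: rec_ext (rec_proj (Ordinal ltin)) _ => v.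
by rewrite (tnth_nth 0).
Qed.

Definition rec1 (f : nat -> nat) := @recursive 1 (fun v => f (nth 0 v 0)).
Definition rec2 (f : nat -> nat -> nat) :=
  @recursive 2 (fun v => f (nth 0 v 0) (nth 0 v 1)).
Definition rec3 (f : nat -> nat -> nat -> nat) :=
  @recursive 3 (fun v => f (nth 0 v 0) (nth 0 v 1) (nth 0 v 2)).

Lemma nth_mktup m (g : 'I_m -> nat) j (ltjm : j < m) :
  nth 0 [tuple g i | i < m] j = g (Ordinal ltjm).
Proof. by rewrite -[j]/(val (Ordinal ltjm)) -tnth_nth tnth_mktuple. Qed.

Lemma rec1_comp n f (g : n.-tuple nat -> nat) :
  rec1 f -> recursive g -> recursive (fun v => f (g v)).
Proof.
move=> rf rg; apply: (rec_comp (g := fun _ => g) rf) => // v.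
by rewrite nth_mktup.
Qed.

Lemma rec2_comp n f (g0 g1 : n.-tuple nat -> nat) :
  rec2 f -> recursive g0 -> recursive g1 ->
  recursive (fun v => f (g0 v) (g1 v)).
Proof.
move=> rf r0 r1.
apply: (rec_comp (g := fun i => if val i is 0 then g0 else g1) rf) => [i|v].
  by case: (val i).
by rewrite !nth_mktup.
Qed.

Lemma rec3_comp n f (g0 g1 g2 : n.-tuple nat -> nat) :
  rec3 f -> recursive g0 -> recursive g1 -> recursive g2 ->
  recursive (fun v => f (g0 v) (g1 v) (g2 v)).
Proof.
move=> rf r0 r1 r2.
apply: (rec_comp (g := fun i =>
  if val i is j.+1 then (if j is 0 then g1 else g2) else g0) rf) => [i|v].
  by case: (val i) => [|[]].
by rewrite !nth_mktup.
Qed.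

Lemma rec_const n c : @recursive n (fun _ => c).
Proof.
elim: c => [|c IHc]; first exact: rec_zero.
apply: (rec_comp (g := fun _ _ => c) rec_succ) => // v.
by rewrite /thead tnth_mktuple.
Qed.

Lemma rec1S : rec1 S.
Proof.
apply: rec_ext rec_succ _ => v; by rewrite /thead (tnth_nth 0).
Qed.

Lemma rec1_id : rec1 id. Proof. exact: rec_nth. Qed.

Lemma rec1_const c : rec1 (fun _ => c). Proof. exact: rec_const. Qed.

Lemma rec1_prim c g (h : nat -> nat) : rec2 g ->
  h 0 = c -> (forall k, h k.+1 = g k (h k)) -> rec1 h.
Proof.
move=> rg h0 hS.
apply: (@rec_prim 0 (fun _ => c) (fun v => g (nth 0 v 0) (nth 0 v 1))).
- exact: rec_const.
- exact: rg.
- by move=> v.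
- by move=> k v; apply: hS.
Qed.

Lemma rec2_prim f g (h : nat -> nat -> nat) : rec1 f -> rec3 g ->
  (forall x, h 0 x = f x) -> (forall k x, h k.+1 x = g k (h k x) x) -> rec2 h.
Proof.
move=> rf rg h0 hS.
apply: (@rec_prim 1 (fun v => f (nth 0 v 0))
          (fun v => g (nth 0 v 0) (nth 0 v 1) (nth 0 v 2))).
- exact: rf.
- exact: rg.
- by move=> v; apply: h0.
- by move=> k v; apply: hS.
Qed.

Lemma rec1_min f (h : nat -> nat) : rec2 f ->
  (forall x, f (h x) x = 0) -> (forall x k, k < h x -> f k x <> 0) -> rec1 h.
Proof.
move=> rf h0 hmin.
apply: (@rec_min 1 (fun v => f (nth 0 v 0) (nth 0 v 1)) _ rf) => [v|v k].
  exact: h0.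
exact: hmin.
Qed.

Lemma rec2_min f (h : nat -> nat -> nat) : rec3 f ->
  (forall x y, f (h x y) x y = 0) ->
  (forall x y k, k < h x y -> f k x y <> 0) -> rec2 h.
Proof.
move=> rf h0 hmin.
apply: (@rec_min 2 (fun v => f (nth 0 v 0) (nth 0 v 1) (nth 0 v 2)) _ rf)
  => [v|v k].
  exact: h0.
exact: hmin.
Qed.

Lemma rec2_swap f : rec2 f -> rec2 (fun x y => f y x).
Proof. by move=> rf; apply: rec2_comp rf _ _; apply: rec_nth. Qed.

Lemma rec_pred : rec1 predn.
Proof. exact: (@rec1_prim 0 (fun k _ => k) predn (rec_nth _)). Qed.

Lemma rec_add : rec2 addn.
Proof.
apply: (@rec2_prim id (fun _ r _ => r.+1)) => //; first exact: rec1_id.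
exact: (rec1_comp rec1S (rec_nth _)).
Qed.

Lemma rec_sub : rec2 subn.
Proof.
apply: (rec2_swap (f := fun y x => x - y)).
apply: (@rec2_prim id (fun _ r _ => r.-1)) => [||x|k x] /=.
- exact: rec1_id.
- exact: (rec1_comp rec_pred (rec_nth _)).
- by rewrite subn0.
- by rewrite subnS.
Qed.

Lemma rec_mul : rec2 muln.
Proof.
apply: (@rec2_prim (fun _ => 0) (fun _ r x => x + r)) => //.
  exact: rec1_const.
exact: (rec2_comp rec_add (rec_nth _) (rec_nth _)).
Qed.

Lemma rec_exp2 : rec1 (fun n => 2 ^ n).
Proof.
apply: (@rec1_prim 1 (fun _ r => 2 * r)) => [||k]; rewrite ?expnS //.
exact: (rec2_comp rec_mul (rec_const _ _) (rec_nth _)).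
Qed.

Lemma rec_if n (b x y : n.-tuple nat -> nat) :
  recursive b -> recursive x -> recursive y ->
  recursive (fun v => if b v == 0 then x v else y v).
Proof.
move=> rb rx ry.
apply: (@rec3_comp n (fun b x y => if b == 0 then x else y)) => //.
suff ri : rec3 (fun b x y => (1 - b) * x + (1 - (1 - b)) * y).
  apply: rec_ext ri _ => v; case: (nth _ _ 0) => [|k] /=.
    by rewrite mul1n mul0n addn0.
  by rewrite mul0n add0n mul1n.
have rnb : @recursive 3 (fun v => 1 - nth 0 v 0).
  exact: rec2_comp rec_sub (rec_const _ _) (rec_nth _).
apply: rec2_comp rec_add _ _; apply: rec2_comp rec_mul _ _; try exact: rec_nth.
  exact: rnb.
exact: rec2_comp rec_sub (rec_const _ _) rnb.
Qed.


(** Quotients and valuations are found by minimization: they are the first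
    number at which an overshoot occurs. *)
Lemma rec_half : rec1 half.
Proof.
apply: (@rec1_min (fun k x => x - k.*2.+1)) => [|x|x k].
- suff r : rec2 (fun k x => x - (k + k).+1).
    by apply: rec_ext r _ => v; rewrite addnn.
  apply: rec2_comp rec_sub (rec_nth _) _ => //; apply: rec1_comp rec1S _.
  by apply: rec2_comp rec_add _ _; apply: rec_nth.
- apply/eqP; rewrite subn_eq0 -{1}(odd_double_half x).
  by case: odd; rewrite // add0n leqnSn.
- move=> ltk /eqP; rewrite subn_eq0; apply/negP; rewrite -ltnNge.
  by rewrite -doubleS -geq_half_double.
Qed.

Lemma rec_odd : rec1 (fun n => odd n).
Proof.
apply: rec_ext (_ : recursive (fun v => nth 0 v 0 - (nth 0 v 0)./2.*2)) _ => [|v].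
- apply: rec2_comp rec_sub (rec_nth _) _ => //.
  suff r : rec1 (fun x => x./2 + x./2) by apply: rec_ext r _ => v; rewrite addnn.
  by apply: rec2_comp rec_add _ _; apply: rec1_comp rec_half (rec_nth _).
- by rewrite -{1}[nth 0 v 0]odd_double_half addnK.
Qed.

Lemma rec_divn : rec2 divn.
Proof.
apply: (@rec2_min (fun k m d => if d == 0 then 0 else m.+1 - d * k.+1)).
- apply: rec_if (rec_nth _) (rec_const _ _) _ => //.
  apply: rec2_comp rec_sub _ _; first exact: rec1_comp rec1S (rec_nth _).
  apply: rec2_comp rec_mul (rec_nth _) _ => //.
  exact: rec1_comp rec1S (rec_nth _).
- move=> m [|d] //=; apply/eqP; rewrite subn_eq0 mulnC.
  exact: ltn_ceil.
- move=> m [|d] k; first by rewrite divn0.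
  rewrite /= => ltk /eqP; rewrite subn_eq0; apply/negP; rewrite -leqNgt mulnC.
  by rewrite -leq_divRL.
Qed.

Lemma rec_modn : rec2 modn.
Proof.
apply: rec_ext (_ : recursive
   (fun v => nth 0 v 0 - (nth 0 v 0 %/ nth 0 v 1) * nth 0 v 1)) _ => [|v].
- apply: rec2_comp rec_sub (rec_nth _) _ => //.
  apply: rec2_comp rec_mul _ (rec_nth _) => //.
  by apply: rec2_comp rec_divn _ _; apply: rec_nth.
- by rewrite {1}(divn_eq (nth 0 v 0) (nth 0 v 1)) addKn.
Qed.

(** The code of a nonempty sequence has the head as 2-adic valuation, and the
    code of the tail is read off the odd part. *)
Definition cons_code n m := 2 ^ n * m.*2.+1.
Definition head_code c := logn 2 c.
Definition tail_code c := (c %/ 2 ^ logn 2 c)./2.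

Lemma cons_codeK n m :
  head_code (cons_code n m) = n /\ tail_code (cons_code n m) = m.
Proof.
have odd1 : odd m.*2.+1 by rewrite /= odd_double.
have l : logn 2 (cons_code n m) = n.
  rewrite /cons_code lognM ?expn_gt0 // pfactorK // lognE /=.
  by rewrite dvdn2 /= odd_double addn0.
split=> //; rewrite /tail_code l /cons_code mulKn ?expn_gt0 //.
by rewrite -[X in _ X = _]/(true + m.*2) half_bit_double.
Qed.

Lemma rec_cons_code : rec2 cons_code.
Proof.
apply: rec2_comp rec_mul _ _; first exact: rec1_comp rec_exp2 (rec_nth _).
suff r : @recursive 2 (fun v => (nth 0 v 1 + nth 0 v 1).+1).
  by apply: rec_ext r _ => v; rewrite addnn.
apply: rec1_comp rec1S _; apply: rec2_comp rec_add _ _; exact: rec_nth.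
Qed.

(** Zero codes the empty sequence and is treated apart, since no power of 2
    divides it with an odd quotient and the search would not stop. *)
Lemma rec_head_code : rec1 head_code.
Proof.
apply: (@rec1_min (fun k c => if c == 0 then 0 else 1 - odd (c %/ 2 ^ k))).
- apply: rec_if (rec_nth _) (rec_const _ _) _ => //.
  apply: rec2_comp rec_sub (rec_const _ _) _.
  apply: rec1_comp rec_odd _; apply: rec2_comp rec_divn (rec_nth _) _ => //.
  exact: rec1_comp rec_exp2 (rec_nth _).
- move=> [|c] //=.
  have [q nq e] := @pfactor_coprime 2 c.+1 isT isT.
  rewrite /head_code {1}e mulnK ?expn_gt0 //.
  by rewrite (_ : odd q) // -coprime2n.
- move=> [|c] k //=.
  have [q nq e] := @pfactor_coprime 2 c.+1 isT isT.
  rewrite /head_code => ltk.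
  have -> : c.+1 %/ 2 ^ k = q * 2 ^ (logn 2 c.+1 - k.+1) * 2.
    by rewrite {1}e -mulnA -expnSr -subSn // subSS -{1}(subnK (ltnW ltk))
      expnD mulnA mulnK ?expn_gt0.
  by rewrite oddM andbF.
Qed.

Lemma rec_tail_code : rec1 tail_code.
Proof.
apply: rec1_comp rec_half _; apply: rec2_comp rec_divn (rec_nth _) _ => //.
exact: rec1_comp rec_exp2 rec_head_code.
Qed.

Lemma cons_code_gt0 n m : 0 < cons_code n m.
Proof. by rewrite muln_gt0 expn_gt0. Qed.

End Recursive.

(** * Computable functions between coded types *)

Section Computable.

Lemma computableP (T1 T2 : countType) (f : T1 -> T2) (g : nat -> nat) :
  rec1 g -> (forall x, g (pickle x) = pickle (f x)) -> computable f.
Proof. by move=> rg gP; exists (fun v => g (nth 0 v 0)). Qed.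

Lemma computable_code (T1 T2 : countType) (f : T1 -> T2) : computable f ->
  exists2 g : nat -> nat, rec1 g & forall x, g (pickle x) = pickle (f x).
Proof.
move=> [g rg gP]; exists (fun n => g [tuple n]) => //.
apply: rec_ext rg _ => v; congr g; apply/eq_from_tnth => i.
by rewrite (ord1 i) !(tnth_nth 0).
Qed.

Lemma computable_ext (T1 T2 : countType) (f f' : T1 -> T2) :
  computable f -> f =1 f' -> computable f'.
Proof. by move=> [g rg gP] ff'; exists g => // x; rewrite gP ff'. Qed.

Lemma computable_id (T : countType) : computable (@id T).
Proof. exact: computableP rec1_id _. Qed.

Lemma computable_const (C T : countType) (x : T) : computable (fun _ : C => x).
Proof. exact: computableP (rec1_const (pickle x)) _. Qed.

Lemma computable_comp (C T1 T2 : countType) (F : T1 -> T2) (f : C -> T1) :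
  computable F -> computable f -> computable (fun c => F (f c)).
Proof.
move=> /computable_code[G rG GP] /computable_code[g rg gP].
by apply: (@computableP _ _ _ (G \o g) (rec1_comp rG rg)) => x /=; rewrite gP GP.
Qed.

Lemma computable_nat1 (F : nat -> nat) : rec1 F -> computable F.
Proof. by move=> rF; apply: computableP rF _. Qed.

Lemma computable_pair (C T1 T2 : countType) (f : C -> T1) (g : C -> T2) :
  computable f -> computable g -> computable (fun c => (f c, g c)).
Proof.
move=> /computable_code[F rF FP] /computable_code[G rG GP].
apply: (@computableP _ _ _ (fun n => cons_code (F n) (cons_code (G n) 0))).
  apply: rec2_comp rec_cons_code rF _.
  exact: rec2_comp rec_cons_code rG (rec_const _ _).
by move=> x; rewrite FP GP.
Qed.

Lemma computable_fst (T1 T2 : countType) : computable (@fst T1 T2).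
Proof.
apply: computableP rec_head_code _ => -[x y].
exact: (cons_codeK _ _).1.
Qed.

Lemma computable_snd (T1 T2 : countType) : computable (@snd T1 T2).
Proof.
apply: (@computableP _ _ _ (fun n => head_code (tail_code n))
  (rec1_comp rec_head_code rec_tail_code)) => -[x y].
by rewrite [pickle (x, y)]/(cons_code (pickle x) (cons_code (pickle y) 0))
  (cons_codeK _ _).2 (cons_codeK _ _).1.
Qed.

Lemma computable_comp2 (C T1 T2 T3 : countType) (F : T1 -> T2 -> T3)
    (f : C -> T1) (g : C -> T2) :
  computable (fun p => F p.1 p.2) -> computable f -> computable g ->
  computable (fun c => F (f c) (g c)).
Proof.
move=> cF cf cg.
exact: (computable_comp (F := fun p => F p.1 p.2) cF (computable_pair cf cg)).
Qed.

Lemma computable_nat2 (F : nat -> nat -> nat) : rec2 F ->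
  computable (fun p => F p.1 p.2).
Proof.
move=> rF.
apply: (@computableP _ _ _ (fun n => F (head_code n) (head_code (tail_code n)))).
  apply: rec2_comp rF rec_head_code _.
  exact: rec1_comp rec_head_code rec_tail_code.
move=> [x y]; rewrite [pickle (x, y)]/(cons_code x (cons_code y 0)).
by rewrite (cons_codeK _ _).2 !(cons_codeK _ _).1.
Qed.

Lemma computable_if (C T : countType) (b : C -> bool) (f g : C -> T) :
  computable b -> computable f -> computable g ->
  computable (fun c => if b c then f c else g c).
Proof.
move=> /computable_code[B rB BP] /computable_code[F rF FP].
move=> /computable_code[G rG GP].
apply: (@computableP _ _ _ (fun n => if B n == 0 then G n else F n)
  (rec_if rB rG rF)) => x /=.
by rewrite BP FP GP; case: (b x).
Qed.

Lemma computable_pickle (T : countType) : computable (pickle : T -> nat).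
Proof. exact: computableP rec1_id _. Qed.

(** The identity on codes. *)
Lemma computable_decode : computable CodeSeq.decode.
Proof.
apply: computableP rec1_id _ => n /=.
by rewrite -{1}[n]CodeSeq.decodeK; congr CodeSeq.code; rewrite map_id.
Qed.

Lemma computable_cons (C T : countType) (x : C -> T) (s : C -> seq T) :
  computable x -> computable s -> computable (fun c => x c :: s c).
Proof.
move=> /computable_code[F rF FP] /computable_code[G rG GP].
apply: (@computableP _ _ _ (fun n => cons_code (F n) (G n))
  (rec2_comp rec_cons_code rF rG)) => c.
by rewrite FP GP.
Qed.

Lemma computable_match (C A T : countType) (s : C -> seq A)
    (f : C * (A * seq A) -> T) (g : C -> T) :
  computable s -> computable f -> computable g ->
  computable (fun c => if s c is x :: t then f (c, (x, t)) else g c).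
Proof.
move=> /computable_code[S rS SP] /computable_code[F rF FP].
move=> /computable_code[G rG GP].
pose P n := cons_code (head_code n) (cons_code (tail_code n) 0).
have rP : rec1 P.
  apply: rec2_comp rec_cons_code rec_head_code _.
  exact: rec2_comp rec_cons_code rec_tail_code (rec_const _ _).
pose Q n m := cons_code n (cons_code (P m) 0).
have rQ : rec2 Q.
  apply: rec2_comp rec_cons_code (rec_nth _) _ => //.
  apply: rec2_comp rec_cons_code _ (rec_const _ _).
  exact: rec1_comp rP (rec_nth _).
apply: (@computableP _ _ _ (fun n => if S n == 0 then G n else F (Q n (S n)))
  (rec_if rS rG (rec1_comp rF (rec2_comp rQ rec1_id rS)))).
move=> x /=; rewrite SP GP; case: (s x) => [|y t] //=.
rewrite [pickle (y :: t)]/(cons_code (pickle y) (pickle t)).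
rewrite eqn0Ngt cons_code_gt0 /= -FP; congr F; rewrite /Q /P.
by rewrite (cons_codeK _ _).1 (cons_codeK _ _).2.
Qed.

Lemma computable_some (T : countType) : computable (@Some T).
Proof.
exact: (@computableP _ _ _ (fun n => cons_code n 0)
  (rec2_comp rec_cons_code rec1_id (rec_const _ 0))).
Qed.

Lemma computable_eq (C T : countType) (f g : C -> T) :
  computable f -> computable g -> computable (fun c => f c == g c).
Proof.
move=> cf cg.
suff ce : computable (fun p : nat * nat => p.1 == p.2).
  apply: computable_ext (computable_comp2 (F := fun m n : nat => m == n) ce
    (computable_comp (computable_pickle _) cf)
    (computable_comp (computable_pickle _) cg)) _ => c.
  by rewrite (inj_eq (pcan_inj pickleK)).
apply: (@computable_ext _ _ (fun p : nat * nat =>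
   if 1 - ((p.1 - p.2) + (p.2 - p.1)) is 0 then false else true)); last first.
  move=> [x y] /=; rewrite eqn_leq -!subn_eq0.
  by case: (x - y) (y - x) => [|k] [|l].
have cs : computable (fun n => if n is 0 then false else true).
  apply: (@computableP _ _ _ (fun n => if n == 0 then 0 else 1)
    (rec_if (rec_nth (n := 1) _) (rec_const _ 0) (rec_const _ 1))) => //.
  by case.
apply: (computable_comp cs); apply: computable_nat2 (fun x y =>
  1 - ((x - y) + (y - x))) _.
apply: rec2_comp rec_sub (rec_const _ _) _.
by apply: rec2_comp rec_add _ _; apply: rec2_comp rec_sub _ _; apply: rec_nth.
Qed.

(** The context [C] stays available to the step, as a parameter of the primitive
    recursion. *)
Lemma computable_iter (C A : countType) (n : C -> nat) (f : C * A -> A)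
    (a : C -> A) : computable n -> computable f -> computable a ->
  computable (fun c => iter (n c) (fun x => f (c, x)) (a c)).
Proof.
move=> /computable_code[N rN NP] /computable_code[F rF FP].
move=> /computable_code[G rG GP].
pose P n m := cons_code n (cons_code m 0).
have rP : rec2 P.
  apply: rec2_comp rec_cons_code (rec_nth _) _ => //.
  by apply: rec2_comp rec_cons_code _ (rec_const _ _); apply: rec_nth.
pose h k x := iter k (fun y => F (P x y)) (G x).
have rh : rec2 h.
  apply: (@rec2_prim G (fun _ r x => F (P x r))) => //.
  by apply: rec1_comp rF (rec2_comp rP _ _); apply: rec_nth.
apply: (@computableP _ _ _ (fun n => h (N n) n) (rec2_comp rh rN rec1_id)).
move=> x.
rewrite NP /h; elim: (n x) => [|k IHk]; first exact: GP.
by rewrite !iterS IHk -FP.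
Qed.

Lemma size_code s : size s <= CodeSeq.code s.
Proof.
elim: s => //= x s IHs; apply: leq_trans (leq_pmull _ (expn_gt0 2 x)).
by rewrite ltnS (leq_trans IHs) // -addnn leq_addr.
Qed.

(** A sequence is no longer than its code, so that iterating the one-letter step
    as often as the code says exhausts it. *)
Lemma computable_foldl (C A B : countType) (s : C -> seq A)
    (f : C * (B * A) -> B) (b : C -> B) :
  computable s -> computable f -> computable b ->
  computable (fun c => foldl (fun y x => f (c, (y, x))) (b c) (s c)).
Proof.
move=> cs cf cb.
pose step (p : C * (seq A * B)) :=
  if p.2.1 is x :: t then (t, f (p.1, (p.2.2, x))) else p.2.
have cstep : computable step.
  apply: (computable_match (s := fun p : C * (seq A * B) => p.2.1)
    (f := fun q : (C * (seq A * B)) * (A * seq A) =>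
            (q.2.2, f (q.1.1, (q.1.2.2, q.2.1))))
    (g := fun p => p.2)); last exact: computable_snd.
    exact: computable_comp (computable_fst _ _) (computable_snd _ _).
  have c1 := computable_fst (C * (seq A * B))%type (A * seq A)%type.
  have c2 := computable_snd (C * (seq A * B))%type (A * seq A)%type.
  apply: computable_pair; first exact: computable_comp (computable_snd _ _) c2.
  apply: computable_comp cf _; apply: computable_pair.
    exact: computable_comp (computable_fst _ _) c1.
  apply: computable_pair; last exact: computable_comp (computable_fst _ _) c2.
  apply: computable_comp (computable_snd _ _) _.
  exact: computable_comp (computable_snd _ _) c1.
have ci := computable_iter (computable_comp (computable_pickle _) cs) cstep
  (computable_pair cs cb).
apply: computable_ext (computable_comp (computable_snd _ _) ci) _ => c /=.
have: size (s c) <= pickle (s c) by rewrite -(size_map pickle) size_code.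
move: (pickle (s c)) => n.
elim: n (s c) (b c) => [|n IHn] [|x t] y //; rewrite iterSr.
  by move=> _; rewrite -[step _]/([::], y) IHn.
by rewrite ltnS => le_t; apply: (IHn t (f (c, (y, x)))).
Qed.

Lemma computable_rev (T : countType) : computable (@rev T).
Proof.
apply: (@computable_ext _ _ (fun s : seq T => foldl (fun y x => x :: y) [::] s)).
  apply: (computable_foldl (f := fun q : seq T * (seq T * T) => q.2.2 :: q.2.1)).
  - exact: computable_id.
  - apply: computable_cons; apply: computable_comp (computable_snd _ _).
      exact: computable_snd.
    exact: computable_fst.
  - exact: computable_const.
move=> s; rewrite -[rev s]cats0 -catrevE.
by elim: s [::] => //= x s IHs y; rewrite IHs.
Qed.

Lemma computable_foldr (C A B : countType) (s : C -> seq A)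
    (f : C * (A * B) -> B) (b : C -> B) :
  computable s -> computable f -> computable b ->
  computable (fun c => foldr (fun x y => f (c, (x, y))) (b c) (s c)).
Proof.
move=> cs cf cb.
apply: computable_ext (computable_foldl
  (f := fun q : C * (B * A) => f (q.1, (q.2.2, q.2.1)))
  (computable_comp (computable_rev _) cs) _ cb) _.
  apply: computable_comp cf _; apply: computable_pair (computable_fst _ _) _.
  apply: computable_pair; apply: computable_comp (computable_snd _ _).
    exact: computable_snd.
  exact: computable_fst.
by move=> c; rewrite foldl_rev.
Qed.

End Computable.

(** * Computable operations on booleans, numbers, lists and finite types *)

Lemma cfst (C A B : countType) (f : C -> A * B) : computable f -> computable (fun c => (f c).1).
Proof. exact: computable_comp (computable_fst _ _). Qed.

Lemma csnd (C A B : countType) (f : C -> A * B) : computable f -> computable (fun c => (f c).2).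
Proof. exact: computable_comp (computable_snd _ _). Qed.

Lemma ccode (C : countType) (n : C -> nat) :
  computable n -> computable (fun c => CodeSeq.decode (n c)).
Proof. exact: computable_comp computable_decode. Qed.

Lemma csome (C A : countType) (f : C -> A) : computable f -> computable (fun c => Some (f c)).
Proof. exact: computable_comp (computable_some _). Qed.

Lemma cand (C : countType) (a b : C -> bool) :
  computable a -> computable b -> computable (fun c => a c && b c).
Proof. by move=> ca cb; apply: computable_if ca cb (computable_const _ _). Qed.

Lemma cor (C : countType) (a b : C -> bool) :
  computable a -> computable b -> computable (fun c => a c || b c).
Proof. by move=> ca cb; apply: computable_if ca (computable_const _ _) cb. Qed.

Lemma cneg (C : countType) (a : C -> bool) : computable a -> computable (fun c => ~~ a c).
Proof.
by move=> ca; apply: computable_if ca (computable_const _ _) (computable_const _ _).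
Qed.

Lemma cimp (C : countType) (a b : C -> bool) :
  computable a -> computable b -> computable (fun c => a c ==> b c).
Proof. by move=> ca cb; apply: computable_if ca cb (computable_const _ _). Qed.

Lemma csucc (C : countType) (m : C -> nat) : computable m -> computable (fun c => (m c).+1).
Proof. exact: computable_comp (computable_nat1 rec1S). Qed.

Lemma cadd (C : countType) (m n : C -> nat) :
  computable m -> computable n -> computable (fun c => m c + n c).
Proof. exact: (computable_comp2 (F := addn) (computable_nat2 rec_add)). Qed.

Lemma csub (C : countType) (m n : C -> nat) :
  computable m -> computable n -> computable (fun c => m c - n c).
Proof. exact: (computable_comp2 (F := subn) (computable_nat2 rec_sub)). Qed.

Lemma cmul (C : countType) (m n : C -> nat) :
  computable m -> computable n -> computable (fun c => m c * n c).
Proof. exact: (computable_comp2 (F := muln) (computable_nat2 rec_mul)). Qed.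

Lemma cmod (C : countType) (m n : C -> nat) :
  computable m -> computable n -> computable (fun c => m c %% n c).
Proof. exact: (computable_comp2 (F := modn) (computable_nat2 rec_modn)). Qed.

Lemma cleq (C : countType) (m n : C -> nat) :
  computable m -> computable n -> computable (fun c => m c <= n c).
Proof.
by move=> cm cn; apply: computable_eq (csub cm cn) (computable_const _ _).
Qed.

Lemma call_fin (C : countType) (I : Type) (r : seq I) (F : I -> C -> bool) :
  (forall i, computable (F i)) -> computable (fun c => all (F^~ c) r).
Proof.
move=> cF; elim: r => [|i r IHr]; first exact: computable_const.
exact: cand (cF i) IHr.
Qed.

Lemma cmap (C A B : countType) (s : C -> seq A) (f : C * A -> B) :
  computable s -> computable f -> computable (fun c => [seq f (c, x) | x <- s c]).
Proof.
move=> cs cf.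
apply: computable_ext (computable_foldr
  (f := fun q : C * (A * seq B) => f (q.1, q.2.1) :: q.2.2)
  (b := fun _ => [::]) cs _ (computable_const _ _)) _.
  apply: computable_cons; last exact: computable_comp (computable_snd _ _) (computable_snd _ _).
  apply: computable_comp cf _; apply: computable_pair (computable_fst _ _) _.
  exact: computable_comp (computable_fst _ _) (computable_snd _ _).
by move=> c /=; elim: (s c) => //= x t ->.
Qed.

(** The variables of a nested context are iterated projections of it. *)
Ltac comp_proj :=
  solve [ assumption | exact: computable_id | exact: computable_const
        | apply: cfst; comp_proj | apply: csnd; comp_proj ].

Lemma call (C A : countType) (s : C -> seq A) (p : C * A -> bool) :
  computable s -> computable p -> computable (fun c => all (fun x => p (c, x)) (s c)).
Proof.
move=> cs cp.
apply: computable_ext (computable_foldr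
  (f := fun q : C * (A * bool) => p (q.1, q.2.1) && q.2.2)
  (b := fun _ => true) cs _ (computable_const _ _)) _.
  apply: cand; last by comp_proj.
  by apply: computable_comp cp _; apply: computable_pair; comp_proj.
by move=> c /=; elim: (s c) => //= x t ->.
Qed.

Lemma chas (C A : countType) (s : C -> seq A) (p : C * A -> bool) :
  computable s -> computable p -> computable (fun c => has (fun x => p (c, x)) (s c)).
Proof.
move=> cs cp; apply: computable_ext (cneg (call cs (cneg cp))) _ => c /=.
by rewrite -has_predC; apply: eq_has => x /=; rewrite negbK.
Qed.

Lemma cfilter (C A : countType) (s : C -> seq A) (p : C * A -> bool) :
  computable s -> computable p ->
  computable (fun c => [seq x <- s c | p (c, x)]).
Proof.
move=> cs cp.
apply: computable_ext (computable_foldr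
  (f := fun q : C * (A * seq A) =>
          if p (q.1, q.2.1) then q.2.1 :: q.2.2 else q.2.2)
  (b := fun _ => [::]) cs _ (computable_const _ _)) _.
  apply: computable_if; last by comp_proj.
    by apply: computable_comp cp _; apply: computable_pair; comp_proj.
  by apply: computable_cons; comp_proj.
by move=> c /=; elim: (s c) => //= x t ->.
Qed.

Lemma ccat (C A : countType) (s t : C -> seq A) :
  computable s -> computable t -> computable (fun c => s c ++ t c).
Proof.
move=> cs ct.
apply: computable_ext (computable_foldr
  (f := fun q : C * (A * seq A) => q.2.1 :: q.2.2) cs _ ct) _.
  by apply: computable_cons; comp_proj.
by move=> c /=; elim: (s c) => //= x r ->.
Qed.

Lemma cflatten (C A : countType) (s : C -> seq (seq A)) :
  computable s -> computable (fun c => flatten (s c)).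
Proof.
move=> cs.
apply: (computable_foldr (f := fun q : C * (seq A * seq A) => q.2.1 ++ q.2.2)
  (b := fun _ => [::])) => //; last exact: computable_const.
by apply: ccat; comp_proj.
Qed.

Lemma csize (C A : countType) (s : C -> seq A) : computable s -> computable (fun c => size (s c)).
Proof.
move=> cs; apply: computable_ext (computable_foldr
  (f := fun q : C * (A * nat) => q.2.2.+1) (b := fun _ => 0) cs _ _) _.
- by apply: csucc; comp_proj.
- exact: computable_const.
- by move=> c /=; elim: (s c) => //= x t ->.
Qed.

Lemma csumn (C : countType) (s : C -> seq nat) :
  computable s -> computable (fun c => sumn (s c)).
Proof.
move=> cs; apply: (computable_foldr
  (f := fun q : C * (nat * nat) => q.2.1 + q.2.2) (b := fun _ => 0)) => //.
- by apply: cadd; comp_proj.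
- exact: computable_const.
Qed.

Lemma chead (C A : countType) (x0 : A) (s : C -> seq A) :
  computable s -> computable (fun c => head x0 (s c)).
Proof.
move=> cs; apply: (computable_match (f := fun q : C * (A * seq A) => q.2.1)
  (g := fun _ => x0)) => //; last exact: computable_const.
by comp_proj.
Qed.

Lemma cbehead (C A : countType) (s : C -> seq A) :
  computable s -> computable (fun c => behead (s c)).
Proof.
move=> cs; apply: computable_ext (computable_match
  (f := fun q : C * (A * seq A) => q.2.2) (g := fun _ => [::]) cs _ _) _.
- by comp_proj.
- exact: computable_const.
- by move=> c; case: (s c).
Qed.

Lemma cnth (C A : countType) (x0 : A) (s : C -> seq A) (n : C -> nat) :
  computable s -> computable n -> computable (fun c => nth x0 (s c) (n c)).
Proof.
move=> cs cn.
apply: computable_ext (chead x0 (computable_iter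
  (f := fun q : C * seq A => behead q.2) cn _ cs)) _.
  by apply: cbehead; comp_proj.
move=> c; elim: (n c) (s c) => [|k IHk] [|x t]; rewrite ?iterSr //=.
by rewrite IHk nth_nil.
Qed.

Lemma crcons (C A : countType) (s : C -> seq A) (x : C -> A) :
  computable s -> computable x -> computable (fun c => rcons (s c) (x c)).
Proof.
move=> cs cx; apply: computable_ext (ccat cs (computable_cons cx
  (computable_const _ [::]))) _ => c; by rewrite cats1.
Qed.

Lemma crev (C A : countType) (s : C -> seq A) :
  computable s -> computable (fun c => rev (s c)).
Proof. exact: computable_comp (computable_rev _). Qed.

Lemma ciota0 (C : countType) (n : C -> nat) : computable n -> computable (fun c => iota 0 (n c)).
Proof.
move=> cn.
apply: computable_ext (computable_iter
  (f := fun q : C * seq nat => rcons q.2 (size q.2)) (a := fun _ => [::]) cn _ _) _.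
- by apply: crcons; [|apply: csize]; comp_proj.
- exact: computable_const.
- move=> c /=; elim: (n c) => // k IHk.
  by rewrite iterS IHk size_iota -cats1 -[in RHS]addn1 iotaD.
Qed.

Section Finite.

Lemma rec1_table d (s : seq nat) : rec1 (nth d s).
Proof.
elim: s => [|x s IHs].
  by apply: rec_ext (rec_const 1 d) _ => v; rewrite nth_nil.
apply: (@rec_ext 1 (fun v =>
  if nth 0 v 0 == 0 then x else nth d s (nth 0 v 0).-1)).
  apply: rec_if (rec_nth _) (rec_const _ x) _ => //.
  by apply: rec1_comp IHs _; apply: rec1_comp rec_pred _; apply: rec_nth.
by move=> v /=; case: (nth 0 v 0).
Qed.

Variable F : finType.

Definition fin_bound := (\max_(x : F) pickle x).+1.

Lemma pickle_lt_bound (x : F) : pickle x < fin_bound.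
Proof. by rewrite ltnS (leq_bigmax x). Qed.

(** A finite table of codes. *)
Lemma computable_fin (T : countType) (f : F -> T) : computable f.
Proof.
pose s := mkseq (fun i => oapp (fun x => pickle (f x)) 0 (unpickle i)) fin_bound.
apply: (computableP (rec1_table 0 s)) => x.
by rewrite nth_mkseq ?pickle_lt_bound // pickleK.
Qed.

Lemma computable_fin_case (C T : countType) (f : F -> C -> T) (a : C -> F) :
  (forall x, computable (f x)) -> computable a -> computable (fun c => f (a c) c).
Proof.
move=> cf ca.
suff c : forall r : seq F, forall b : C -> T, computable b ->
    computable (fun c => foldr (fun x y => if a c == x then f x c else y) (b c) r).
  case: (pickP F) => [x0 _|F0].
    apply: computable_ext (c (enum F) (f x0) (cf x0)) _ => x.
    have: a x \in enum F by rewrite mem_enum.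
    elim: (enum F) => //= y r IHr; rewrite inE.
    by case: eqP => [<- //|_] /= /IHr.
  by apply: computableP rec1_id _ => x; have:= F0 (a x).
elim=> [|x r IHr] b cb //=; apply: computable_if (cf x) (IHr _ cb).
exact: computable_eq ca (computable_const _ _).
Qed.

End Finite.

(** * Unbounded search and integer arithmetic *)

Section Search.

(** A finite function is coded by its graph. *)
Lemma cffun (C rT : countType) (aT : finType) (F : aT -> C -> rT) :
  (forall x, computable (F x)) -> computable (fun c => [ffun x => F x c]).
Proof.
move=> cF.
have [g rg gP] : exists2 g, rec1 g & forall c,
    g (pickle c) = pickle [seq (x, F x c) | x <- enum aT].
  apply: computable_code; elim: (enum aT) => [|x r IHr].
    exact: computable_const.
  apply: computable_cons IHr; apply: computable_pair (cF x).
  exact: computable_const.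
apply: (computableP rg) => c; rewrite gP.
rewrite -[RHS]/(CodeSeq.code (map pickle (tfgraph [ffun x => F x c]))).
rewrite -[LHS]/(CodeSeq.code (map pickle [seq (x, F x c) | x <- enum aT])).
congr CodeSeq.code; rewrite -codom_tffun codomE.
elim: (enum aT) => //= x r ->; congr (_ :: _).
by rewrite /total_fun ffunE.
Qed.

(** The search for [n] given [c] is a minimization over numbers standing for
    [c] through the decoder. *)
Lemma csearch (C : countType) (r : nat -> C) (p : C * nat -> bool)
    (ex_p : forall c, exists n, p (c, n)) :
  computable r -> (forall c, r (pickle c) = c) -> computable p ->
  computable (fun c => ex_minn (ex_p c)).
Proof.
move=> /computable_code[R rR RP] rK /computable_code[P rP PP].
apply: (@computableP _ _ _ (fun v => ex_minn (ex_p (r v)))); last first.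
  by move=> c; rewrite rK.
apply: (@rec1_min (fun k v => 1 - P (cons_code (R v) (cons_code k 0)))).
- apply: rec2_comp rec_sub (rec_const _ _) _; apply: rec1_comp rP _.
  apply: rec2_comp rec_cons_code _ _; first exact: rec1_comp rR (rec_nth _).
  exact: rec2_comp rec_cons_code (rec_nth _) (rec_const _ _).
- move=> v; case: ex_minnP => n pn _.
  rewrite (RP v : R v = _) -[cons_code _ _]/(pickle (r v, n)) PP.
  by rewrite pn.
- move=> v k; case: ex_minnP => n pn n_min ltkn.
  rewrite (RP v : R v = _) -[cons_code _ _]/(pickle (r v, k)) PP.
  case pk: (p _) => //=.
  by have := n_min _ pk; rewrite leqNgt ltkn.
Qed.

(** Minimization has to succeed at every number, even one that codes no input;
    a decoder replaces such numbers by inputs. *)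
Definition decodable (T : countType) :=
  exists2 r : nat -> T, computable r & forall x, r (pickle x) = x.

Lemma decodable_fin (F : finType) (x0 : F) : decodable F.
Proof.
exists (fun n => odflt x0 (pickle_inv n)); last by move=> x; rewrite pickleK_inv.
pose s := mkseq (fun i => pickle (odflt x0 (pickle_inv i))) (fin_bound F).
apply: (computableP (rec1_table (pickle x0) s)) => n /=.
have [ltn | len] := ltnP n (fin_bound F); first by rewrite nth_mkseq.
rewrite nth_default ?size_mkseq //; congr pickle.
have := @pickle_invK F n; case: (pickle_inv n) => [x|] //= en.
have := pickle_lt_bound x.
by rewrite en ltnNge len.
Qed.

Lemma decodable_seq (T : countType) : decodable T -> decodable (seq T).
Proof.
move=> [r cr rK]; exists (fun n => map r (CodeSeq.decode n)).
  apply: (cmap (f := fun q : nat * nat => r q.2)); first exact: computable_decode.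
  by apply: computable_comp cr _; comp_proj.
move=> s; rewrite CodeSeq.codeK -map_comp -[RHS]map_id.
by apply: eq_map => x /=.
Qed.

Lemma decodable_pair (T1 T2 : countType) :
  decodable T1 -> decodable T2 -> decodable (T1 * T2)%type.
Proof.
move=> [r1 cr1 r1K] [r2 cr2 r2K].
exists (fun n => (r1 (head_code n), r2 (head_code (tail_code n)))).
  apply: computable_pair; first exact: computable_comp cr1 (computable_nat1 rec_head_code).
  apply: computable_comp cr2 (computable_nat1 (F := fun n => head_code (tail_code n)) _).
  exact: rec1_comp rec_head_code rec_tail_code.
move=> [x y]; rewrite [pickle (x, y)]/(cons_code (pickle x) (cons_code (pickle y) 0)).
by rewrite (cons_codeK _ _).2 !(cons_codeK _ _).1 r1K r2K.
Qed.

End Search.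

(** Integer-valued algorithms produce a difference of two natural numbers, so
    that congruences can be decided without coding integers. *)
Definition icomputable (C : countType) (f : C -> int) :=
  exists p n : C -> nat,
    [/\ computable p, computable n & forall c, f c = ((p c)%:Z - (n c)%:Z)%R].

Section IntComputable.
Variable C : countType.
Local Open Scope ring_scope.

Lemma icomp_ext (f g : C -> int) : icomputable f -> f =1 g -> icomputable g.
Proof. by move=> [p [n [cp cn fE]]] fg; exists p, n; split=> // c; rewrite -fg. Qed.

Lemma icomp_nat (f : C -> nat) : computable f -> icomputable (fun c => (f c)%:Z).
Proof.
move=> cf; exists f, (fun _ => 0%N); split=> // [|c]; first exact: computable_const.
by rewrite subr0.
Qed.

Lemma icomp_opp (f : C -> int) : icomputable f -> icomputable (fun c => - f c).
Proof.
by move=> [p [n [cp cn fE]]]; exists n, p; split=> // c; rewrite fE opprB.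
Qed.

Lemma icomp_add (f g : C -> int) : icomputable f -> icomputable g ->
  icomputable (fun c => f c + g c).
Proof.
move=> [p [n [cp cn fE]]] [q [m [cq cm gE]]].
exists (fun c => p c + q c)%N, (fun c => n c + m c)%N.
split; [exact: cadd | exact: cadd |].
by move=> c; rewrite fE gE !PoszD; ring.
Qed.

Lemma icomp_sub (f g : C -> int) : icomputable f -> icomputable g ->
  icomputable (fun c => f c - g c).
Proof. by move=> cf cg; apply: icomp_add cf (icomp_opp cg). Qed.

Lemma icomp_mul (f g : C -> int) : icomputable f -> icomputable g ->
  icomputable (fun c => f c * g c).
Proof.
move=> [p [n [cp cn fE]]] [q [m [cq cm gE]]].
exists (fun c => p c * q c + n c * m c)%N, (fun c => p c * m c + n c * q c)%N.
split; [by apply: cadd; apply: cmul | by apply: cadd; apply: cmul |].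
by move=> c; rewrite fE gE !PoszD !PoszM; ring.
Qed.

Lemma icomp_const z : icomputable (fun _ : C => z).
Proof.
case: z => n; first exact: (icomp_nat (computable_const _ n)).
exact: (icomp_opp (icomp_nat (computable_const _ n.+1))).
Qed.

Lemma icomp_sum (I : Type) (r : seq I) (P : pred I) (F : I -> C -> int) :
  (forall i, icomputable (F i)) -> icomputable (fun c => \sum_(i <- r | P i) F i c).
Proof.
move=> cF; elim: r => [|i r IHr].
  by apply: icomp_ext (icomp_const 0) _ => c; rewrite big_nil.
case Pi: (P i); last by apply: icomp_ext IHr _ => c; rewrite big_cons Pi.
by apply: icomp_ext (icomp_add (cF i) IHr) _ => c; rewrite big_cons Pi.
Qed.

Lemma icomp_prod (I : Type) (r : seq I) (P : pred I) (F : I -> C -> int) :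
  (forall i, icomputable (F i)) -> icomputable (fun c => \prod_(i <- r | P i) F i c).
Proof.
move=> cF; elim: r => [|i r IHr].
  by apply: icomp_ext (icomp_const 1) _ => c; rewrite big_nil.
case Pi: (P i); last by apply: icomp_ext IHr _ => c; rewrite big_cons Pi.
by apply: icomp_ext (icomp_mul (cF i) IHr) _ => c; rewrite big_cons Pi.
Qed.

Lemma icomp_det n (A : C -> 'M[int]_n) :
  (forall i j, icomputable (fun c => A c i j)) -> icomputable (fun c => \det (A c)).
Proof.
move=> cA; apply: icomp_sum => s; apply: icomp_mul; first exact: icomp_const.
by apply: icomp_prod.
Qed.

Lemma cdvdz (f : C -> int) (m : C -> nat) :
  icomputable f -> computable m -> computable (fun c => (m c %| f c)%Z).
Proof.
move=> [p [n [cp cn fE]]] cm.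
apply: computable_ext (computable_eq (cmod cp cm) (cmod cn cm)) _ => c.
by rewrite fE -eqz_mod_dvd !modz_nat.
Qed.

End IntComputable.

(** * Cancellation in cyclic words *)

Section Cyclic.
Variable G : sgraph.
Implicit Types (u v w p q r : word G) (x y l : vertex G * bool).

Definition linv l : vertex G * bool := (l.1, ~~ l.2).
Definition com l l' := adj l.1 l'.1.

Lemma linvK : involutive linv. Proof. by case=> x b; rewrite /linv negbK. Qed.

Lemma com_sym x y : com x y = com y x. Proof. exact: adj_sym. Qed.

Lemma com_linv x y : com (linv x) y = com x y. Proof. by []. Qed.

Lemma com_linvr x y : com x (linv y) = com x y. Proof. by []. Qed.

Lemma com_irr x : com x x = false. Proof. exact: adj_irr. Qed.

(** Cyclic words up to commutations. All moves act at the head of the word, so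
    that inductions follow one move at a time; symmetry is derived. *)
Inductive ceq : word G -> word G -> Prop :=
| ceq_refl w : ceq w w
| ceq_rot w w' : ceq (rot 1 w) w' -> ceq w w'
| ceq_swap x y r w' : com x y -> ceq (y :: x :: r) w' -> ceq (x :: y :: r) w'.

Lemma ceq_trans v u w : ceq u v -> ceq v w -> ceq u w.
Proof.
by elim=> // {u v} => [u v _ IH /IH|x y r v xy _ IH /IH];
  [apply: ceq_rot | apply: ceq_swap].
Qed.

Lemma ceq_rotn n w : ceq w (rot n w).
Proof.
have [le_n|lt_n] := leqP n (size w); last first.
  by rewrite rot_oversize ?(ltnW lt_n) //; apply: ceq_refl.
elim: n le_n => [|n IHn] lt_n; first by rewrite rot0; apply: ceq_refl.
rewrite -add1n rotD //; apply: ceq_trans (IHn (ltnW lt_n)) _.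
exact: ceq_rot (ceq_refl _).
Qed.

Lemma ceq_catC u v : ceq (u ++ v) (v ++ u).
Proof. by rewrite -[v ++ u](rot_size_cat u v); apply: ceq_rotn. Qed.

Lemma ceq_sym u v : ceq u v -> ceq v u.
Proof.
elim=> {u v} => [w|u v _ IH|x y r v xy _ IH]; first exact: ceq_refl.
  apply: ceq_trans IH _; rewrite -[u in ceq _ u]cat0s -(drop0 u).
  case: u => [|x u]; first exact: ceq_refl.
  by rewrite rot1_cons -cats1; apply: ceq_catC [:: x].
by apply: ceq_trans IH _; apply: ceq_swap; [rewrite com_sym | apply: ceq_refl].
Qed.

Lemma ceq_swap_in a c x y : com x y ->
  ceq (a ++ x :: y :: c) (a ++ y :: x :: c).
Proof.
move=> xy; apply: ceq_trans (ceq_catC _ _) _.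
apply: ceq_trans (ceq_catC (y :: x :: c) a).
exact: ceq_swap xy (ceq_refl _).
Qed.

Lemma ceq_move a p l c : all (com l) p -> ceq (a ++ l :: p ++ c) (a ++ p ++ l :: c).
Proof.
elim: p a => [|y p IHp] a /=; first by move=> _; apply: ceq_refl.
case/andP=> ly lp; apply: ceq_trans (ceq_swap_in _ _ ly) _.
by have := IHp (rcons a y) lp; rewrite !cat_rcons.
Qed.

Lemma size_ceq u v : ceq u v -> size u = size v.
Proof. by elim=> // {u v} [u v _ <-]; rewrite size_rot. Qed.

(** Adding cancellations makes the moves irreversible: conjugate words will be
    those that have a common descendant. *)
Inductive reach : word G -> word G -> Prop :=
| reach_refl w : reach w w
| reach_rot w w' : reach (rot 1 w) w' -> reach w w'
| reach_swap x y r w' : com x y -> reach (y :: x :: r) w' -> reach (x :: y :: r) w'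
| reach_cancel x r w' : reach r w' -> reach (x :: linv x :: r) w'.

Lemma ceq_reach u v : ceq u v -> reach u v.
Proof.
by elim=> {u v}; [apply: reach_refl | move=> *; apply: reach_rot |
  move=> *; apply: reach_swap].
Qed.

Lemma reach_trans v u w : reach u v -> reach v w -> reach u w.
Proof.
by elim=> // {u v} => [u v _ IH /IH|x y r v xy _ IH /IH|x r v _ IH /IH];
  [apply: reach_rot | apply: reach_swap | apply: reach_cancel].
Qed.

Lemma size_reach u v : reach u v -> size v <= size u.
Proof.
elim=> // {u v} => [u v _|x r v _ IH]; first by rewrite size_rot.
by rewrite (leq_trans IH) //= -addn2 leq_addr.
Qed.

(** A cancellable pair of a cyclic word: two mutually inverse letters, one of
    the two arcs between them consisting of letters commuting with them. *)
Definition cancels w r := exists a m c l,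
  [/\ w = a ++ l :: m ++ linv l :: c,
      all (com l) m || all (com l) (c ++ a) & ceq r (a ++ m ++ c)].

Lemma cancels_rot w r : cancels w r -> cancels (rot 1 w) r.
Proof.
move=> [a [m [c [l [-> cm rE]]]]]; case: a => [|y a] in cm rE *.
  rewrite /= rot1_cons -cats1 -catA /=; exists m, c, [::], (linv l).
  split; first by rewrite linvK.
    by rewrite orbC; move: cm; rewrite cats0.
  by rewrite cats0.
rewrite /= rot1_cons; exists a, m, (rcons c y), l; split.
- by rewrite rcons_cat /= rcons_cat.
- by rewrite cat_rcons.
- have -> : a ++ m ++ rcons c y = (a ++ m ++ c) ++ [:: y].
    by rewrite -cats1 !catA.
  exact: ceq_trans rE (ceq_catC [:: y] _).
Qed.

Lemma cancels_swap x y s r :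
  com x y -> cancels (x :: y :: s) r -> cancels (y :: x :: s) r.
Proof.
move=> xy [[|x' [|y' a]] [m [c [l []]]]] /=.
- case: m => [|z m] [xl yl sE].
    by move: xy; rewrite xl yl com_linvr com_irr.
  subst x y s; rewrite /= cats0 xy /= => cm rE.
  exists [:: z], m, c, l; split=> //.
  by rewrite all_cat /= xy !andbT.
- move=> [xx' yl sE]; subst x' y s => cm rE; exists [::], (x :: m), c, l.
  split=> //; move: cm; rewrite cats0 all_cat /= (com_sym l x) xy.
  by case/orP=> [->|/andP[-> _]] //; rewrite orbT.
- move=> [<- <- ->] cm rE; exists [:: y, x & a], m, c, l; split=> //.
    by move: cm; rewrite !all_cat /= [com l x && _]andbCA.
  exact: ceq_trans rE (ceq_swap xy (ceq_refl _)).
Qed.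

(** Cancellable pairs are a property of the cyclic word up to commutations, so
    that no move other than a cancellation has to be followed. *)
Lemma cancels_ceq u v r : ceq u v -> cancels u r -> cancels v r.
Proof.
by elim=> {u v} // => [u v _ IH /cancels_rot /IH|x y s v xy _ IH /(cancels_swap xy)/IH].
Qed.

Lemma cancels_reach w r : cancels w r -> reach w r.
Proof.
move=> [a [m [c [l [-> cm rE]]]]].
case/orP: cm => cm.
  apply: (@reach_trans (l :: linv l :: c ++ a ++ m)).
    apply: ceq_reach; apply: ceq_trans (ceq_move a _ cm) _; rewrite catA.
    exact: ceq_catC.
  apply: reach_cancel; apply: ceq_reach; apply: ceq_sym; apply: ceq_trans rE _.
  by rewrite catA; apply: ceq_catC.
apply: (@reach_trans (linv l :: l :: (c ++ a) ++ m)).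
  apply: ceq_reach; apply: (@ceq_trans (linv l :: (c ++ a) ++ l :: m)).
    have -> : a ++ l :: m ++ linv l :: c = (a ++ l :: m) ++ linv l :: c.
      by rewrite -catA.
    by apply: ceq_trans (ceq_catC _ _) _; rewrite /= catA; apply: ceq_refl.
  exact: ceq_sym (ceq_move [:: linv l] m cm).
rewrite -{2}[l]linvK; apply: reach_cancel; apply: ceq_reach; apply: ceq_sym.
by apply: ceq_trans rE _; rewrite -catA catA; apply: ceq_catC.
Qed.

(** Two cancellations from the same cyclic word can be completed to a common
    descendant; the only nontrivial overlap is a letter squeezed between two
    of its inverses, where both cancellations leave the same cyclic word. *)
Lemma cancels_join y s r :
  cancels (y :: linv y :: s) r -> exists2 t, reach s t & reach r t.
Proof.
move E: (linv y) => y' [[|y1 [|y2 a]] [m [c [l []]]]] /=.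
- case: m => [|z m] [yl y'z sE].
    by move=> _ /= /ceq_reach rE; exists s; [apply: reach_refl | rewrite sE].
  subst l z s; rewrite /= -E com_linvr com_irr /= cats0 => cm rE.
  exists r; last exact: reach_refl.
  apply: ceq_reach; apply: ceq_sym; apply: ceq_trans rE _.
  apply: ceq_trans (ceq_catC [:: linv y] _) _; rewrite -catA.
  by have := ceq_sym (@ceq_move m c (linv y) [::] cm); rewrite cats0.
- move=> [yy1 y'l sE]; subst y1 l s.
  rewrite -E linvK all_cat /= com_linv com_irr andbF orbF => cm rE.
  exists r; last exact: reach_refl.
  apply: ceq_reach; apply: ceq_sym; apply: ceq_trans rE _ => /=.
  exact: (@ceq_move [::] m y c cm).
- move=> [yy1 y'y2 sE]; subst y1 y2 s => cm rE; exists (a ++ m ++ c).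
    apply: cancels_reach; exists a, m, c, l; split=> //; last exact: ceq_refl.
    by move: cm; rewrite !all_cat /= => /orP[->//|/and4P[-> _ _ ->]];
      rewrite orbT.
  apply: reach_trans (ceq_reach rE) _; rewrite -E.
  exact: reach_cancel (reach_refl _).
Qed.

Definition joinable u v := exists2 t, reach u t & reach v t.

(** Only the first cancellation on the way matters for confluence. *)
Lemma reach_split u t : reach u t ->
  ceq u t \/ exists x r, ceq u (x :: linv x :: r) /\ reach r t.
Proof.
elim=> {u t} [w|u t _ IH|x y s t xy _ IH|x r t rt _]; first by left; apply: ceq_refl.
- case: IH => [|[x [r [ur rt]]]]; [left; exact: ceq_rot | right].
  by exists x, r; split=> //; apply: ceq_rot.
- case: IH => [|[z [r [ur rt]]]]; [left; exact: ceq_swap | right].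
  by exists z, r; split=> //; apply: ceq_swap.
- by right; exists x, r; split=> //; apply: ceq_refl.
Qed.

(** Newman's argument: two first cancellations are joined by [cancels_join], and
    what follows concerns shorter words. *)
Lemma reach_confluent u t1 t2 : reach u t1 -> reach u t2 -> joinable t1 t2.
Proof.
have [n] := ubnP (size u); elim: n u t1 t2 => // n IHn u t1 t2 le_n ut1 ut2.
case: (reach_split ut1) => [e|[x1 [r1 [e1 rt1]]]].
  by exists t2; [apply: reach_trans (ceq_reach (ceq_sym e)) ut2 | apply: reach_refl].
case: (reach_split ut2) => [e|[x2 [r2 [e2 rt2]]]].
  by exists t1; [apply: reach_refl | apply: reach_trans (ceq_reach (ceq_sym e)) ut1].
have [j r2j r1j] : exists2 j, reach r2 j & reach r1 j.
  apply: (@cancels_join x2); apply: cancels_ceq e2 _.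
  apply: cancels_ceq (ceq_sym e1) _; exists [::], [::], r1, x1.
  by split=> //; apply: ceq_refl.
have lt1 : size r1 < n by move: le_n; rewrite ltnS (size_ceq e1) /=; apply: ltnW.
have lt2 : size r2 < n by move: le_n; rewrite ltnS (size_ceq e2) /=; apply: ltnW.
have [k1 t1k1 jk1] := IHn _ _ _ lt1 rt1 r1j.
have [k2 k1k2 t2k2] := IHn _ _ _ lt2 (reach_trans r2j jk1) rt2.
by exists k2 => //; apply: reach_trans t1k1 k1k2.
Qed.

Lemma joinable_refl u : joinable u u.
Proof. by exists u; apply: reach_refl. Qed.

Lemma joinable_sym u v : joinable u v -> joinable v u.
Proof. by move=> [t ut vt]; exists t. Qed.

Lemma joinable_trans v u w : joinable u v -> joinable v w -> joinable u w.
Proof.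
move=> [s us vs] [t vt letter_coef]; have [k sk tk] := reach_confluent vs vt.
by exists k; [apply: reach_trans us sk | apply: reach_trans letter_coef tk].
Qed.

Lemma reach_joinable u v : reach u v -> joinable u v.
Proof. by move=> uv; exists v => //; apply: reach_refl. Qed.

(** The surrounding words [p] and [q] make the congruence rule provable. *)
Lemma weq_joinable u v : weq u v ->
  forall p q, joinable (p ++ u ++ q) (p ++ v ++ q).
Proof.
elim=> {u v} [w|u v _ IH|u v w _ IH1 _ IH2|u u' v v' _ IH1 _ IH2|x b|x y xy] p q.
- exact: joinable_refl.
- exact: joinable_sym.
- exact: joinable_trans (IH1 _ _) (IH2 _ _).
- rewrite -!catA; apply: joinable_trans (IH1 _ _) _.
  by have := IH2 (p ++ u') q; rewrite -!catA.
- apply: reach_joinable; apply: cancels_reach; exists p, [::], q, (x, b).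
  by split=> //; apply: ceq_refl.
- by apply: reach_joinable; apply: ceq_reach; apply: ceq_swap_in.
Qed.

Definition wconj u v := exists g, weq (g ++ u ++ winv g) v.

Lemma wconj_joinable u v : wconj u v -> joinable u v.
Proof.
move=> [g /weq_joinable/(_ [::] [::])]; rewrite !cats0 /=; apply: joinable_trans.
apply: (@joinable_trans (u ++ winv g ++ g)).
  rewrite -[u in joinable u _]cats0; apply: joinable_sym.
  have := weq_joinable (weq_mulV (winv g)) u [::].
  by rewrite winvK cats0 cats0.
by apply: reach_joinable; apply: ceq_reach; rewrite catA; apply: ceq_catC.
Qed.

End Cyclic.

(** * Conjugacy *)

Section Lists.
Variable T : countType.

Definition lists (s : seq T) n : seq (seq T) :=
  iter n (fun L => flatten [seq [seq x :: w | w <- L] | x <- s]) [:: [::]].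

Lemma mem_lists s n w : (w \in lists s n) = (size w == n) && all [in s] w.
Proof.
elim: n w => [|n IHn] w; first by rewrite inE; case: w.
apply/flatten_mapP/idP => [[x xs /mapP[v]]|].
  by rewrite IHn => /andP[/eqP sv av] ->; rewrite /= sv eqxx xs.
case: w => //= x w; rewrite eqSS => /and3P[sw xs aw]; exists x => //.
by apply: map_f; rewrite IHn sw.
Qed.

Lemma clists (C : countType) (s : C -> seq T) (n : C -> nat) :
  computable s -> computable n -> computable (fun c => lists (s c) (n c)).
Proof.
move=> cs cn; apply: (computable_iter
  (f := fun q : C * seq (seq T) => flatten [seq [seq x :: w | w <- q.2] | x <- s q.1])
  (a := fun _ => [:: [::]])) => //; last exact: computable_const.
apply: cflatten; apply: (cmap (s := fun q : C * seq (seq T) => s q.1)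
  (f := fun r : (C * seq (seq T)) * T => [seq r.2 :: w | w <- r.1.2])).
  by apply: computable_comp cs _; comp_proj.
apply: (cmap (s := fun r : (C * seq (seq T)) * T => r.1.2)
  (f := fun t : ((C * seq (seq T)) * T) * seq T => t.1.2 :: t.2)).
  by comp_proj.
by apply: computable_cons; comp_proj.
Qed.

End Lists.

Section GroupMorphism.
Local Open Scope group_scope.
Variables (gT : groupType) (alpha : gT -> gT).
Hypothesis alphaM : {morph alpha : x y / x * y}.

Lemma gmorph1 : alpha 1 = 1.
Proof. by apply: (mulgI (alpha 1)); rewrite -alphaM !mulg1. Qed.

Lemma gmorphV x : alpha x^-1 = (alpha x)^-1.
Proof. by apply: (mulIg (alpha x)); rewrite mulVg -alphaM mulVg gmorph1. Qed.

Lemma gmorphJ x y : alpha (x ^ y) = alpha x ^ alpha y.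
Proof. by rewrite !conjgE !alphaM gmorphV. Qed.

End GroupMorphism.

Section Conjugacy.
Variable G : sgraph.
Local Open Scope group_scope.
Implicit Types (u v w p q r : word G) (x y l : vertex G * bool).

Lemma wvalM u v : wval (u ++ v) = wval u * wval v.
Proof. by rewrite [RHS]raag_mulE. Qed.

Lemma wvalV u : wval (winv u) = (wval u)^-1.
Proof. by rewrite [RHS]raag_invE. Qed.

Lemma wval0 : @wval G [::] = 1. Proof. by []. Qed.

Lemma weqP u v : weq u v <-> wval u = wval v.
Proof. exact: raag_piP. Qed.

Lemma wval_repr (g : raag G) : wval (repr g) = g.
Proof. exact: reprK. Qed.

Definition conjw u v := exists h : raag G, wval v = wval u ^ h.

Lemma conjw_refl u : conjw u u.
Proof. by exists 1; rewrite conjg1. Qed.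

Lemma conjw_sym u v : conjw u v -> conjw v u.
Proof. by move=> [h vE]; exists h^-1; rewrite vE conjgK. Qed.

Lemma conjw_trans v u w : conjw u v -> conjw v w -> conjw u w.
Proof. by move=> [h vE] [k wE]; exists (h * k); rewrite conjgM -vE. Qed.

Lemma conjw_catC u v : conjw (u ++ v) (v ++ u).
Proof. by exists (wval u); rewrite !wvalM conjgE !mulgA mulVg mul1g. Qed.

Lemma weq_conjw u v : weq u v -> conjw u v.
Proof. by move/weqP=> e; exists 1; rewrite conjg1. Qed.

Lemma weq_swap x y : com x y -> weq [:: x; y] [:: y; x].
Proof.
move=> xy.
have base (a b : G) : adj a b -> commute (gen a) (gen b).
  move=> ab; rewrite /commute -!wvalM; apply/weqP; exact: weq_adj.
have letter (l : vertex G * bool) : wval [:: l] = if l.2 then gen l.1 else (gen l.1)^-1.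
  by case: l => a []; rewrite //= -wvalV.
apply/weqP; rewrite -[[:: x; y]]/([:: x] ++ [:: y]) -[[:: y; x]]/([:: y] ++ [:: x]).
rewrite !wvalM !letter -/(commute _ _); have c := base _ _ xy.
case: x.2 y.2 => [] []; rewrite //; first exact: commuteV.
  exact/commute_sym/commuteV/commute_sym.
exact/commuteV/commute_sym/commuteV/commute_sym.
Qed.

Lemma reach_conjw u v : reach u v -> conjw u v.
Proof.
elim=> {u v} [w|w v _|x y r v xy _|x r v _]; first exact: conjw_refl.
- apply: conjw_trans; rewrite -[w in conjw w _](cat_take_drop 1).
  exact: conjw_catC.
- apply: conjw_trans; apply: weq_conjw.
  exact: weq_cat (weq_swap xy) (weq_refl r).
- apply: conjw_trans; apply: weq_conjw; case: x => a b.
  exact: weq_cat (weq_cancel a b) (weq_refl r).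
Qed.

Lemma conjwP u v : conjw u v <-> joinable u v.
Proof.
split=> [[h e]|[t ut vt]]; last first.
  exact: conjw_trans (reach_conjw ut) (conjw_sym (reach_conjw vt)).
apply: wconj_joinable; exists (winv (repr h)); apply/weqP.
by rewrite !wvalM winvK wvalV wval_repr e conjgE.
Qed.

(** Without cancellable pairs, a descendant is a permutation of the letters,
    so that no conjugate is shorter. *)
Lemma cancel_free_min u v :
  (forall r, ~ cancels u r) -> conjw u v -> size u <= size v.
Proof.
move=> free /conjwP[t ut /size_reach]; apply: leq_trans.
case: (reach_split ut) => [/size_ceq -> //|[x [r [e _]]]].
case: (free r); apply: cancels_ceq (ceq_sym e) _; exists [::], [::], r, x.
by split=> //; apply: ceq_refl.
Qed.

Lemma min_cancel_free u : (forall v, conjw u v -> size u <= size v) ->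
  forall r, ~ cancels u r.
Proof.
move=> umin r c.
have [a [m [d [l [uE _ rE]]]]] := c.
have /umin := reach_conjw (cancels_reach c).
rewrite (size_ceq rE) uE !size_cat /= size_cat /=.
by rewrite leqNgt !(addnS, addSn) ltnS !addnA ltnW.
Qed.

Definition moves w : seq (word G) :=
  rot 1 w :: if w is x :: w' then if w' is y :: r then
    (if com x y then [:: y :: x :: r] else [::]) ++
    (if y == linv x then [:: r] else [::]) else [::] else [::].

Lemma moves_reach u v : v \in moves u -> reach u v.
Proof.
rewrite inE => /orP[/eqP ->|]; first by apply: reach_rot; apply: reach_refl.
case: u => [|x [|y r]] //; rewrite mem_cat => /orP[].
  by case: ifP => // xy; rewrite inE => /eqP ->; apply: reach_swap; last apply: reach_refl.
by case: eqP => // -> /[!inE] /eqP ->; apply: reach_cancel; apply: reach_refl.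
Qed.

Lemma reach_path u v : reach u v ->
  exists2 p, path (fun a b => b \in moves a) u p & v = last u p.
Proof.
elim=> {u v} [w|u v _ [p pp ->]|x y r v xy _ [p pp ->]|x r v _ [p pp ->]].
- by exists [::].
- by exists (rot 1 u :: p); rewrite //= pp mem_head.
- exists ([:: y, x & r] :: p) => //=; rewrite pp andbT inE mem_cat.
  by rewrite xy mem_head orbT.
- exists (r :: p) => //=; rewrite pp andbT inE mem_cat eqxx.
  by rewrite mem_head !orbT.
Qed.

Definition words_upto n : seq (word G) :=
  flatten [seq lists (enum {: vertex G * bool}) i | i <- iota 0 n.+1].

Lemma mem_words_upto n w : (w \in words_upto n) = (size w <= n).
Proof.
apply/flatten_mapP/idP => [[i]|le_n].
  by rewrite mem_iota ltnS mem_lists => lin /andP[/eqP ->].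
exists (size w); first by rewrite mem_iota ltnS.
by rewrite mem_lists eqxx; apply/allP => x _; rewrite mem_enum.
Qed.

Definition expand (L : seq (word G)) := L ++ flatten [seq moves w | w <- L].

(** A chain of moves without repetition stays among the words that are no longer
    than [u], and their number bounds its length. *)
Definition descendants u := iter (size (words_upto (size u))) expand [:: u].

Lemma mem_descendants u v : v \in descendants u <-> reach u v.
Proof.
split.
  rewrite /descendants; elim: (size _) v => [|n IHn] v.
    by rewrite inE => /eqP ->; apply: reach_refl.
  rewrite iterS mem_cat => /orP[/IHn //|/flatten_mapP[w /IHn uw /moves_reach]].
  exact: reach_trans.
have iterP n (p : seq (word G)) L w : w \in L -> path (fun a b => b \in moves a) w p -> size p <= n ->
    last w p \in iter n expand L.
  elim: n p L w => [|n IHn] [|x p] L w //= wL.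
    by move=> _ _; rewrite mem_cat (IHn [::]).
  case/andP=> xw pp sp; rewrite -iterS iterSr; apply: IHn => //.
  by rewrite mem_cat; apply/orP; right; apply/flatten_mapP; exists w.
have small n (p : seq (word G)) w0 : size w0 <= n ->
    path (fun a b => b \in moves a) w0 p -> {in p, forall w, size w <= n}.
  elim: p w0 => //= x p IHp w0 s0 /andP[/moves_reach/size_reach sx pp] w.
  have sxn := leq_trans sx s0; rewrite inE => /orP[/eqP -> //|].
  exact: IHp sxn pp _.
case/reach_path=> p pp ->; have [p' pp' /= /andP[_ up] _] := shortenP pp.
apply: iterP => //; first exact: mem_head.
apply: uniq_leq_size up _ => w; rewrite mem_words_upto; exact: (small _ _ _ (leqnn _) pp' w).
Qed.

Definition conjb u v := has [in descendants v] (descendants u).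

Lemma conjbP u v : reflect (conjw u v) (conjb u v).
Proof.
apply: (iffP hasP) => [[t /mem_descendants ut /mem_descendants vt]|/conjwP[t ut vt]].
  by apply/conjwP; exists t.
by exists t; [apply/mem_descendants | apply/mem_descendants].
Qed.

Definition shortest u := head u [seq w <- words_upto (size u) | conjb u w &&
  all (fun v => conjb u v ==> (size w <= size v)) (words_upto (size u))].

Lemma shortestP u : conjw u (shortest u) /\
  forall v, conjw u v -> size (shortest u) <= size v.
Proof.
set W := words_upto (size u).
have uW : u \in W by rewrite mem_words_upto.
have [m mP mmin] : exists2 m, exists2 w, conjw u w & size w = m &
    forall v, conjw u v -> m <= size v.
  have ex : exists n, has (fun w => conjb u w && (size w == n)) W.
    by exists (size u); apply/hasP; exists u; rewrite // eqxx andbT; apply/conjbP/conjw_refl.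
  exists (ex_minn ex); case: ex_minnP => n /hasP[w _ /andP[/conjbP uw /eqP sw]] nmin.
    by exists w.
  move=> v uv; have [le|/ltnW lt] := leqP (size v) (size u).
    apply: nmin; apply/hasP; exists v; first by rewrite mem_words_upto.
    by rewrite eqxx andbT; apply/conjbP.
  apply: leq_trans lt; apply: nmin; apply/hasP; exists u => //.
  by rewrite eqxx andbT; apply/conjbP/conjw_refl.
case: mP => w0 uw0 sw0; rewrite /shortest -/W; set P := (X in filter X _).
have: w0 \in filter P W.
  rewrite mem_filter mem_words_upto sw0 mmin ?andbT; last exact: conjw_refl.
  apply/andP; split; first exact/conjbP.
  by apply/allP => v _; apply/implyP => /conjbP /mmin; rewrite sw0.
have: all P (filter P W) by apply: filter_all.
case: (filter P W) => //= w F /andP[/andP[/conjbP uw /allP wmin] _] _; split=> // v uv.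
apply: leq_trans (mmin _ uv); rewrite -sw0.
apply: (implyP (wmin w0 _)); last exact/conjbP.
by rewrite mem_words_upto sw0 mmin //; apply: conjw_refl.
Qed.

End Conjugacy.

(** * Gap labels *)

Section Gaps.
Variables (G : sgraph) (a : G).
Implicit Types (u v w p q r : word G) (x y l : vertex G * bool) (b c d : G).

(** The letters of the class commute with each other and with all others that
    are not in N. *)
Definition isK l := l.1 \in star_class a.
Definition isN l := l.1 \notin star a.

Lemma isKE l : isK l = (l.1 \in star_class a). Proof. by []. Qed.

Lemma isNE l : isN l = (l.1 \notin star a). Proof. by []. Qed.

Lemma star_classP b : b \in star_class a -> star b = star a.
Proof. by rewrite inE => /eqP. Qed.

Lemma mem_star b : b \in star b. Proof. by rewrite inE eqxx. Qed.

Lemma class_star b : b \in star_class a -> b \in star a.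
Proof. by move/star_classP <-; apply: mem_star. Qed.

Lemma class_adj b c : b \in star_class a -> c \in star a -> (b != c) -> adj b c.
Proof.
by move/star_classP <-; rewrite inE eq_sym => /orP[->|].
Qed.

Lemma class_notN b c : b \in star_class a -> adj b c -> c \in star a.
Proof. by move/star_classP <-; rewrite inE => ->; rewrite orbT. Qed.

Lemma isK_notN l : isK l -> ~~ isN l.
Proof. by rewrite negbK; apply: class_star. Qed.

Definition skel w := [seq l <- w | ~~ isK l].
Definition nN w := count isN w.

Lemma nNE w : nN w = count isN w. Proof. by []. Qed.

Lemma skel_cat u v : skel (u ++ v) = skel u ++ skel v.
Proof. exact: filter_cat. Qed.

Lemma nN_cat u v : nN (u ++ v) = nN u + nN v.
Proof. exact: count_cat. Qed.

Lemma nN_skel w : nN (skel w) = nN w.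
Proof.
rewrite /nN /skel count_filter; apply: eq_count => l /=.
by case: (boolP (isN l)) => //= Nl; apply/negP => /isK_notN; rewrite Nl.
Qed.

(** The gap of index [i] lies between the letters of N of ranks [i] and [i + 1];
    its letters belong to the star, so the class commutes with them. *)
Fixpoint gapcount l i w : nat :=
  if w is y :: w' then
    if isN y then (if i is i'.+1 then gapcount l i' w' else 0)
    else ((i == 0) && (y == l)) + gapcount l i w'
  else 0.

Lemma gapcount_cat l i u v : gapcount l i (u ++ v) =
  gapcount l i u + (if nN u <= i then gapcount l (i - nN u) v else 0).
Proof.
elim: u i => [|y u IHu] i /=; first by rewrite subn0.
case: ifP => Ny; last by rewrite IHu addnA.
by case: i => [|i] //=; rewrite IHu add1n ltnS subSS.
Qed.

Lemma gapcount_gt l i w : nN w < i -> gapcount l i w = 0.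
Proof.
elim: w i => //= y w IHw i; case: ifP => Ny /=.
  by case: i => // i; rewrite add1n ltnS; apply: IHw.
by rewrite add0n => lt_i; rewrite IHw // gtn_eqF ?(leq_trans _ lt_i).
Qed.

Local Open Scope ring_scope.

Definition gsum c i w : int := (gapcount (c, true) i w)%:Z - (gapcount (c, false) i w)%:Z.

Lemma gsumE c i w : gsum c i w = (gapcount (c, true) i w)%:Z - (gapcount (c, false) i w)%:Z.
Proof. by []. Qed.

Lemma gsum_nil c i : gsum c i [::] = 0. Proof. by []. Qed.

Lemma gsum_cat c i u v : gsum c i (u ++ v) =
  gsum c i u + (if (nN u <= i)%N then gsum c (i - nN u) v else 0).
Proof. by rewrite /gsum !gapcount_cat; case: ifP => _; rewrite ?PoszD; lia. Qed.

Lemma gsum_gt c i w : (nN w < i)%N -> gsum c i w = 0.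
Proof. by move=> lt_i; rewrite /gsum !gapcount_gt. Qed.

Definition sg (b : bool) : int := if b then 1 else -1.

Lemma gsum_cons c i y w : gsum c i (y :: w) =
  if isN y then (if i is i'.+1 then gsum c i' w else 0)
  else (if (i == 0%N) && (y.1 == c) then sg y.2 else 0) + gsum c i w.
Proof.
rewrite /gsum /=; case: (isN y); first by case: i.
case: y => y t /=; rewrite !xpair_eqE; case: (i == 0%N) => //=; last first.
  by rewrite !add0n add0r.
by case: (y == c); case: t => //=; rewrite ?PoszD ?add0n /sg; lia.
Qed.

(** A word for an element of the free abelian group on the class. *)
Definition kword (e : G -> int) : word G :=
  flatten [seq nseq `|e c|%N (c, 0 <= e c) | c <- enum (star_class a)].

Lemma all_kword e : all isK (kword e).
Proof.
apply/allP => l /flattenP[s /mapP[c]]; rewrite mem_enum => cK ->.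
by move/nseqP=> [-> _].
Qed.

Lemma skel_allK w : all isK w -> skel w = [::].
Proof.
by move=> wK; apply/eqP; rewrite -(negbK (_ == _)) -has_filter has_predC wK.
Qed.

Lemma nN_allK w : all isK w -> nN w = 0%N.
Proof. by move=> wK; rewrite -nN_skel skel_allK. Qed.

Lemma gsum_nseq c i n d t : d \in star_class a ->
  gsum c i (nseq n (d, t)) = if (i == 0%N) && (d == c) then sg t *+ n else 0.
Proof.
move=> dK; elim: n => [|n IHn]; first by case: ifP.
rewrite gsum_cons (negbTE (isK_notN _)) // IHn /=.
by case: ifP; rewrite ?mulrS ?addr0.
Qed.

Lemma gsum_kword c i e : gsum c i (kword e) =
  if (i == 0%N) && (c \in star_class a) then e c else 0.
Proof.
rewrite /kword -[c \in _]mem_enum.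
have: {subset enum (star_class a) <= star_class a} by move=> d; rewrite mem_enum.
elim: (enum _) (enum_uniq (star_class a)) => [|d r IHr] /=; first by rewrite andbF.
case/andP=> dr ur sub; have dK : d \in star_class a by rewrite sub ?mem_head.
rewrite gsum_cat nN_allK; last by apply/allP => l /nseqP[-> _].
rewrite leq0n subn0 IHr //; last by move=> z zr; rewrite sub ?inE ?zr ?orbT.
rewrite gsum_nseq // inE; have [->|ndc] /= := eqVneq c d.
  rewrite (negbTE dr) !andbT andbF addr0; case: ifP => // _.
  by case: (e d) => n; rewrite /sg /= ?mulNrn ?NegzE ?natz.
by rewrite andbF add0r.
Qed.

Local Open Scope group_scope.

Definition power c (n : int) : raag G := wval (nseq `|n|%N (c, 0 <= n)%R).

Lemma wval_cons x w : wval (x :: w) = wval [:: x] * wval w.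
Proof. by rewrite -wvalM. Qed.

Lemma powerS c t n : wval [:: (c, t)] * power c n = power c (sg t + n)%R.
Proof.
rewrite -wvalM; apply/weqP; have canc (s : bool) w : weq ([:: (c, s), (c, ~~ s) & w]) w.
  exact: weq_cat (weq_cancel c s) (weq_refl w).
case: t; case: n => [n|n]; rewrite /sg /=.
- by rewrite -PoszD /= add1n; apply: weq_refl.
- case: n => [|n]; first by rewrite /=; apply: (canc true).
  rewrite (_ : (1 + Negz n.+1)%R = Negz n); last by rewrite !NegzE; lia.
  exact: (canc true).
- case: n => [|n]; first exact: weq_refl.
  rewrite (_ : (- 1 + n.+1%:Z)%R = n%:Z); last by lia.
  exact: (canc false).
- rewrite (_ : (- 1 + Negz n)%R = Negz n.+1); last by rewrite !NegzE; lia.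
  exact: weq_refl.
Qed.

Lemma com_commute x y : com x y -> commute (wval [:: x]) (wval [:: y]).
Proof. by move=> xy; rewrite /commute -!wvalM; apply/weqP/weq_swap. Qed.

Lemma commute_word x w : all (com x) w -> commute (wval [:: x]) (wval w).
Proof.
elim: w => [|y w IHw] /=; first by move=> _; rewrite wval0; apply: commute1.
by case/andP=> xy xw; rewrite (wval_cons y); apply: commuteM (com_commute xy) (IHw xw).
Qed.

Lemma kword_cons c t e e' : c \in star_class a ->
  (forall d, d \in star_class a -> e' d = (if d == c then sg t + e d else e d)%R) ->
  wval ((c, t) :: kword e) = wval (kword e').
Proof.
rewrite wval_cons /kword => cK e'E.
have: {subset enum (star_class a) <= star_class a} by move=> d; rewrite mem_enum.
have: c \in enum (star_class a) by rewrite mem_enum.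
elim: (enum _) (enum_uniq (star_class a)) => //= d r IHr.
case/andP=> dr ur; rewrite inE => cr sub.
have dK : d \in star_class a by rewrite sub ?mem_head.
have rK : {subset r <= star_class a} by move=> z zr; rewrite sub ?inE ?zr ?orbT.
rewrite !wvalM e'E //; case/orP: cr => [/eqP cd|cr].
  subst d; rewrite eqxx mulgA powerS; congr (_ * wval (flatten _)).
  by apply/eq_in_map => z zr; rewrite e'E ?rK //; case: eqP dr => // <-; rewrite zr.
have ndc : d != c by apply: contraNneq dr => ->.
rewrite (negbTE ndc) -IHr // !mulgA; congr (_ * _).
apply: commute_word; apply/allP => l /nseqP[-> _].
by apply: class_adj; rewrite ?class_star // eq_sym.
Qed.

(** A normal form, in which the letters of the class are gathered at the
    beginning of each gap. *)
Fixpoint normal_word (s : word G) (e : nat -> G -> int) : word G :=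
  if s is y :: s' then
    if isN y then kword (e 0%N) ++ y :: normal_word s' (fun i => e i.+1)
    else y :: normal_word s' e
  else kword (e 0%N).

Lemma eq_kword e e' : {in star_class a, e =1 e'} -> kword e = kword e'.
Proof.
move=> ee'; rewrite /kword; congr flatten; apply/eq_in_map => c.
by rewrite mem_enum => /ee' ->.
Qed.

Lemma eq_normal_word s e e' : (forall i, {in star_class a, e i =1 e' i}) ->
  normal_word s e = normal_word s e'.
Proof.
elim: s e e' => [|y s IHs] e e' ee' /=; first exact: eq_kword.
by rewrite (eq_kword (ee' 0%N)) (IHs _ _ ee') (IHs (fun i => e i.+1) (fun i => e' i.+1)).
Qed.

Lemma normal_word_cons s c t e : c \in star_class a -> all (predC isK) s ->
  wval ((c, t) :: normal_word s e) =
  wval (normal_word s (fun i d => if (i == 0%N) && (d == c) then sg t + e i d else e i d)%R).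
Proof.
move=> cK; elim: s e => [|y s IHs] e /=; first by move=> _; apply: kword_cons.
case/andP=> Ky Ks; case: ifPn => Ny.
  rewrite -cat_cons !wvalM; congr (_ * _); exact: kword_cons.
rewrite [RHS]wval_cons -IHs // (wval_cons _ (y :: _)) (wval_cons y (normal_word s e)).
rewrite (wval_cons _ (normal_word s e)) !mulgA; congr (_ * _).
apply: com_commute; apply: class_adj => //=; first by rewrite negbK in Ny.
by apply: contraNneq Ky => /= e1; rewrite /isK -e1.
Qed.

(** Letters of the class move to the beginning of their gap. *)
Lemma wval_norm w : wval w = wval (normal_word (skel w) (fun i c => gsum c i w)).
Proof.
elim: w => [|y w IHw] /=.
  rewrite (eq_kword (e' := fun _ => 0%R)) //; congr wval.
  by rewrite /kword; elim: (enum _).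
have [Ky|Ky] := boolP (isK y) => /=.
  rewrite wval_cons IHw -wval_cons; case: y Ky => c t cK.
  rewrite normal_word_cons //; last by apply/allP => l; rewrite mem_filter => /andP[].
  congr wval; apply: eq_normal_word => i d _.
  rewrite gsum_cons (negbTE (isK_notN _)) //= [c == d]eq_sym.
  by case: ifP; rewrite ?add0r.
case: ifP => Ny; last first.
  rewrite wval_cons IHw -wval_cons; congr (wval (_ :: _)).
  apply: eq_normal_word => i d dK; rewrite gsum_cons Ny.
  have /negbTE -> : y.1 != d by apply: contraNneq Ky => e1; rewrite /isK e1.
  by rewrite andbF add0r.
rewrite (eq_kword (e' := fun _ => 0%R)); last by move=> c _; rewrite gsum_cons Ny.
have -> : kword (fun _ => 0%R) = [::] by rewrite /kword; elim: (enum _).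
rewrite /= wval_cons IHw -wval_cons; congr (wval (_ :: _)).
by apply: eq_normal_word => i d _; rewrite gsum_cons Ny.
Qed.

Lemma gsum_wval u v : skel u = skel v ->
  (forall c i, c \in star_class a -> gsum c i u = gsum c i v) -> wval u = wval v.
Proof.
move=> uv luv; rewrite (wval_norm u) (wval_norm v) uv; congr wval.
by apply: eq_normal_word => i c /luv.
Qed.

Local Open Scope ring_scope.

(** The last gap of a cyclic word, of index [nN w], continues with what precedes
    the first letter of N; the label of index 0 therefore only counts if there
    is no letter of N. *)
Definition label c i w : int :=
  if i is 0 then (if nN w == 0%N then gsum c 0 w else 0)
  else gsum c i w + (if i == nN w then gsum c 0 w else 0).

Definition eqlab u v := skel u = skel v /\
  forall c i, c \in star_class a -> label c i u = label c i v.

Lemma eqlab_nN u v : eqlab u v -> nN u = nN v.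
Proof. by case=> uv _; rewrite -nN_skel uv nN_skel. Qed.

(** Conjugation by the class letters of gap 0 moves them to the last gap, after
    which labels are exponent sums and determine the normal form. *)
Lemma eqlab_conjw u v : eqlab u v -> conjw u v.
Proof.
move=> uv; have nE := eqlab_nN uv; case: uv => sE lE.
have [n0|n_gt0] := posnP (nN u).
  apply: weq_conjw; apply/weqP; apply: gsum_wval => // c [|i] cK.
    by have := lE c 0%N cK; rewrite /= -nE n0.
  by rewrite !gsum_gt -?nE ?n0.
pose rotw w := kword (fun c => - gsum c 0 w) ++ w ++ kword (fun c => gsum c 0 w).
have rotP w : conjw w (rotw w).
  exists (wval (kword (fun c => gsum c 0 w))).
  rewrite !wvalM conjgE; congr (_ * _)%g.
  apply: (mulIg (wval (kword (fun c => gsum c 0 w)))); rewrite mulVg -wvalM -wval0.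
  apply: gsum_wval; first by rewrite skel_cat !skel_allK ?all_kword.
  move=> c i cK; rewrite gsum_cat !gsum_kword nN_allK ?all_kword // subn0 cK.
  by case: (i == _); rewrite ?addr0 //= addNr.
have rot_skel w : skel (rotw w) = skel w.
  by rewrite /rotw !skel_cat ![skel (kword _)]skel_allK ?all_kword ?cats0.
have rot_gsum c i w : (0 < nN w)%N -> c \in star_class a -> gsum c i (rotw w) =
    if i is 0 then 0 else label c i w.
  move=> w_gt0 cK; rewrite /rotw !gsum_cat !gsum_kword nN_allK ?all_kword // cK andbT subn0.
  case: i => [|i] /=; first by rewrite leqNgt w_gt0 addr0 addNr.
  rewrite add0r; congr (_ + _); rewrite andbT subn_eq0.
  by rewrite eq_sym; case: (ltngtP (nN w) i.+1).
apply: conjw_trans (rotP u) (conjw_trans _ (conjw_sym (rotP v))).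
apply: weq_conjw; apply/weqP; apply: gsum_wval; first by rewrite !rot_skel.
by move=> c i cK; rewrite !rot_gsum -?nE //; case: i => // i; apply: lE.
Qed.

End Gaps.
Arguments gsum : simpl never.

(** * Substitution of words for generators *)

Section Substitution.
Variable G : sgraph.
Implicit Types (u v w z : word G) (f g : G -> word G).

Definition lsub f (l : vertex G * bool) : word G :=
  if l.2 then f l.1 else winv (f l.1).
Definition wsub f w : word G := flatten [seq lsub f l | l <- w].

Lemma wsub_cat f u v : wsub f (u ++ v) = wsub f u ++ wsub f v.
Proof. by rewrite /wsub map_cat flatten_cat. Qed.

Lemma wsub1 f l : wsub f [:: l] = lsub f l.
Proof. by rewrite /wsub /= cats0. Qed.

Lemma wsub_winv f w : wsub f (winv w) = winv (wsub f w).
Proof.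
elim: w => //= l w IHw; rewrite -cat1s winv_cat !wsub_cat winv_cat IHw.
congr (_ ++ _); case: l => b [] /=; rewrite /wsub /= !cats0 /lsub //=.
by rewrite winvK.
Qed.

(** The condition for substitution to respect the relations of the group. *)
Definition preserving f :=
  forall b c : G, adj b c -> commute (wval (f b)) (wval (f c)).

Lemma weq_wsub f u v : preserving f -> weq u v -> weq (wsub f u) (wsub f v).
Proof.
move=> fP; elim=> {u v} [w|u v _ IH|u v w _ IH1 _ IH2|u u' v v' _ IH1 _ IH2|b t|b c bc].
- exact: weq_refl.
- exact: weq_sym.
- exact: weq_trans IH1 IH2.
- by rewrite !wsub_cat; apply: weq_cat.
- rewrite /wsub /= cats0; case: t; first exact: weq_mulV.
  by have := weq_mulV (winv (f b)); rewrite winvK.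
- by apply/weqP; rewrite /wsub /= !cats0 !wvalM; apply: fP.
Qed.

Definition induced f (g : raag G) : raag G := wval (wsub f (repr g)).

Lemma induced_wval f w : preserving f -> induced f (wval w) = wval (wsub f w).
Proof. by move=> fP; apply/weqP; apply: weq_wsub fP _; apply: weq_repr. Qed.

Lemma inducedM f : preserving f -> {morph induced f : x y / (x * y)%g}.
Proof.
move=> fP x y; rewrite -[x]wval_repr -[y]wval_repr -wvalM !induced_wval //.
by rewrite wsub_cat wvalM.
Qed.

Lemma induced_gen f b : preserving f -> induced f (gen b) = wval (f b).
Proof. by move=> fP; rewrite induced_wval // /wsub /= cats0. Qed.

Lemma induced_cancel f g : preserving f -> preserving g ->
  (forall b, wval (wsub f (g b)) = gen b) -> cancel (induced g) (induced f).
Proof.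
move=> fP gP fg x; rewrite -[x]wval_repr induced_wval // induced_wval //.
elim: (repr x) => //= l w IHw; rewrite -cat1s wsub_cat wsub_cat !wvalM IHw.
congr (_ * _)%g; case: l => b t; rewrite /wsub /= !cats0 -/(wsub f _) /lsub.
case: t => /=; first exact: fg.
by rewrite wsub_winv wvalV fg -wvalV.
Qed.

End Substitution.

Section Params.
Variables (G : sgraph) (a : G).
Implicit Types (u v w p q r z : word G) (x y l : vertex G * bool) (b c d : G).

Local Notation K := (star_class a).
Local Notation isN := (isN a).
Local Notation isK := (isK a).
Local Notation nN := (nN a).
Local Notation gsum := (gsum a).
Local Notation skel := (skel a).

(** Entry [mu b s c t] is the number of letters [(c, t)] in the vector written
    before ([s = true]) or after ([s = false]) the generator [b]; only the
    difference over [t] matters, and natural numbers can be searched through.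
    For [b] in the class the vector before is the whole image. *)
Definition coefs := G -> bool -> G -> bool -> nat.
Implicit Types mu : coefs.

Definition vword mu b s : word G := flatten
  [seq nseq (mu b s c true) (c, true) ++ nseq (mu b s c false) (c, false)
     | c <- enum K].

Definition gimg mu b : word G :=
  if b \in K then vword mu b true else vword mu b true ++ (b, true) :: vword mu b false.

Lemma gimgE mu b : gimg mu b =
  if b \in K then vword mu b true else vword mu b true ++ (b, true) :: vword mu b false.
Proof. by []. Qed.

Local Open Scope ring_scope.

Definition coef mu b s c : int := (mu b s c true)%:Z - (mu b s c false)%:Z.

Lemma all_vword mu b s : all isK (vword mu b s).
Proof.
apply/allP => l /flattenP[r /mapP[c]]; rewrite mem_enum => cK ->.
by rewrite mem_cat => /orP[] /nseqP[-> _].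
Qed.

Lemma gsum_vword c i mu b s : c \in K -> gsum c i (vword mu b s) =
  if i == 0%N then coef mu b s c else 0.
Proof.
move=> cK; rewrite /vword.
have: {subset enum K <= K} by move=> d; rewrite mem_enum.
have: c \in enum K by rewrite mem_enum.
elim: (enum _) (enum_uniq K) => //= d r IHr /andP[dr ur] cr sub.
have dK : d \in K by rewrite sub ?mem_head.
have rK : {subset r <= K} by move=> z zr; rewrite sub ?inE ?zr ?orbT.
have aK n t : all isK (nseq n (d, t)) by apply/allP => l /nseqP[-> _].
rewrite !gsum_cat nN_cat !nN_allK // !subn0 !gsum_nseq //=.
move: cr; rewrite inE; have [->|ndc] /= := eqVneq c d => cr.
  have -> : gsum d i (flatten [seq nseq (mu b s c0 true) (c0, true) ++
      nseq (mu b s c0 false) (c0, false) | c0 <- r]) = 0.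
    elim: r {IHr ur sub cr} dr rK => //= e r IHr.
    rewrite inE negb_or => /andP[de dr] rK.
    have eK : e \in K by rewrite rK ?mem_head.
    have aeK n t : all isK (nseq n (e, t)) by apply/allP => l /nseqP[-> _].
    rewrite !gsum_cat nN_cat !nN_allK // !subn0 !gsum_nseq //= [e == d]eq_sym.
    rewrite (negbTE de) !andbF !add0r IHr // => z zr; apply: rK.
    by rewrite inE zr orbT.
  by rewrite addr0 andbT; case: ifP; rewrite // /sg /coef natz mulNrn natz.
by rewrite !andbF !add0r IHr.
Qed.

Lemma gsum_winvK c i z : all isK z -> gsum c i (winv z) = - gsum c i z.
Proof.
elim: z => [|x z IHz] /=; first by rewrite gsum_nil oppr0.
case/andP=> xK zK; rewrite -cat1s winv_cat gsum_cat IHz // nN_allK; last first.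
  by rewrite /winv all_rev all_map; apply: sub_all zK => l.
rewrite leq0n subn0 gsum_cons (negbTE (isK_notN _)) // gsum_nil addr0.
rewrite gsum_cons (negbTE (isK_notN _)) //= [RHS]opprD [LHS]addrC; congr (_ + _).
by case: ifP => _; rewrite ?oppr0 // /sg; case: x.2.
Qed.

Lemma all_winvK z : all isK (winv z) = all isK z.
Proof. by rewrite /winv all_rev all_map. Qed.

Lemma nN_lsub mu l : nN (lsub (gimg mu) l) = nN [:: l].
Proof.
have nN_inv w : nN (winv w) = nN w.
  by rewrite !nNE /winv count_rev count_map; apply: eq_count => x.
have -> : nN (lsub (gimg mu) l) = nN (gimg mu l.1).
  by rewrite /lsub; case: l.2; rewrite ?nN_inv.
rewrite /gimg; case: ifP => bK; last first.
  by rewrite nN_cat nN_allK ?all_vword //= nN_allK ?all_vword.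
by rewrite nN_allK ?all_vword // [RHS]nN_allK //= andbT.
Qed.

Lemma nN_wsub mu w : nN (wsub (gimg mu) w) = nN w.
Proof.
by elim: w => // l w IHw; rewrite -[l :: w]cat1s wsub_cat wsub1 !nN_cat IHw nN_lsub.
Qed.

Lemma skel_wsub mu w : skel (wsub (gimg mu) w) = skel w.
Proof.
elim: w => // l w IHw; rewrite -[l :: w]cat1s wsub_cat wsub1 !skel_cat IHw.
congr (_ ++ _); rewrite {IHw w} /lsub /gimg; case: l => b t /=.
case bK: (b \in K); first by case: t; rewrite skel_allK ?all_winvK ?all_vword //=
   ?isKE /= bK.
have nb t' : isK (b, t') = false by rewrite ?isKE /= bK.
have sK s : skel (vword mu b s) = [::] by rewrite skel_allK ?all_vword.
have sV s : skel (winv (vword mu b s)) = [::].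
  by rewrite skel_allK ?all_winvK ?all_vword.
have sC t' w' : skel ((b, t') :: w') = (b, t') :: skel w' by rewrite /= nb.
rewrite nb /=; case: t; first by rewrite skel_cat sC !sK.
by rewrite winv_cat -cat1s winv_cat !skel_cat !sV /= nb.
Qed.

(** Coefficient, in the gap [i] of the image of the single letter [l], of the
    vector before ([s]) or after its vertex. The inverse of u b v is the word
    v^-1 b^-1 u^-1, which exchanges the two gaps and the sign. *)
Definition letter_coef l i (s : bool) : int :=
  if isK l then if s && (i == 0%N) then sg l.2 else 0
  else if isN l then
    (if l.2 then (i == ~~ s)%:R else - (i == s)%:R)
  else if i == 0%N then sg l.2 else 0.

Lemma gsum_lsub c i mu l : c \in K -> gsum c i (lsub (gimg mu) l) =
  letter_coef l i true * coef mu l.1 true c + letter_coef l i false * coef mu l.1 false c.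
Proof.
move=> cK; case: l => b t; rewrite /lsub /gimg /letter_coef /=.
case: (boolP (b \in K)) => bK.
  have -> : isK (b, t) by [].
  rewrite mul0r addr0; case: t => /=; rewrite ?gsum_winvK ?all_vword // gsum_vword //.
    by case: ifP => _; rewrite /sg ?mul1r ?mul0r.
  by case: ifP => _; rewrite /sg ?mulN1r ?mul0r ?oppr0.
have -> : isK (b, t) = false by rewrite /isK /= (negbTE bK).
have bc : b != c by apply: contraNneq bK => ->.
have invE : winv (vword mu b true ++ (b, true) :: vword mu b false) =
    winv (vword mu b false) ++ (b, false) :: winv (vword mu b true).
  by rewrite winv_cat -cat1s winv_cat -catA.
have nK s : nN (winv (vword mu b s)) = 0%N by rewrite nN_allK ?all_winvK ?all_vword.
case: t => /=; rewrite ?invE gsum_cat ?nK ?nN_allK ?all_vword // leq0n subn0 gsum_cons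
  /= (negbTE bc) andbF add0r ?gsum_winvK ?all_vword // ?gsum_vword //.
  rewrite ?isNE /=; case bN: (b \notin star a).
    case: i => [|[|i]] /=; rewrite ?gsum_vword //= ?mul1r ?mul0r ?addr0 ?add0r //.
  by case: ifP => _; rewrite /sg ?mul1r ?mul0r ?addr0.
rewrite ?isNE /=; case bN: (b \notin star a).
  case: i => [|[|i]] /=; rewrite ?gsum_winvK ?all_vword ?gsum_vword //= ?oppr0
   ?mulN1r ?mul0r ?addr0 ?add0r //.
by case: ifP => _; rewrite ?mulN1r ?mul0r ?oppr0 ?addr0 // addrC.
Qed.

Lemma gsum_wsub_cons c i mu l w : c \in K -> gsum c i (wsub (gimg mu) (l :: w)) =
  letter_coef l i true * coef mu l.1 true c + letter_coef l i false * coef mu l.1 false c +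
  (if (nN [:: l] <= i)%N then gsum c (i - nN [:: l]) (wsub (gimg mu) w) else 0).
Proof.
by move=> cK; rewrite -[l :: w]cat1s wsub_cat wsub1 gsum_cat nN_lsub gsum_lsub.
Qed.

(** The coefficients of the exponent sums in the image, as linear forms in the
    vectors of the generators. *)
Fixpoint gap_coef w i (k : G * bool) : int :=
  if w is l :: w' then (if l.1 == k.1 then letter_coef l i k.2 else 0) +
    (if (nN [:: l] <= i)%N then gap_coef w' (i - nN [:: l])%N k else 0)
  else 0.

Lemma gsum_wsub c i mu w : c \in K -> gsum c i (wsub (gimg mu) w) =
  \sum_k gap_coef w i k * coef mu k.1 k.2 c.
Proof.
move=> cK; elim: w i => [|l w IHw] i.
  by rewrite big1 // => k _; rewrite mul0r.
rewrite gsum_wsub_cons //=.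
under eq_bigr do rewrite mulrDl; rewrite big_split /=; congr (_ + _); last first.
  case: ifP => _; first by rewrite IHw.
  by rewrite big1 // => k _; rewrite mul0r.
rewrite (bigD1 (l.1, true)) //= (bigD1 (l.1, false)) //=. 2: by rewrite xpair_eqE andbF.
rewrite !eqxx addrA.
rewrite big1 ?addr0 // => -[b s] /= /andP[]; rewrite !xpair_eqE [b == _]eq_sym.
by case: (l.1 == b); case: s => //= _ _; rewrite mul0r.
Qed.

Lemma gsum_wsubK c i mu z : c \in K -> all isK z -> gsum c i (wsub (gimg mu) z) =
  if i == 0%N then \sum_(d in K) gsum d 0 z * coef mu d true c else 0.
Proof.
move=> cK; elim: z => [|l z IHz] /=.
  by move=> _; case: ifP => // _; rewrite big1 // => d _; rewrite mul0r.
case/andP=> lK zK; rewrite gsum_wsub_cons // nN_allK ?leq0n /= ?andbT ?lK // subn0 IHz //.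
rewrite /letter_coef lK /= mul0r addr0; case: ifP => i0; last by rewrite mul0r addr0.
under [in RHS]eq_bigr do rewrite gsum_cons (negbTE (isK_notN lK)) mulrDl.
rewrite big_split /=; congr (_ + _); rewrite (bigD1 l.1) //= eqxx big1 ?addr0 //.
by move=> d /andP[_ /negbTE]; rewrite eq_sym => ->; rewrite mul0r.
Qed.

End Params.

(** * Automorphisms given by integers *)

Section Automorphisms.
Variables (G : sgraph) (a : G).
Implicit Types (u v w p q r z : word G) (x y l : vertex G * bool) (b c d : G).
Implicit Types (mu : coefs G).

Local Notation K := (star_class a).
Local Notation isN := (isN a).
Local Notation isK := (isK a).
Local Notation nN := (nN a).
Local Notation gsum := (gsum a).
Local Notation skel := (skel a).
Local Notation vword := (vword a).
Local Notation gimg := (gimg a).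

Local Open Scope ring_scope.

(** For [b] outside the class and adjacent to a vertex [c] of N, the images
    commute when the two vectors of [b] are opposite and, if [b] is in N too,
    both are conjugated by the same vector. The modulus 0 asks for equality. *)
Definition comm_eqs mu (m : nat) : bool :=
  all (fun b => all (fun c =>
    [&& adj b c, c \notin star a & b \notin K] ==>
    all (fun d => (m %| coef mu b true d + coef mu b false d)%Z &&
      ((b \notin star a) ==> (m %| coef mu b true d - coef mu c true d)%Z)) (enum K))
   (enum G)) (enum G).

Lemma comm_eqsP mu m : comm_eqs mu m <-> forall b c d, adj b c -> c \notin star a ->
  b \notin K -> d \in K ->
  (m %| coef mu b true d + coef mu b false d)%Z /\
  (b \notin star a -> (m %| coef mu b true d - coef mu c true d)%Z).
Proof.
split=> [/allP cP b c d bc cN bK dK|cP].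
  have /allP/(_ c) := cP b (mem_enum _ b); rewrite mem_enum => /(_ isT).
  rewrite bc cN bK /= => /allP/(_ d); rewrite mem_enum => /(_ dK) /andP[-> /implyP].
  by split.
apply/allP => b _; apply/allP => c _; apply/implyP => /and3P[bc cN bK].
apply/allP => d; rewrite mem_enum => dK; have [-> e] := cP _ _ _ bc cN bK dK.
exact/implyP.
Qed.

Lemma eq_wvalK z z' : all isK z -> all isK z' ->
  (forall c, c \in K -> gsum c 0 z = gsum c 0 z') -> wval z = wval z'.
Proof.
move=> zK zK' e; apply: (@gsum_wval _ a); first by rewrite !skel_allK.
by move=> c [|i] cK; [apply: e | rewrite !gsum_gt // nN_allK].
Qed.

Lemma commuteKK z z' : all isK z -> all isK z' -> commute (wval z) (wval z').
Proof.
move=> zK zK'; rewrite /commute -!wvalM.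
apply: eq_wvalK => [||c cK]; rewrite ?all_cat ?zK ?zK' //.
by rewrite !gsum_cat !nN_allK // addrC.
Qed.

Lemma commuteKL z l : all isK z -> ~~ isN l -> commute (wval z) (wval [:: l]).
Proof.
move=> zK lN; have [lK|lK] := boolP (isK l); first by apply: commuteKK; rewrite //= lK.
apply/commute_sym/commute_word/allP => x xz; rewrite com_sym.
apply: class_adj (allP zK x xz) _ _; first by rewrite ?isNE negbK in lN.
by apply: contraNneq lK => e; rewrite ?isKE -e; apply: (allP zK).
Qed.

Local Open Scope group_scope.

(** Vertices of the star commute with the class, so that only edges with an end
    in N need the equations: a vertex of the star with opposite vectors is
    fixed, and two adjacent vertices of N are conjugated by one element. *)
Lemma gimg_preserving mu : comm_eqs mu 0 -> preserving (gimg mu).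
Proof.
move/comm_eqsP=> cP b c bc.
have UV d e : adj d e -> e \notin star a -> d \notin K ->
    wval (vword mu d false) = (wval (vword mu d true))^-1.
  move=> de eN dK; apply: (mulgI (wval (vword mu d true))); rewrite mulgV -wvalM.
  rewrite -wval0; apply: eq_wvalK => [||g gK]; rewrite ?all_cat ?all_vword //.
  rewrite gsum_cat nN_allK ?all_vword // !gsum_vword // gsum_nil.
  by have [] := cP _ _ _ de eN dK gK; rewrite dvd0z => /eqP.
have LK d z : d \in star a -> all isK z -> commute (wval z) (wval [:: (d, true)]).
  by move=> dL zK; apply: commuteKL; rewrite // ?isNE negbK.
have sK mu' d s := all_vword a mu' d s.
have vU d s d' s' : commute (wval (vword mu d s)) (wval (vword mu d' s')).
  exact: commuteKK.
have gimgE d : d \notin K -> wval (gimg mu d) =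
    wval (vword mu d true) * (gen d * wval (vword mu d false)).
  by move=> dK; rewrite /gimg (negbTE dK) wvalM (wval_cons _ (vword _ _ _)).
have KL d e : d \in K -> adj d e -> commute (wval (gimg mu d)) (wval (gimg mu e)).
  move=> dK de; rewrite {1}/gimg dK.
  have [eK|eK] := boolP (e \in K); first by rewrite /gimg eK; apply: vU.
  rewrite gimgE //; apply: commuteM; first exact: vU.
  apply: commuteM (vU _ _ _ _); apply: LK (class_notN dK de) _; exact: sK.
have [bK|bK] := boolP (b \in K); first exact: KL.
have [cK|cK] := boolP (c \in K).
  by apply: commute_sym; apply: KL => //; rewrite adj_sym.
have gbc : commute (gen b) (gen c).
  by rewrite /commute -!wvalM; apply/weqP/weq_adj.
have LL d e : d \in star a -> commute (gen d) (gen e) -> d \notin K -> e \notin K ->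
   adj d e -> commute (wval (gimg mu d)) (wval (gimg mu e)).
  move=> dL de dK eK ade.
  have dcomm s f : commute (gen d) (wval (vword mu f s)).
    by apply: commute_sym; apply: LK.
  have dimg : commute (gen d) (wval (gimg mu e)).
    rewrite gimgE //; apply: commuteM (dcomm _ _) _; exact: commuteM de (dcomm _ _).
  have [eL|eN] := boolP (e \in star a).
    rewrite gimgE //; apply: commute_sym; apply: commuteM.
      rewrite gimgE //; apply: commute_sym; apply: commuteM (vU _ _ _ _) _.
      by apply: commuteM (vU _ _ _ _); apply: LK.
    apply: commuteM; first exact: commute_sym.
    rewrite gimgE //; apply: commute_sym; apply: commuteM (vU _ _ _ _) _.
    by apply: commuteM (vU _ _ _ _); apply: LK.
  rewrite [wval (gimg mu d)](_ : _ = gen d) //.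
  by rewrite gimgE // (UV _ _ ade eN dK) mulgA -(dcomm true d : _ * _ = _) mulgK.
have [bL|bN] := boolP (b \in star a); first exact: LL.
have [cL|cN] := boolP (c \in star a).
  by apply: commute_sym; apply: LL; rewrite // adj_sym.
rewrite !gimgE // (UV _ _ bc cN bK) (UV c b) //; last by rewrite adj_sym.
have -> : wval (vword mu b true) = wval (vword mu c true).
  apply: eq_wvalK => // d dK; rewrite !gsum_vword //.
  by have [_ /(_ bN)] := cP _ _ _ bc cN bK dK; rewrite dvd0z subr_eq0 => /eqP.
set h := wval _; rewrite /commute.
have conjE g : h * (g * h^-1) = g ^ h^-1 by rewrite conjgE invgK.
by rewrite !conjE -!conjMg gbc.
Qed.

Local Open Scope ring_scope.

(** Column [j] is the exponent vector of the image of vertex [j] of the class. *)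
Definition class_mx mu : 'M[int]_#|K| :=
  \matrix_(i, j) coef mu (enum_val j) true (enum_val i).

Definition unimodular mu (m : nat) : bool :=
  (m %| \det (class_mx mu) - 1)%Z || (m %| \det (class_mx mu) + 1)%Z.

Definition coefs_of (e : G -> bool -> G -> int) : coefs G :=
  fun b s c t => if (0 <= e b s c) == t then `|e b s c|%N else 0%N.

Lemma coef_of e b s c : coef (coefs_of e) b s c = e b s c.
Proof. by rewrite /coef /coefs_of; case: (e b s c) => n /=; rewrite ?subr0 ?sub0r ?NegzE. Qed.

(** The inverse matrix on the class; a vector of another generator is negated
    and transformed by this matrix. *)
Definition inv_coefs mu := coefs_of (fun b s c =>
  if b \in K then (if s then \sum_i \sum_j (invmx (class_mx mu)) i j *
    ((enum_val i == c) && (enum_val j == b))%:R else 0)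
  else - \sum_(d in K) coef mu b s d * \sum_i \sum_j (invmx (class_mx mu)) i j *
    ((enum_val i == c) && (enum_val j == d))%:R).

Lemma pick_entry (B : 'M[int]_#|K|) (i0 j0 : 'I_#|K|) :
  \sum_i \sum_j B i j * ((enum_val i == enum_val i0) &&
     (enum_val j == enum_val j0))%:R = B i0 j0.
Proof.
rewrite (bigD1 i0) //= (bigD1 j0) //= !eqxx mulr1 big1 ?addr0; last first.
  by move=> j /negbTE nj; rewrite (inj_eq enum_val_inj) nj andbF mulr0.
rewrite big1 ?addr0 // => i /negbTE ni; rewrite big1 // => j _.
by rewrite (inj_eq enum_val_inj) ni mulr0.
Qed.

Lemma class_mx_inv mu : class_mx (inv_coefs mu) = invmx (class_mx mu).
Proof. by apply/matrixP => i j; rewrite mxE coef_of enum_valP pick_entry. Qed.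

Lemma coef_inv mu b s c : c \in K -> b \notin K ->
  coef (inv_coefs mu) b s c =
  - \sum_(d in K) coef mu b s d * coef (inv_coefs mu) d true c.
Proof.
move=> cK bK; rewrite coef_of (negbTE bK); congr (- _); apply: eq_bigr => d dK.
by rewrite coef_of dK.
Qed.

Lemma unimodular_unit mu : unimodular mu 0 = (class_mx mu \in unitmx).
Proof.
by rewrite /unimodular !dvd0z subr_eq0 addr_eq0 unitmxE.
Qed.

Lemma skel0_allK w : skel w = [::] -> all isK w.
Proof.
move=> w0; apply/allP => l lw; apply: contraT => lK.
have: l \in skel w by rewrite mem_filter lK.
by rewrite w0.
Qed.

Lemma all_wsubK mu z : all isK z -> all isK (wsub (gimg mu) z).
Proof. by move=> zK; apply: skel0_allK; rewrite skel_wsub skel_allK. Qed.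

(** The hypotheses say that a composite has trivial integers: the matrices on
    the class are multiplied, and a vector of another generator is transformed
    by the matrix before the vector of the outer map is added. *)
Lemma gimg_comp mu nu b :
  (forall b c, b \in K -> c \in K ->
     \sum_(d in K) coef nu b true d * coef mu d true c = (b == c)%:R) ->
  (forall b s c, b \notin K -> c \in K ->
     coef mu b s c + \sum_(d in K) coef nu b s d * coef mu d true c = 0) ->
  wval (wsub (gimg mu) (gimg nu b)) = gen b.
Proof.
move=> H1 H2; have vK d s := all_vword a nu d s.
have gsumE d s c : c \in K -> gsum c 0 (wsub (gimg mu) (vword nu d s)) =
    \sum_(e in K) coef nu d s e * coef mu e true c.
  move=> cK; rewrite gsum_wsubK //=; apply: eq_bigr => e eK.
  by rewrite gsum_vword.
have gimgE m : gimg m b = if b \in K then vword m b true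
    else vword m b true ++ (b, true) :: vword m b false by [].
rewrite gimgE; case: ifPn => bK.
  apply: eq_wvalK => [||c cK]; rewrite ?all_wsubK //=; first by rewrite andbT.
  rewrite gsumE // H1 // gsum_cons gsum_nil addr0 (negbTE (isK_notN _)) //=.
  by rewrite /sg; case: eqP.
rewrite -[_ :: _]cat1s !wsub_cat wsub1 /lsub /= gimgE (negbTE bK).
rewrite -[(b, true) :: vword mu b false]cat1s !wvalM.
have one s : wval (vword mu b s ++ wsub (gimg mu) (vword nu b s)) = 1%g.
  rewrite -wval0; apply: eq_wvalK => [||c cK] //.
    by rewrite all_cat all_vword all_wsubK.
  by rewrite gsum_cat nN_allK ?all_vword // gsum_vword //= gsumE // H2 // gsum_nil.
have c1 : commute (wval (wsub (gimg mu) (vword nu b true))) (wval (vword mu b true)).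
  by apply: commuteKK; rewrite ?all_wsubK ?all_vword.
have one' s : (wval (vword mu b s) * wval (wsub (gimg mu) (vword nu b s)) = 1)%g.
  by rewrite -wvalM one.
by rewrite !mulgA (c1 : (_ * _ = _)%g) one' mul1g -mulgA one' mulg1.
Qed.

Section Inverse.
Variable mu : coefs G.
Hypotheses (cmu : comm_eqs mu 0) (dmu : unimodular mu 0).
Let nu := inv_coefs mu.

Lemma class_mx_comp (mu1 mu2 : coefs G) : class_mx mu1 *m class_mx mu2 = 1%:M ->
  forall b c, b \in K -> c \in K ->
  \sum_(d in K) coef mu2 b true d * coef mu1 d true c = (b == c)%:R.
Proof.
move=> /matrixP A1 b c bK cK; rewrite big_enum_val /=.
have := A1 (enum_rank_in cK c) (enum_rank_in bK b); rewrite !mxE => e.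
rewrite -[RHS](_ : (enum_rank_in cK c == enum_rank_in bK b)%:R = _); last first.
  by rewrite -(inj_eq enum_val_inj) !enum_rankK_in // eq_sym.
rewrite -e; apply: eq_bigr => i _; rewrite !mxE !enum_rankK_in //.
by rewrite mulrC.
Qed.

Lemma inv_comp1 b c : b \in K -> c \in K ->
  \sum_(d in K) coef mu b true d * coef nu d true c = (b == c)%:R.
Proof. by apply: class_mx_comp; rewrite class_mx_inv mulVmx // -unimodular_unit. Qed.

Lemma inv_comp2 b c : b \in K -> c \in K ->
  \sum_(d in K) coef nu b true d * coef mu d true c = (b == c)%:R.
Proof. by apply: class_mx_comp; rewrite class_mx_inv mulmxV // -unimodular_unit. Qed.

Lemma inv_comm_eqs : comm_eqs nu 0.
Proof.
apply/comm_eqsP => b c d bc cN bK dK; have cP := (comm_eqsP mu 0).1 cmu.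
have cI := coef_inv mu _ dK bK. rewrite -/nu in cI; rewrite !cI -opprD -big_split /=; split.
  rewrite big1 ?oppr0 // => e eK; rewrite -mulrDl.
  have [] := cP _ _ _ bc cN bK eK; rewrite dvd0z => /eqP -> _.
  by rewrite mul0r.
move=> bN; have cK : c \notin K by apply: contra cN; apply: class_star.
rewrite (coef_inv mu _ dK cK) -/nu.
rewrite opprK addrC -sumrB big1 // => e eK; rewrite -mulrBl.
have [_ /(_ bN)] := cP _ _ _ bc cN bK eK; rewrite dvd0z subr_eq0 => /eqP ->.
by rewrite subrr mul0r.
Qed.

Lemma gimg_inv1 b : wval (wsub (gimg nu) (gimg mu b)) = gen b.
Proof.
apply: gimg_comp; first exact: inv_comp1.
by move=> {}b s c bK cK; rewrite coef_inv // addNr.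
Qed.

Lemma gimg_inv2 b : wval (wsub (gimg mu) (gimg nu b)) = gen b.
Proof.
apply: gimg_comp; first exact: inv_comp2.
move=> {}b s c bK cK; under eq_bigr => d dK do rewrite coef_inv // mulNr mulr_suml.
rewrite sumrN exchange_big /=.
under eq_bigr => d dK.
  under eq_bigr => e eK do rewrite -mulrA.
  rewrite -mulr_sumr inv_comp2 //; over.
rewrite (bigD1 c) //= eqxx mulr1 big1 ?addr0 ?addrN //.
by move=> d /andP[_ /negbTE ->]; rewrite mulr0.
Qed.

Lemma star_subgroup_word z : all isK z -> star_subgroup a (wval z).
Proof.
move=> zK M [[M1 MV] SM]; elim: z zK => [|l z IHz] /=; first by move=> _; apply: set_mem.
case/andP=> lK /IHz zM; rewrite wval_cons; apply: set_mem.
have Mgen b : b \in K -> gen b \in M by move=> bK; apply: mem_set; apply: SM; exists b.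
have MI (x : raag G) : x \in M -> (x^-1)%g \in M by move=> xM; rewrite -[(x^-1)%g]mul1g; apply: MV.
have MM (x y : raag G) : x \in M -> y \in M -> (x * y)%g \in M.
  by move=> xM yM; rewrite -[y]invgK; apply: MV => //; apply: MI.
apply: MM; last exact: mem_set.
case: l lK => b [] bK; first exact: Mgen.
by rewrite -[X in wval X]/(winv [:: (b, true)]) wvalV; apply/MI/Mgen.
Qed.

Lemma Omega_induced : Omega a (induced (gimg mu)).
Proof.
have P1 := gimg_preserving cmu; have P2 := gimg_preserving inv_comm_eqs.
split.
- split; first exact: inducedM.
  exists (induced (gimg nu)); apply: induced_cancel => //; [exact: gimg_inv1 | exact: gimg_inv2].
- move=> b bK; exists (wval (vword mu b true)), (wval (vword mu b false)).
  split; [exact: (star_subgroup_word (all_vword a _ _ _)) | exact: (star_subgroup_word (all_vword a _ _ _)) |].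
  rewrite induced_gen // gimgE (negbTE bK) -cat1s !wvalM mulgA //.
- move=> b bK; rewrite induced_gen // gimgE bK; exact: (star_subgroup_word (all_vword a _ _ _)).
Qed.

End Inverse.

End Automorphisms.

(** * Integers given by automorphisms *)

Section Evaluation.
Variables (G : sgraph) (T : Type) (idx : T) (op : Monoid.law idx).
Variable h : vertex G * bool -> T.

Definition word_eval (w : word G) : T := \big[op/idx]_(l <- w) h l.

Lemma word_eval_cat u v : word_eval (u ++ v) = op (word_eval u) (word_eval v).
Proof. exact: big_cat. Qed.

Lemma word_eval_cons l w : word_eval (l :: w) = op (h l) (word_eval w).
Proof. exact: big_cons. Qed.

Lemma word_eval_nil : word_eval [::] = idx.
Proof. exact: big_nil. Qed.

Hypothesis h_inv : forall b t, op (h (b, t)) (h (b, ~~ t)) = idx.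
Hypothesis h_adj : forall b c, adj b c ->
  op (h (b, true)) (h (c, true)) = op (h (c, true)) (h (b, true)).

(** A homomorphism from the group to a monoid needs values for the letters that
    satisfy the relations. *)
Lemma weq_word_eval u v : weq u v -> word_eval u = word_eval v.
Proof.
elim=> {u v} // [u v w _ -> _ -> //|u u' v v' _ IH1 _ IH2|b t|b c bc].
- by rewrite !word_eval_cat IH1 IH2.
- by rewrite !word_eval_cons word_eval_nil Monoid.mulm1 h_inv.
- by rewrite !word_eval_cons word_eval_nil !Monoid.mulm1 h_adj.
Qed.

End Evaluation.

Local Open Scope ring_scope.

(** Upper unitriangular integer matrices of order 4, given by the entries
    above the diagonal. *)
Record unitri := Unitri {u12 : int; u23 : int; u34 : int; u13 : int; u24 : int; u14 : int}.

Definition unitri_mul x y := Unitri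
  (u12 x + u12 y) (u23 x + u23 y) (u34 x + u34 y)
  (u13 x + u13 y + u12 x * u23 y) (u24 x + u24 y + u23 x * u34 y)
  (u14 x + u14 y + u12 x * u24 y + u13 x * u34 y).
Definition unitri_one := Unitri 0 0 0 0 0 0.

Lemma unitri_mulA : associative unitri_mul.
Proof. by move=> x y z; rewrite /unitri_mul /=; congr Unitri; ring. Qed.
Lemma unitri_mul1 : left_id unitri_one unitri_mul.
Proof. by move=> [] *; rewrite /unitri_mul /=; congr Unitri; ring. Qed.
Lemma unitri_mulr1 : right_id unitri_one unitri_mul.
Proof. by move=> [] *; rewrite /unitri_mul /=; congr Unitri; ring. Qed.

HB.instance Definition _ :=
  Monoid.isLaw.Build unitri unitri_one unitri_mul unitri_mulA unitri_mul1 unitri_mulr1.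

Section Necessity.
Variables (G : sgraph) (a : G).
Implicit Types (u v w p q r z : word G) (x y l : vertex G * bool) (b c d : G).
Implicit Types (mu : coefs G).

Local Notation K := (star_class a).
Local Notation isK := (isK a).
Local Notation gsum := (gsum a).
Local Notation vword := (vword a).
Local Notation gimg := (gimg a).

Section Heisenberg.
Variables (b c d : G) (ob : bool).
Hypotheses (dK : d \in K) (cN : c \notin star a) (bN : ob -> b \notin star a).
Hypotheses (bK : b \notin K) (bc : adj b c).

(** The vertices [b], [d], [c] go to three consecutive elementary matrices, so
    that [b] and [c] commute while the entries above record how often [d]
    occurs before and after them. The flag [ob] says that [b] is in N; otherwise
    [b] commutes with [d] and must go to 1. *)
Definition hrep l : unitri :=
  if l.1 == d then Unitri 0 (sg l.2) 0 0 0 0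
  else if l.1 == c then Unitri 0 0 (sg l.2) 0 0 0
  else if (l.1 == b) && ob then Unitri (sg l.2) 0 0 0 0 0 else unitri_one.

Let dc : ~~ adj d c.
Proof. by apply: contra cN; apply: class_notN. Qed.
Let db : ob -> ~~ adj d b.
Proof. by move/bN; apply: contra; apply: class_notN. Qed.
Let cd : (c == d) = false.
Proof. by apply: contraNF cN => /eqP ->; apply: class_star. Qed.
Let bd : (b == d) = false.
Proof. by apply: contraNF bK => /eqP ->. Qed.
Let bc' : (b == c) = false.
Proof. by apply/negP => /eqP e; move: bc; rewrite e adj_irr. Qed.

Lemma hrep_inv e t : unitri_mul (hrep (e, t)) (hrep (e, ~~ t)) = unitri_one.
Proof.
rewrite /hrep /=; case: (e == d); first by case: t.
case: (e == c); first by case: t.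
by case: (_ && _); first by case: t.
Qed.

Lemma hrep_adj e f : adj e f ->
  unitri_mul (hrep (e, true)) (hrep (f, true)) =
  unitri_mul (hrep (f, true)) (hrep (e, true)).
Proof.
rewrite /hrep /= => ef.
have [ed|ed] := eqVneq e d; have [fd|fd] := eqVneq f d => //.
- have [fc|_] := eqVneq f c; first by move: dc; rewrite -ed -fc ef.
  case: ifP => // /andP[/eqP fb /db]; by rewrite -ed -fb ef.
- have [ec|_] := eqVneq e c; first by move: dc; rewrite -fd -ec adj_sym ef.
  case: ifP => // /andP[/eqP eb /db]; by rewrite -fd -eb adj_sym ef.
by case: (e == c); case: (f == c); case: ((e == b) && ob);
  case: ((f == b) && ob); rewrite /unitri_mul /=; congr Unitri.
Qed.

Let ev := word_eval unitri_mul hrep.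

Lemma hrep_K z : all isK z -> ev z = Unitri 0 (gsum d 0 z) 0 0 0 0.
Proof.
rewrite /ev; elim: z => [|l z IHz] /=; first by rewrite word_eval_nil gsum_nil.
case/andP=> lK zK; rewrite word_eval_cons IHz // gsum_cons (negbTE (isK_notN lK)) /=.
have lc : (l.1 == c) = false by apply: contraNF cN => /eqP <-; apply: class_star.
have lb : (l.1 == b) = false by apply: contraNF bK => /eqP <-.
rewrite /hrep lc lb; case: (l.1 == d) => /=; rewrite /unitri_mul /=;
 by congr Unitri; ring.
Qed.

Lemma comm_eqs_entry mu :
  commute (wval (gimg mu b)) (wval (gimg mu c)) ->
  coef mu b true d + coef mu b false d = 0 /\
  (ob -> coef mu b true d - coef mu c true d = 0).
Proof.
rewrite /commute -!wvalM => /weqP/(weq_word_eval hrep_inv hrep_adj).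
have cK : c \notin K by apply: contra cN; apply: class_star.
have hb t : hrep (b, t) = if ob then Unitri (sg t) 0 0 0 0 0 else unitri_one.
  by rewrite /hrep /= bd bc' eqxx /=.
have hc t : hrep (c, t) = Unitri 0 0 (sg t) 0 0 0.
  by rewrite /hrep /= cd eqxx.
rewrite !gimgE (negbTE bK) (negbTE cK) !word_eval_cat !word_eval_cons -/ev !hrep_K ?all_vword //.
rewrite !gsum_vword //= hb hc; set i := coef mu b true d; set j := coef mu b false d.
set k := coef mu c true d; set m := coef mu c false d.
move=> e; have := congr1 u14 e; have := congr1 u24 e; move: (ob) i j k m {e}.
clear; case=> i j k m; rewrite /unitri_mul /sg /=;
  rewrite ?(add0r, addr0, mul0r, mulr0, mul1r, mulr1).
all: by move=> e24 e14; split=> // *; lia.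
Qed.

End Heisenberg.

Lemma comm_eqs_necessary mu : preserving (gimg mu) -> comm_eqs a mu 0.
Proof.
move=> pP; apply/comm_eqsP => b c d bc cN bK dK; rewrite !dvd0z.
have e ob bN := @comm_eqs_entry b c d ob dK cN bN bK bc _ (pP _ _ bc).
split; first by have [//|-> _] := e false _.
by move=> bN; have [//|_ ->] := e true _.
Qed.

(** These exponent sums are invariants of group elements, unlike those of a
    single gap. *)
Definition expsum c w : int := \sum_(l <- w) (if l.1 == c then sg l.2 else 0).

Lemma expsum_cat c u v : expsum c (u ++ v) = expsum c u + expsum c v.
Proof. exact: big_cat. Qed.

Lemma expsum_weq c u v : weq u v -> expsum c u = expsum c v.
Proof.
apply: (@weq_word_eval _ _ _ +%R (fun l => if l.1 == c then sg l.2 else 0)) => [b t|b d _] /=.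
  by case: ifP => _; rewrite ?addr0 // /sg; case: t.
exact: addrC.
Qed.

Lemma expsum_winv c w : expsum c (winv w) = - expsum c w.
Proof.
have := expsum_weq c (weq_mulV w); rewrite expsum_cat [RHS]big_nil.
by move/eqP; rewrite addr_eq0 => /eqP ->; rewrite opprK.
Qed.

Lemma expsum_wsub c (f : G -> word G) w :
  expsum c (wsub f w) = \sum_d expsum d w * expsum c (f d).
Proof.
elim: w => [|l w IHw].
  by rewrite [LHS]big_nil big1 // => d _; rewrite /expsum big_nil mul0r.
rewrite -[l :: w]cat1s wsub_cat wsub1 expsum_cat IHw.
under [in RHS]eq_bigr do rewrite expsum_cat mulrDl.
rewrite big_split /=; congr (_ + _).
rewrite (bigD1 l.1) //= big1 => [|d /negbTE nd]; last first.
  by rewrite /expsum big_seq1 eq_sym nd mul0r.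
rewrite addr0 /expsum !big_seq1 eqxx -/(expsum _ _) /lsub.
by case: l.2; rewrite /sg ?mul1r // mulN1r -/(expsum _ _) expsum_winv.
Qed.

Lemma expsum_K c z : all isK z -> expsum c z = if c \in K then gsum c 0 z else 0.
Proof.
elim: z => [|l z IHz] /=; first by rewrite /expsum big_nil gsum_nil if_same.
case/andP=> lK zK; rewrite -[l :: z]cat1s expsum_cat IHz // gsum_cons.
rewrite (negbTE (isK_notN lK)) /= /expsum big_seq1.
have [//|cK] := boolP (c \in K).
by case: eqP => [e|]; rewrite ?addr0 //; move: cK; rewrite -e (lK : _ \in _).
Qed.

Lemma expsum_gimg c mu b : expsum c (gimg mu b) =
  if c \in K then (if b \in K then coef mu b true c
                   else coef mu b true c + coef mu b false c) else (b == c)%:R.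
Proof.
rewrite !gimgE; case: (boolP (b \in K)) => bK.
  rewrite expsum_K ?all_vword //; have [cK|cK] := boolP (c \in K).
    by rewrite gsum_vword.
  by case: eqP => // e; move: cK; rewrite -e bK.
rewrite -[(b, true) :: _]cat1s !expsum_cat !(expsum_K _ (all_vword _ _ _ _)).
rewrite [expsum c [:: _]]big_seq1 /=; case: (boolP (c \in K)) => cK.
  rewrite !gsum_vword //=; case: eqP => [e|_]; last by rewrite add0r.
  by move: bK; rewrite e cK.
by rewrite add0r addr0; case: eqP.
Qed.

Section Morphism.
Variables (alpha : raag G -> raag G) (f : G -> word G).
Hypothesis alphaM : {morph alpha : x y / (x * y)%g}.
Hypothesis alphaf : forall b, alpha (gen b) = wval (f b).

Lemma morph_wval w : alpha (wval w) = wval (wsub f w).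
Proof.
elim: w => [|l w IHw]; first exact: gmorph1 alphaM.
rewrite -[l :: w]cat1s wvalM alphaM IHw wsub_cat wsub1 wvalM; congr (_ * _)%g.
case: l => b [] /=; first exact: alphaf.
rewrite /lsub /= wvalV -[wval [:: (b, false)]]/(wval (winv [:: (b, true)])) wvalV.
by rewrite (gmorphV alphaM) alphaf.
Qed.

Lemma morph_preserving : preserving f.
Proof.
move=> b c bc; rewrite /commute -!alphaf -!alphaM; congr alpha.
by rewrite -!wvalM; apply/weqP/weq_adj.
Qed.

End Morphism.

(** Necessity of the determinant condition: in exponent sums, the inverse
    automorphism carries generators of the class to words in which vertices
    outside the class have sum 0, so that its exponent sums on the class form
    an inverse of the matrix. *)
Lemma Omega_coefs alpha : Omega a alpha -> exists mu,
  [/\ comm_eqs a mu 0, unimodular a mu 0 & forall b, alpha (gen b) = wval (gimg mu b)].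
Proof.
move=> [[alphaM [beta alphaK betaK]] outK inK].
have wordK g : star_subgroup a g -> exists2 z, all isK z & g = wval z.
  pose M := [set g | exists2 z, all isK z & g = wval z]%classic.
  move=> /(_ M); apply; split; first split.
  - by apply: mem_set; exists [::].
  - move=> x y /set_mem[z zK ->] /set_mem[z' zK' ->]; apply: mem_set.
    exists (z ++ winv z'); first by rewrite all_cat zK all_winvK.
    by rewrite wvalM wvalV.
  - by move=> _ [b bK <-]; exists [:: (b, true)]; rewrite //= andbT.
have ex b : exists uv : word G * word G, [/\ all isK uv.1, all isK uv.2 &
    alpha (gen b) = wval (if b \in K then uv.1 else uv.1 ++ (b, true) :: uv.2)].
  have [bK|bK] := boolP (b \in K).
    have [z zK e] := wordK _ (inK _ bK).
    by exists (z, [::]).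
  have [u [v [/wordK[zu uK ->] /wordK[zv vK ->] e]]] := outK _ bK.
  by exists (zu, zv); split=> //; rewrite e wvalM (wval_cons _ zv) mulgA.
have [F FP] := choice ex.
pose mu := coefs_of (fun b (s : bool) c => gsum c 0 (if s then (F b).1 else (F b).2)).
have muE b : alpha (gen b) = wval (gimg mu b).
  have [uK vK ->] := FP b; rewrite !gimgE.
  have vecE s : wval (vword mu b s) = wval (if s then (F b).1 else (F b).2).
    apply: (@eq_wvalK _ a) => [||c cK]; rewrite ?all_vword //; first by case: s.
    by rewrite gsum_vword // coef_of.
  case: ifP => bK; first by rewrite vecE.
  by rewrite !wvalM (wval_cons _ (vword _ _ _)) (wval_cons _ (F b).2) !vecE.
exists mu; split=> //; first exact/comm_eqs_necessary/(morph_preserving alphaM muE).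
rewrite unimodular_unit.
pose w b := repr (beta (gen b)).
have wE b c : \sum_d expsum d (w b) * expsum c (gimg mu d) = (b == c)%:R.
  rewrite -expsum_wsub (expsum_weq c (_ : weq _ [:: (b, true)])); last first.
    by apply/weqP; rewrite -(morph_wval alphaM muE) wval_repr betaK.
  by rewrite /expsum big_seq1 /sg; case: eqP.
have w0 b c : b \in K -> c \notin K -> expsum c (w b) = 0.
  move=> bK cK; have := wE b c; rewrite (bigD1 c) //= expsum_gimg (negbTE cK) eqxx mulr1.
  rewrite big1 => [|d /negbTE nd]; last by rewrite expsum_gimg (negbTE cK) nd mulr0.
  by rewrite addr0 => ->; case: eqP bK cK => // -> ->.
pose B := \matrix_(i, j) expsum (enum_val i) (w (enum_val j)) : 'M[int]_#|K|.
suff /mulmx1_unit[] : class_mx a mu *m B = 1%:M by [].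
apply/matrixP => i j; rewrite !mxE -(inj_eq enum_val_inj).
rewrite eq_sym -wE [RHS](bigID [in K]) /= [X in _ + X]big1 ?addr0; last first.
  by move=> d dK; rewrite w0 ?enum_valP // mul0r.
rewrite [RHS]big_enum_val /=; apply: eq_bigr => k _.
by rewrite !mxE mulrC expsum_gimg !enum_valP.
Qed.

End Necessity.

Local Close Scope ring_scope.

(** * Shortest words with the labels of an image *)

Section Reduced.
Variables (G : sgraph) (a : G).
Implicit Types (u v w p q r z t : word G) (x y l : vertex G * bool) (b c d : G).
Implicit Types (mu : coefs G).

Local Notation K := (star_class a).
Local Notation isN := (isN a).
Local Notation isK := (isK a).
Local Notation nN := (nN a).
Local Notation gsum := (gsum a).
Local Notation gapcount := (gapcount a).
Local Notation skel := (skel a).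
Local Notation vword := (vword a).
Local Notation gimg := (gimg a).
Local Notation eqlab := (eqlab a).

(** Unlike for a cyclic word, the inverse letters have a single interval between
    them. *)
Definition cancellable t := exists p1 l p2 p3,
  t = p1 ++ l :: p2 ++ linv l :: p3 /\ all (com l) p2.

Lemma cancellable_cat u t v : cancellable t -> cancellable (u ++ t ++ v).
Proof.
move=> [p1 [l [p2 [p3 [-> p2c]]]]]; exists (u ++ p1), l, p2, (p3 ++ v); split=> //.
by rewrite -!catA /= -catA.
Qed.

Lemma cat_split_at (T : Type) (p s q r : seq T) : p ++ s = q ++ r ->
  (exists2 m : seq T, q = p ++ m & s = m ++ r) \/
  (exists (x : T) (m : seq T), p = q ++ x :: m /\ r = x :: m ++ s).
Proof.
elim: p q => [|x p IHp] [|y q] /=; first by move=> ->; left; exists [::].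
- by move=> ->; left; exists (y :: q).
- by move=> <-; right; exists x, p.
case=> -> /IHp [[m -> ->]|[z [m [-> ->]]]]; first by left; exists m.
by right; exists z, m.
Qed.

(** In the square of a word every arc of the cyclic word is an interval; the
    intervals that wrap around or are longer than [w] have to be cut. *)
Lemma cancellable_double w : cancellable (w ++ w) -> exists r, cancels w r.
Proof.
move=> [p1 [l [p2 [p3 [e p2c]]]]].
case: (cat_split_at e) => [[m p1E wE]|[x [m [wE e2]]]].
  exists (m ++ p2 ++ p3), m, p2, p3, l; split=> //; first by rewrite p2c.
  exact: ceq_refl.
case: e2 => xl e2; subst x.
have {}e2 : m ++ w = p2 ++ linv l :: p3 by [].
case: (cat_split_at e2) => [[m' p2E wE']|[x [m' [mE e3]]]].
  (* the interval wraps around: it consists of the end [m] of [w] and of the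
     beginning [m'] of the next copy *)
  rewrite p2E all_cat in p2c; case/andP: p2c => mc m'c.
  have e4 : p1 ++ l :: m = m' ++ linv l :: p3 by rewrite -wE wE'.
  case: (cat_split_at e4) => [[n m'E e5]|[x [n [p1E e5]]]].
    case: n => [|y n] in m'E e5 *.
      by case: e5 => e5 _; have /= := congr1 snd e5; case: (l.2).
    case: e5 => e5 _; move: m'c; rewrite m'E all_cat /= -e5 com_irr andbF //.
  case: e5 => e5 p3E; subst x.
  exists (m' ++ n ++ m), m', n, m, (linv l); split; last exact: ceq_refl.
    by rewrite linvK wE p1E -catA.
  by apply/orP; right; rewrite all_cat; apply/andP; split.
case: e3 => e3 p3E; subst x.
exists (p1 ++ p2 ++ m'), p1, p2, m', l; split; last exact: ceq_refl.
  by rewrite wE mE.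
by rewrite p2c.
Qed.

Lemma gapcount_split l t : ~~ isN l -> 0 < gapcount l 0 t ->
  exists p2 p3, [/\ t = p2 ++ l :: p3, all (predC isN) p2 & l \notin p2].
Proof.
move=> lN; elim: t => //= y t IHt; case: ifPn => // yN.
have [<- _|yl] := eqVneq y l; first by exists [::], t.
rewrite add0n => /IHt[p2 [p3 [-> p2N lp2]]]; exists (y :: p2), p3; split=> //=.
  by rewrite yN.
by rewrite inE eq_sym negb_or yl.
Qed.

Lemma eq_letter x (z : vertex G * bool) : x.1 = z.1 -> z = x \/ z = linv x.
Proof. by case: x z => [e []] [f []] /= ->; [left|right|right|left]. Qed.

Lemma gapcount_mem x p q : all (predC isN) p -> x \in p -> 0 < gapcount x 0 (p ++ q).
Proof.
elim: p => //= e p IHp /andP[eN pN]; rewrite inE (negbTE eN) => /orP[/eqP ->|xp].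
  by rewrite eqxx.
by rewrite (leq_trans (IHp pN xp)) // leq_addl.
Qed.

(** A letter of the class commutes with its gap; two inverse ones that are
    closest to each other have neither of them in between. *)
Lemma gapcount_cancellable l j t : isK l -> 0 < gapcount l j t -> 0 < gapcount (linv l) j t ->
  cancellable t.
Proof.
move=> lK; elim: t j => //= y t IHt j.
have consP : cancellable t -> cancellable (y :: t) by move/(cancellable_cat [:: y] [::]); rewrite cats0.
case: ifPn => yN.
  by case: j => // j l1 l2; apply/consP/(IHt j).
case: j => [|j]; last by rewrite !add0n => l1 l2; apply/consP/(IHt j.+1).
have stepP x : isK x -> y = x -> gapcount x 0 t = 0 -> 0 < gapcount (linv x) 0 t ->
    cancellable (y :: t).
  move=> xK -> x0 /gapcount_split[|p2 [p3 [tE p2N xp2]]]; first exact: isK_notN.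
  exists [::], x, p2, p3; split; first by rewrite tE.
  apply/allP => z zp2; apply: class_adj xK _ _.
    by have := allP p2N z zp2; rewrite /= ?isNE negbK.
  apply/negP => /eqP /eq_letter[e|e]; subst z; last by rewrite zp2 in xp2.
  by have := gapcount_mem (linv x :: p3) p2N zp2; rewrite -tE x0.
rewrite !eqxx /=; have [yl|yl] := eqVneq y l; have [yl'|yl'] := eqVneq y (linv l).
- by move: yl'; rewrite yl => /(congr1 snd) /=; case: (l.2).
- rewrite /= add0n => _ l2; have [l0|l1] := posnP (gapcount l 0 t).
    exact: stepP yl l0 l2.
  exact/consP/(IHt 0).
- rewrite /= add0n => l1 _; have [l0|l2] := posnP (gapcount (linv l) 0 t).
    by apply: stepP yl' l0 _; rewrite ?linvK.
  exact/consP/(IHt 0).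
- by rewrite /= !add0n => l1 l2; apply/consP/(IHt 0).
Qed.

Local Open Scope ring_scope.

(** The inner gaps of the square of a word are the gaps of the cyclic word. *)
Lemma label_double c i w : (0 < i < nN w + nN w)%N -> gsum c i (w ++ w) =
  label a c (if (i <= nN w)%N then i else i - nN w)%N w.
Proof.
case/andP; case: i => // i _ lt_i; rewrite gsum_cat.
case: (ltngtP i.+1 (nN w)) => [lt|gt|e].
- by rewrite /label ltn_eqF.
- have lt2 : (i.+1 - nN w < nN w)%N by rewrite ltn_subLR // ltnW.
  rewrite gsum_gt // add0r; case e: (i.+1 - nN w)%N => [|k].
    by move/eqP: e; rewrite subn_eq0 leqNgt gt.
  by rewrite /label -e ltn_eqF // addr0.
- by rewrite /label e eqxx subnn.
Qed.

Lemma eqlab_double u v c i : eqlab u v -> c \in K -> (0 < i < nN u + nN u)%N ->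
  gsum c i (u ++ u) = gsum c i (v ++ v).
Proof.
move=> uv cK; have nE := eqlab_nN uv => lt_i.
by rewrite !label_double -?nE //; case: uv => _; apply.
Qed.

Lemma eqlab_trans v u w : eqlab u v -> eqlab v w -> eqlab u w.
Proof. by move=> [s1 l1] [s2 l2]; split=> [|c i cK]; rewrite ?s1 // l1 ?l2. Qed.

(** Letters of the class that can be cancelled are in one gap of the cyclic
    word, although the second alternative may put them in the two linear gaps that
    the label of the last index adds up. *)
Lemma eqlab_cancel p m q l : isK l ->
  all (com l) m || all (com l) (q ++ p) ->
  eqlab (p ++ m ++ q) (p ++ l :: m ++ linv l :: q).
Proof.
move=> lK cm.
have skE x w : isK x -> skel (x :: w) = skel w by move=> xK /=; rewrite xK.
have nE x w : isK x -> nN (x :: w) = nN w.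
  by move=> xK; rewrite !nNE /= (negbTE (isK_notN xK)).
have noN z : all (com l) z -> nN z = 0%N.
  move=> lz; apply/eqP; rewrite -leqn0 leqNgt -has_count; apply/hasPn => x xz.
  by rewrite negbK; apply: class_notN lK _; apply: (allP lz).
have lcons c i x w : isK x -> gsum c i (x :: w) =
    (if (i == 0%N) && (x.1 == c) then sg x.2 else 0) + gsum c i w.
  by move=> xK; rewrite gsum_cons (negbTE (isK_notN xK)).
have sE : skel (p ++ m ++ q) = skel (p ++ l :: m ++ linv l :: q).
  by rewrite !skel_cat skE // skel_cat skE.
have nnE : nN (p ++ l :: m ++ linv l :: q) = nN (p ++ m ++ q).
  by rewrite -nN_skel -sE nN_skel.
have sgN : sg (linv l).2 = - sg l.2 by rewrite /sg /=; case: l.2.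
split=> // c i cK; case/orP: cm => cm.
  have gsumE j : gsum c j (p ++ l :: m ++ linv l :: q) = gsum c j (p ++ m ++ q).
    rewrite !gsum_cat; congr (_ + _); case: ifP => // _.
    rewrite lcons // !gsum_cat lcons // (noN _ cm) leq0n subn0 sgN.
    by case: ifP => _; ring.
  by rewrite /label !gsumE nnE.
move: cm; rewrite all_cat => /andP[/noN q0 /noN p0].
have gsumE j : gsum c j (p ++ l :: m ++ linv l :: q) = gsum c j (p ++ m ++ q) +
    (if l.1 == c then ((j == 0%N)%:R - (j == nN m)%:R) * sg l.2 else 0).
  rewrite !gsum_cat p0 leq0n subn0 lcons // gsum_cat lcons // sgN /=.
  rewrite subn_eq0; case: (ltngtP j (nN m)) => // jm; case: (l.1 == c);
    case: (j == 0%N); rewrite ?andbT ?andbF /=; ring.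
have nm : nN (p ++ m ++ q) = nN m by rewrite !nN_cat p0 q0 addn0.
rewrite /label nnE !gsumE nm; case: i => [|i].
  case: (nN m =P 0%N) => // ->; case: (l.1 == c) => /=; ring.
case: (i.+1 =P nN m) => [<-|ne] /=; case: (l.1 == c) => /=; ring.
Qed.

Lemma filter_split (T : Type) (P : pred T) (s s1 s2 : seq T) (x : T) :
  filter P s = s1 ++ x :: s2 ->
  exists q1 q2 : seq T, [/\ s = q1 ++ x :: q2, filter P q1 = s1 & filter P q2 = s2].
Proof.
elim: s s1 => [|y s IHs] s1 /=; first by case: s1.
case: ifP => Py; last first.
  by move=> /IHs[q1 [q2 [-> <- <-]]]; exists (y :: q1), q2; rewrite /= Py.
case: s1 => [|z s1] [<-]; first by move=> <-; exists [::], s.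
by move=> /IHs[q1 [q2 [-> <- <-]]]; exists (y :: q1), q2; rewrite /= Py.
Qed.

(** Each letter of N in [q], inverse or not, puts [- x0] before it and [x0] after
    it. These cancel in the inner gaps, so that only the ends remain besides
    the action on the class. *)
Lemma gsum_wsub_between mu q c (x0 : int) : c \in K ->
  (forall l, l \in q -> ~~ isK l -> coef mu l.1 true c + coef mu l.1 false c = 0) ->
  (forall l, l \in q -> isN l -> coef mu l.1 false c = x0) ->
  forall j, gsum c j (wsub (gimg mu) q) =
    \sum_(d in K) gsum d j q * coef mu d true c +
    ((j == nN q)%:R - (j == 0%N)%:R) * x0.
Proof.
move=> cK; elim: q => [|l q IHq] sum0 vx j.
  rewrite big1 => [|d _]; last by rewrite gsum_nil mul0r.
  by rewrite [nN [::]]/= subrr mul0r addr0.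
have sub x : x \in q -> x \in l :: q by rewrite inE orbC => ->.
have {}IHq := IHq (fun x xq => sum0 x (sub x xq)) (fun x xq => vx x (sub x xq)).
have nE : nN (l :: q) = (isN l + nN q)%N by [].
have nE1 : nN [:: l] = isN l by rewrite nNE /= addn0.
rewrite gsum_wsub_cons // nE nE1.
have [lK|lK] := boolP (isK l).
  have lN := negbTE (isK_notN lK).
  rewrite lN leq0n subn0 add0n IHq addrA; congr (_ + _).
  under [in RHS]eq_bigr do rewrite gsum_cons lN mulrDl.
  rewrite big_split /=; congr (_ + _).
  rewrite (bigD1 l.1) //= eqxx big1 ?addr0 => [|d /andP[_ /negbTE]]; last first.
    by rewrite eq_sym => ->; rewrite andbF mul0r.
  by rewrite /letter_coef lK /= mul0r addr0 andbT.
have := sum0 l (mem_head _ _) lK; have [lN|lN] := boolP (isN l); last first.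
  move=> s0; rewrite leq0n subn0 add0n IHq /letter_coef (negbTE lK) (negbTE lN).
  rewrite -mulrDr s0 mulr0 add0r; congr (_ + _); apply: eq_bigr => d dK.
  rewrite gsum_cons (negbTE lN) (_ : (l.1 == d) = false) ?andbF ?add0r //.
  by apply: contraNF lK => /eqP e; rewrite ?isKE e.
have vE := vx l (mem_head _ _) lN; rewrite vE => /eqP; rewrite addr_eq0 => /eqP ->.
rewrite /letter_coef (negbTE lK) lN; case: j => [|j].
  rewrite big1 => [|d _]; last by rewrite gsum_cons lN mul0r.
  by case: l.2 => /=; rewrite ?mul0r ?mul1r; ring.
rewrite add1n ltnS leq0n subSS subn0 IHq.
rewrite [in RHS](eq_bigr (fun d => gsum d j q * coef mu d true c)); last first.
  by move=> d _; rewrite gsum_cons lN.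
move: (\sum_(d in K) _) => S; rewrite eqSS.
by case: l.2 => /=; case: j => [|j] /=; ring.
Qed.

Lemma opposite_exponents (t : bool) (ux vx ul vl : int) :
  ux + vx == 0 -> ux - ul == 0 -> ul + vl == 0 -> vx = if t then vl else - ul.
Proof. by case: t; lia. Qed.

Lemma gapcount_balanced x j w : gsum x.1 j w = 0 -> (0 < gapcount x j w)%N ->
  (0 < gapcount (linv x) j w)%N.
Proof. by case: x => e []; rewrite !gsumE /linv /=; lia. Qed.

Section MinimalImage.
Variables (mu : coefs G) (u : word G).
Hypotheses (cmu : comm_eqs a mu 0) (dmu : unimodular a mu 0).
Hypothesis free_u : forall r, ~ cancels u r.

Let not_cancellable : ~ cancellable (u ++ u).
Proof. by move/cancellable_double => [r /free_u]. Qed.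

(** Injectivity of the action on the class. *)
Lemma kernel0 (e : G -> int) :
  (forall c, c \in K -> \sum_(d in K) e d * coef mu d true c = 0) ->
  forall d, d \in K -> e d = 0.
Proof.
move=> e0 d dK; pose v : 'cV[int]_#|K| := \col_j e (enum_val j).
have Av0 : class_mx a mu *m v = 0.
  apply/matrixP => i j; rewrite !mxE -[RHS](e0 (enum_val i)) ?enum_valP //.
  by rewrite [RHS]big_enum_val /=; apply: eq_bigr => k _; rewrite !mxE mulrC.
have v0 : v = 0.
  have Au : class_mx a mu \in unitmx by rewrite -unimodular_unit.
  by rewrite -(mulKmx Au v) Av0 mulmx0.
by move/matrixP: v0 => /(_ (enum_rank_in dK d) 0); rewrite !mxE enum_rankK_in.
Qed.

Lemma gsum_noK c i w : all (predC isK) w -> c \in K -> gsum c i w = 0.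
Proof.
move=> + cK; elim: w i => [|x w IHw] i /=; first by rewrite gsum_nil.
case/andP=> xK wK; rewrite gsum_cons (_ : (x.1 == c) = false).
  rewrite andbF add0r; case: ifP => _; last exact: IHw.
  by case: i => // i; apply: IHw.
by apply: contraNF xK => /eqP e; rewrite ?isKE e.
Qed.

Lemma nN_cons l w : nN (l :: w) = (isN l + nN w)%N.
Proof. by []. Qed.

Lemma gapcount_in x w : ~~ isN x -> x \in w ->
  exists2 j, (j <= nN w)%N & (0 < gapcount x j w)%N.
Proof.
move=> xN; elim: w => // y w IHw; rewrite inE.
have [<-|yx] /= := eqVneq x y.
  by move=> _; exists 0%N; rewrite //= (negbTE xN) eqxx.
move=> /IHw[j jn xj]; have [yN|yN] := boolP (isN y).
  by exists j.+1.
by exists j; rewrite // ltn_addl.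
Qed.

(** A cancellable pair of letters of the class contradicts the minimality of
    [v]. For another pair, the corresponding stretch of [u] differs from that
    of [v] only by letters of the class. If the pair is in the star, it commutes
    with these and is cancellable in [u] at once. If it is in N, no letter of
    the class is between its letters in [v], so the labels inside the stretch of
    the image are 0, which by [gsum_wsub_between] and injectivity on the class
    holds in [u] as well; then the letters of the class in this stretch of [u],
    if any, occur with their inverses and can be cancelled. *)
Lemma reduced_of_min v : eqlab v (wsub (gimg mu) u) ->
  (forall w, eqlab w v -> (size v <= size w)%N) -> forall r, ~ cancels v r.
Proof.
move=> vu vmin r [p [m [q [l [vE cm _]]]]].
have skE : skel v = skel u by rewrite vu.1 skel_wsub.
have [lK|lK] := boolP (isK l).
  have := vmin _ (_ : eqlab (p ++ m ++ q) v); rewrite vE => /(_ (eqlab_cancel lK cm)).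
  rewrite !size_cat /= !size_cat /= leqNgt.
  by rewrite !(addnS, addSn) ltnS ltnW.
have [P1 [l0 [P2 [P3 [DE P2c l0K]]]]] : exists P1 l0 P2 P3,
    [/\ v ++ v = P1 ++ l0 :: P2 ++ linv l0 :: P3, all (com l0) P2 & ~~ isK l0].
  case/orP: cm => cm.
    by exists p, l, m, (q ++ v); split=> //; rewrite {1}vE -!catA /= -catA.
  exists (p ++ l :: m), (linv l), (q ++ p), (m ++ linv l :: q); split=> //.
  by rewrite linvK {1}vE {1}vE -!catA /= -!catA.
apply: not_cancellable.
have sDE : skel (u ++ u) = skel P1 ++ l0 :: skel P2 ++ linv l0 :: skel P3.
  have fc x w : ~~ isK x -> skel (x :: w) = x :: skel w by move=> /= ->.
  by rewrite skel_cat -skE -skel_cat DE skel_cat fc // skel_cat fc.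
have [Q1 [R [EE Q1E RE]]] := filter_split sDE.
have [Q2 [Q3 [{}RE Q2E Q3E]]] := filter_split RE; rewrite {R}RE in EE.
rewrite -!/(skel _) in Q1E Q2E.
have Q2c x : x \in Q2 -> ~~ isK x -> com l0 x.
  move=> xQ xK; apply: (allP P2c).
  have: x \in skel P2 by rewrite -Q2E mem_filter xK.
  by rewrite mem_filter => /andP[].
have lpatI : all (com l0) Q2 -> cancellable (u ++ u) by exists Q1, l0, Q2, Q3.
have [l0N|l0N] := boolP (isN l0); last first.
  apply: lpatI; apply/allP => x xQ; have [xK|xK] := boolP (isK x); last exact: Q2c.
  rewrite com_sym; apply: (class_adj xK); first by rewrite ?isNE negbK in l0N.
  by apply: contraNneq l0K => e; rewrite ?isKE -e.
have P2K : all (predC isK) P2.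
  apply/allP => x xP; apply/negP => xK; move/negP: l0N; apply.
  by apply: class_notN xK _; have := allP P2c x xP; rewrite com_sym.
have nE1 : nN Q1 = nN P1 by rewrite -nN_skel Q1E nN_skel.
have nE2 : nN Q2 = nN P2 by rewrite -nN_skel Q2E nN_skel.
have l0N' : isN (linv l0) by [].
have lexD c j : c \in K -> (j <= nN P2)%N -> gsum c (nN P1 + j.+1)%N (v ++ v) = 0.
  move=> cK le_j; rewrite DE gsum_cat gsum_gt; last by rewrite addnS ltnS leq_addr.
  rewrite leq_addr addKn add0r gsum_cons l0N gsum_cat gsum_noK // add0r.
  case: ifP => // le_j'; have -> : j = nN P2 by apply/eqP; rewrite eqn_leq le_j.
  by rewrite subnn gsum_cons l0N'.
have cP := (comm_eqsP a mu 0).1 cmu.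
have gsumE c j : c \in K -> (j <= nN Q2)%N ->
    gsum c (nN Q1 + j.+1)%N (wsub (gimg mu) (u ++ u)) =
    \sum_(d in K) gsum d j Q2 * coef mu d true c.
  move=> cK le_j; set x0 := gsum c 1 (lsub (gimg mu) l0).
  have x0E : x0 = if l0.2 then coef mu l0.1 false c else - coef mu l0.1 true c.
    rewrite /x0 gsum_lsub // /letter_coef (negbTE l0K) l0N /=.
    by case: l0.2 => /=; rewrite ?mul0r ?mul1r ?add0r ?mulN1r ?oppr0 ?mul0r ?addr0.
  have x0E' : gsum c 0 (lsub (gimg mu) (linv l0)) = - x0.
    have lK' : isK (linv l0) = false by apply: negbTE.
    rewrite x0E gsum_lsub // /letter_coef lK' l0N' /=.
    by case: l0.2 => /=; rewrite ?oppr0 ?mul0r ?mul1r ?add0r ?mulN1r ?opprK ?addr0.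
  have btw := @gsum_wsub_between mu Q2 c x0 cK _ _ j.
  rewrite EE -[l0 :: _]cat1s -[linv l0 :: _]cat1s !wsub_cat !wsub1.
  rewrite gsum_cat gsum_gt ?nN_wsub; last by rewrite addnS ltnS leq_addr.
  rewrite leq_addr addKn add0r gsum_cat nN_lsub nN_cons l0N /= subSS subn0.
  rewrite gsum_cat nN_wsub gsum_cat nN_lsub nN_cons l0N' /=.
  have -> : gsum c j.+1 (lsub (gimg mu) l0) = (j == 0%N)%:R * x0.
    case: j {le_j btw} => [|j]; first by rewrite mul1r.
    by rewrite gsum_gt ?mul0r // nN_lsub nN_cons l0N.
  rewrite btw; last 2 first.
  - move=> x xQ xK; have l0x := Q2c x xQ xK; rewrite com_sym in l0x.
    by have [] := cP _ _ _ l0x l0N xK cK; rewrite dvd0z => /eqP.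
  - move=> x xQ xN; have xK : ~~ isK x by apply: contraL xN; apply: isK_notN.
    have l0x := Q2c x xQ xK; have xl0 := l0x; rewrite com_sym in xl0.
    have [] := cP _ _ _ xl0 l0N xK cK; rewrite !dvd0z => e1 /(_ xN) e2.
    have [] := cP _ _ _ l0x xN l0K cK; rewrite dvd0z => e3 _.
    by rewrite x0E; apply: opposite_exponents e1 e2 e3.
  case: (ltngtP j (nN Q2)) le_j => // [lt_j|->] _ /=.
    by rewrite addr0 sub0r mulNr addrCA addrN addr0.
  by rewrite subnn x0E' mulrBl mul1r addr0; ring.
have lex0 d j : d \in K -> (j <= nN Q2)%N -> gsum d j Q2 = 0.
  move=> dK le_j; apply: (kernel0 (e := fun d => gsum d j Q2)) dK => c cK.
  rewrite -gsumE // wsub_cat -(eqlab_double vu cK).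
    by rewrite nE1 lexD // -nE2.
  apply/andP; split; first by rewrite addnS.
  rewrite -nN_cat DE nN_cat nE1 ltn_add2l nN_cons l0N nN_cat nN_cons l0N' -nE2.
  by rewrite !add1n ltnS addnS ltnS (leq_trans le_j) ?leq_addr.
have [noK|] := boolP (all (predC isK) Q2).
  by apply: lpatI; apply/allP => x xQ; apply: Q2c => //; apply: (allP noK).
rewrite -has_predC => /hasP[x xQ]; rewrite /= negbK => xK.
have [j le_j xj] := gapcount_in (isK_notN xK) xQ.
have lpQ : cancellable Q2.
  apply: (gapcount_cancellable xK xj); apply: gapcount_balanced => //; exact: lex0.
by rewrite EE -cat1s -[_ ++ linv l0 :: _]cat0s catA -/(cancellable _); have := cancellable_cat (Q1 ++ [:: l0]) (linv l0 :: Q3) lpQ; rewrite -catA.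
Qed.

(** A shortest word among those with the labels of the image has no cancellable
    pair. *)
Lemma exists_min_image : exists v, eqlab v (wsub (gimg mu) u) /\
  forall w, conjw v w -> (size v <= size w)%N.
Proof.
pose P n := `[< exists2 v, eqlab v (wsub (gimg mu) u) & size v = n >].
have exP : exists n, P n.
  by exists (size (wsub (gimg mu) u)); apply/asboolP; exists (wsub (gimg mu) u).
case: (ex_minnP exP) => n /asboolP[v vu sv] nmin; exists v; split=> // w vw.
apply: cancel_free_min vw; apply: (reduced_of_min vu) => w' w'v.
rewrite sv; apply: nmin; apply/asboolP; exists w' => //.
exact: eqlab_trans w'v vu.
Qed.

End MinimalImage.

End Reduced.

(** * Linear systems with a unimodular unknown *)

Section Congruence.
Local Open Scope ring_scope.

Definition eqm (m : int) p q (A B : 'M[int]_(p, q)) :=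
  forall i j, (m %| A i j - B i j)%Z.

Lemma mx_subE p q (A B : 'M[int]_(p, q)) i j : (A - B) i j = A i j - B i j.
Proof. by rewrite !mxE. Qed.

Lemma mx_addE p q (A B : 'M[int]_(p, q)) i j : (A + B) i j = A i j + B i j.
Proof. by rewrite mxE. Qed.

Lemma eqm_refl m p q (A : 'M_(p, q)) : eqm m A A.
Proof. by move=> i j; rewrite subrr dvdz0. Qed.

Lemma eqm_sym m p q (A B : 'M_(p, q)) : eqm m A B -> eqm m B A.
Proof. by move=> AB i j; rewrite -opprB rpredN. Qed.

Lemma eqm_trans m p q (B A C : 'M_(p, q)) : eqm m A B -> eqm m B C -> eqm m A C.
Proof.
by move=> AB BC i j; have := rpredD (AB i j) (BC i j); rewrite addrA subrK.
Qed.

Lemma eqm_dvd m n p q (A B : 'M_(p, q)) : (m %| n)%Z -> eqm n A B -> eqm m A B.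
Proof. by move=> mn AB i j; apply: dvdz_trans mn (AB i j). Qed.

Lemma eqm_mull m p q r (C : 'M_(r, p)) (A B : 'M_(p, q)) :
  eqm m A B -> eqm m (C *m A) (C *m B).
Proof.
move=> AB i j; rewrite !mxE -sumrB; apply: rpred_sum => k _.
by rewrite -mulrBr dvdz_mull.
Qed.

Lemma eqm_mulr m p q r (C : 'M_(q, r)) (A B : 'M_(p, q)) :
  eqm m A B -> eqm m (A *m C) (B *m C).
Proof.
move=> AB i j; rewrite !mxE -sumrB; apply: rpred_sum => k _.
by rewrite -mulrBl dvdz_mulr.
Qed.

Lemma eqm_block m p1 p2 q1 q2 (A A' : 'M_(p1, q1)) (B B' : 'M_(p1, q2))
    (C C' : 'M_(p2, q1)) (D D' : 'M_(p2, q2)) :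
  eqm m A A' -> eqm m B B' -> eqm m C C' -> eqm m D D' ->
  eqm m (block_mx A B C D) (block_mx A' B' C' D').
Proof.
move=> AE BE CE DE i j; rewrite -(splitK i) -(splitK j).
case: (split i) (split j) => [k|k] [l|l] /=.
- by rewrite !block_mxEul.
- by rewrite !block_mxEur.
- by rewrite !block_mxEdl.
- by rewrite !block_mxEdr.
Qed.

Lemma dvdz_mulB (m a b c d : int) :
  (m %| a - b)%Z -> (m %| c - d)%Z -> (m %| a * c - b * d)%Z.
Proof.
move=> ab cd; have -> : a * c - b * d = a * (c - d) + (a - b) * d by ring.
by apply: rpredD; [apply: dvdz_mull | apply: dvdz_mulr].
Qed.

Lemma eqm_det m n (A B : 'M_n) : eqm m A B -> (m %| \det A - \det B)%Z.
Proof.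
move=> AB; rewrite /determinant -sumrB; apply: rpred_sum => s _.
rewrite -mulrBr dvdz_mull //.
by elim/big_rec2: _ => [|i a b _]; rewrite ?subrr ?dvdz0 //; apply: dvdz_mulB.
Qed.

Definition unit_mod (m x : int) := (m %| x - 1)%Z || (m %| x + 1)%Z.

Lemma unit_mod_dvd m n x : (m %| n)%Z -> unit_mod n x -> unit_mod m x.
Proof.
by move=> mn /orP[] h; apply/orP; [left|right]; apply: dvdz_trans mn h.
Qed.

Lemma unit_modM m x e : e \is a GRing.unit -> unit_mod m x -> unit_mod m (e * x).
Proof.
case/orP=> /eqP ->; rewrite ?mul1r // mulN1r => /orP[] h; apply/orP.
  by right; rewrite addrC -opprB rpredN.
by left; rewrite -opprD rpredN.
Qed.

Lemma unit_mod_eq m x y : (m %| x - y)%Z -> unit_mod m x -> unit_mod m y.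
Proof.
move=> xy /orP[] h; apply/orP; [left|right].
  have -> : y - 1 = (x - 1) - (x - y) by ring.
  by rewrite rpredB.
have -> : y + 1 = (x + 1) - (x - y) by ring.
by rewrite rpredB.
Qed.

End Congruence.

Section Lifting.
Local Open Scope ring_scope.

(** A diagonal matrix with [m] put above the diagonal and [c] in the lower
    left corner: its determinant differs from the product of the diagonal by
    a multiple of a power of [m], which [c] makes arbitrary. *)
Definition corner_mx n (d : nat -> int) (m c : int) : 'M[int]_n.+1 :=
  \matrix_(i, j) (d i *+ (i == j :> nat) + m *+ (j == i.+1 :> nat)
    + c *+ ((i == n :> nat) && (j == 0%N :> nat))).

Lemma det_corner_mx n d m c : \det (corner_mx n d m c) =
  \prod_(i < n.+1) d i + (-1) ^+ n * m ^+ n * c.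
Proof.
case: n => [|n].
  by rewrite det_mx11 !mxE big_ord1 /= !mulr1n mulr0n addr0 !expr0 !mul1r.
rewrite (expand_det_col _ 0) (bigD1 0) //= (bigD1 ord_max) //= big1 ?addr0.
  congr (_ + _).
    rewrite mxE /= !mulr1n !mulr0n !addr0 big_ord_recl; congr (_ * _).
    rewrite /cofactor addn0 expr0 mul1r -det_tr det_trig.
      apply: eq_bigr => i _; rewrite !mxE /= eqxx mulr1n.
      by rewrite andbF [_ == _.+1]ltn_eqF // !mulr0n !addr0.
    apply/is_trig_mxP => i j ltij; rewrite !mxE /= /bump /= !add1n andbF !eqSS.
    by rewrite gtn_eqF // [_ == _.+1]ltn_eqF ?mulr0n ?addr0 // ltnW.
  rewrite mxE /= eqxx !mulr0n !add0r mulr1n mulrC; congr (_ * _).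
  rewrite /cofactor addn0; congr (_ * _); rewrite det_trig.
    rewrite (eq_bigr (fun=> m)) ?prodr_const ?card_ord // => i _.
    rewrite !mxE /= /bump /= leqNgt ltn_ord /= add0n add1n eqxx mulr1n.
    by rewrite [_ == _.+1 :> nat]ltn_eqF // !andbF !mulr0n addr0 add0r.
  apply/is_trig_mxP => i j ltij; rewrite !mxE /= /bump /=.
  rewrite leqNgt ltn_ord /= add0n add1n andbF.
  rewrite ltn_eqF ?(leq_trans ltij) // gtn_eqF ?mulr0n ?addr0 //.
by move=> i /andP[i0 im]; rewrite mxE /= -!val_eqE /= in i0 im *;
  rewrite (negbTE i0) (negbTE im) !mulr0n !addr0 mul0r.
Qed.

Definition diag_of n (d : nat -> int) : 'M[int]_n :=
  \matrix_(i, j) (d i *+ (i == j :> nat)).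

Lemma det_diag_of n d : \det (diag_of n d) = \prod_(i < n) d i.
Proof.
rewrite det_trig; first by apply: eq_bigr => i _; rewrite mxE eqxx.
by apply/is_trig_mxP => i j ltij; rewrite mxE ltn_eqF.
Qed.

Lemma unitz_cases (x : int) : x \is a GRing.unit -> x = 1 \/ x = -1.
Proof. by case/orP=> /eqP; [left|right]. Qed.

(** The Smith form is diagonal with determinant 1 or -1 modulo the power of [m],
    and the corner entry of [corner_mx] corrects the difference. *)
Lemma lift_unimodular n (m : int) (B : 'M[int]_n) :
  unit_mod (m ^+ n) (\det B) ->
  exists2 B', B' \in unitmx & eqm m B' B.
Proof.
case: n B => [|n] B; first by exists B; [rewrite unitmxE det_mx00 unitr1 | apply: eqm_refl].
have [L Lu [R Ru [d _ BE]]] := int_Smith_normal_form B.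
have {}BE : B = L *m diag_of n.+1 (nth 0 d) *m R by [].
rewrite !unitmxE in Lu Ru => detB.
have eps : exists2 e : int, e \is a GRing.unit &
    (m ^+ n.+1 %| \prod_(i < n.+1) d`_i - e)%Z.
  have: unit_mod (m ^+ n.+1) (\det L * \det R * \det B).
    by apply: unit_modM detB; rewrite unitrM Lu Ru.
  rewrite BE !det_mulmx det_diag_of [X in unit_mod _ X](_ : _ =
     (\det L * \det L) * (\det R * \det R) * \prod_(i < n.+1) d`_i); last by ring.
  have sq (x : int) : x \is a GRing.unit -> x * x = 1 by case/unitz_cases=> ->.
  rewrite !sq // !mul1r => /orP[] h; first by exists 1; rewrite ?unitr1.
  by exists (-1); rewrite ?unitrN1 // opprK.
case: eps => e eu /dvdzP[x xE].
pose D := corner_mx n (nth 0 d) m (- (-1) ^+ n * x * m).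
have detD : \det D = e.
  rewrite det_corner_mx -[e](addrK (\prod_(i < n.+1) d`_i)).
  move/eqP: xE; rewrite subr_eq => /eqP xE; rewrite {1}xE exprS.
  have -> : (-1) ^+ n * m ^+ n * (- (-1) ^+ n * x * m) =
    - ((-1) ^+ n * (-1) ^+ n * (x * (m * m ^+ n))) by ring.
  by rewrite -exprMn mulrNN mulr1 expr1n mul1r; ring.
exists (L *m D *m R).
  by rewrite unitmxE !det_mulmx detD !unitrM Lu eu Ru.
rewrite BE; apply/eqm_mulr/eqm_mull => i j; rewrite !mxE.
have cancel3 (p q r : int) : p + q + r - p = q + r by ring.
rewrite cancel3; apply: rpredD.
  by rewrite -mulr_natr dvdz_mulr.
by rewrite -mulr_natr dvdz_mulr // dvdz_mull.
Qed.

End Lifting.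

Section LocalGlobal.
Local Open Scope ring_scope.

Lemma dvdz_all0 (x : int) : (forall m : nat, (0 < m)%N -> (m %| x)%Z) -> x = 0.
Proof.
move=> /(_ `|x|.+1 isT); rewrite dvdzE /= => /dvdn_leq; case: x => [[|n]|n] //=.
  by move=> /(_ isT); rewrite ltnn.
by move=> /(_ isT); rewrite ltnn.
Qed.

Lemma unitmx_det_unit n (A : 'M[int]_n) : A \in unitmx -> \det A \is a GRing.unit.
Proof. by rewrite unitmxE. Qed.

(** The elementary divisors of the columns are invertible modulo every number,
    hence are 1 or -1, and the Smith form is easily completed. *)
Lemma complete_columns s t (rho : 'M[int]_(s + t, s)) :
  (forall m : nat, (0 < m)%N -> exists2 A : 'M[int]_(s + t),
     unit_mod m (\det A) & eqm m (lsubmx A) rho) ->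
  exists2 W, W \in unitmx & rho = lsubmx W.
Proof.
move=> loc; have [L Lu [R Ru [d _ rhoE]]] := int_Smith_normal_form rho.
pose E := diag_of s (nth 0 d).
have {}rhoE : rho = L *m col_mx E 0 *m R.
  rewrite rhoE; congr (_ *m _ *m _); apply/matrixP => i j; rewrite !mxE.
  case: splitP => k ik; rewrite !mxE ik // gtn_eqF //.
  by rewrite (leq_trans (ltn_ord j)) // leq_addr.
have du (i : 'I_s) : d`_i \is a GRing.unit.
  apply: contraT => ndu; pose m := if d`_i == 0 then 2%N else absz (d`_i).
  have m_gt1 : (1 < m)%N.
    rewrite /m; case: eqP => // /eqP di0; rewrite ltn_neqAle absz_gt0 di0 andbT.
    apply: contra ndu => /eqP di1; rewrite unfold_in /=.
    by case: (d`_i) di1 => [n|n] /=; [move=> <- | case=> <-].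
  have md : (m %| d`_i)%Z.
    rewrite /m; case: eqP => [->|_]; first exact: dvdz0.
    by rewrite dvdzE /= .
  have [A detA AE] := loc m (ltnW m_gt1).
  pose A' := invmx L *m A *m block_mx (invmx R) 0 0 1%:M.
  have detA' : unit_mod m (\det A').
    rewrite !det_mulmx det_ublock det1 mulr1 mulrC mulrA.
    apply: unit_modM detA; rewrite unitrM; apply/andP.
    by split; apply: unitmx_det_unit; rewrite unitmx_inv.
  have colA' : eqm m (lsubmx A') (col_mx E 0).
    have -> : lsubmx A' = invmx L *m lsubmx A *m invmx R.
      rewrite /A' -mulmxA -[A in LHS]hsubmxK mul_row_block !mulmx0 add0r addr0.
      by rewrite mul_mx_row row_mxKl mulmxA.
    have -> : col_mx E 0 = invmx L *m rho *m invmx R.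
      by rewrite rhoE !mulmxA mulVmx // mul1mx mulmxK.
    exact/eqm_mulr/eqm_mull.
  have : (m %| \det A')%Z.
    rewrite (expand_det_col _ (lshift t i)); apply: rpred_sum => k _.
    apply: dvdz_mulr; have := colA' k i; rewrite mxE => h.
    rewrite -[A' _ _](subrK (col_mx E 0 k i)); apply: rpredD => //.
    rewrite !mxE; case: splitP => k' _; rewrite !mxE ?dvdz0 //.
    case: eqP => [->|_]; last by rewrite mulr0n dvdz0.
    by rewrite mulr1n.
  move=> mA; case/orP: detA' => h.
    have : (m %| \det A' - (\det A' - 1))%Z by apply: rpredB.
    by rewrite subKr dvdzE /= dvdn1 gtn_eqF.
  have : (m %| (\det A' + 1) - \det A')%Z by apply: rpredB.
  by rewrite addrAC subrr add0r dvdzE /= dvdn1 gtn_eqF.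
exists (L *m block_mx (E *m R) 0 0 1%:M).
  rewrite unitmx_mul Lu /= unitmxE det_ublock det1 mulr1 -unitmxE unitmx_mul.
  by rewrite Ru andbT unitmxE det_diag_of; apply: rpred_prod => i _; apply: du.
rewrite rhoE -[L in RHS]hsubmxK mul_row_block !mulmx0 add0r addr0 row_mxKl.
by rewrite -[L in LHS]hsubmxK mul_row_col mulmx0 addr0 mulmxA.
Qed.

(** After a change of basis that makes the prescribed columns standard, only the
    lower right block remains to be lifted; the extra power of [m] in the
    hypotheses is what [lift_unimodular] consumes. *)
Lemma lift_columns s t (m : nat) (rho : 'M[int]_(s + t, s)) : (0 < m)%N ->
  (forall m : nat, (0 < m)%N -> exists2 A : 'M[int]_(s + t),
     unit_mod m (\det A) & eqm m (lsubmx A) rho) ->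
  forall A : 'M[int]_(s + t), unit_mod (m%:Z ^+ t.+1) (\det A) ->
    eqm (m%:Z ^+ t.+1) (lsubmx A) rho ->
  exists B, [/\ B \in unitmx, lsubmx B = rho & eqm m B A].
Proof.
move=> m_gt0 loc A detA AE; have [W Wu rhoE] := complete_columns loc.
set M := m%:Z ^+ t.+1 in detA AE.
pose C := invmx W *m A.
have CE : eqm M (lsubmx C) (col_mx 1%:M 0).
  have -> : lsubmx C = invmx W *m lsubmx A.
    by rewrite /C -[A in LHS]hsubmxK mul_mx_row row_mxKl.
  have -> : col_mx 1%:M 0 = invmx W *m rho.
    rewrite rhoE; have : invmx W *m W = 1%:M by rewrite mulVmx.
    rewrite -[W in _ *m W]hsubmxK mul_mx_row => /(congr1 lsubmx).
    by rewrite row_mxKl => ->; rewrite scalar_mx_block block_mxEh row_mxKl.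
  exact: eqm_mull.
pose C0 := block_mx 1%:M (ursubmx C) 0 (drsubmx C).
have CC0 : eqm M C0 C.
  have := CE; rewrite -[lsubmx C]vsubmxK => {}CE; rewrite -[C in eqm _ _ C]submxK.
  apply: eqm_block; rewrite -?/(ulsubmx C) -?/(dlsubmx C); try exact: eqm_refl.
    apply: eqm_sym => i j; have := CE (lshift t i) j.
    by rewrite !col_mxEu !mxE.
  by apply: eqm_sym => i j; have := CE (rshift s i) j; rewrite !col_mxEd !mxE.
have detB : unit_mod M (\det (drsubmx C)).
  have := eqm_det (eqm_sym CC0); rewrite det_ublock det1 mul1r => h.
  apply: unit_mod_eq h _; rewrite det_mulmx; apply: unit_modM detA.
  by apply: unitmx_det_unit; rewrite unitmx_inv.
have [B Bu BE] : exists2 B, B \in unitmx & eqm m B (drsubmx C).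
  apply: lift_unimodular; apply: unit_mod_dvd detB.
  by rewrite /M exprSr dvdz_mulr.
exists (W *m block_mx 1%:M (ursubmx C) 0 B); split.
- by rewrite unitmx_mul Wu unitmxE det_ublock det1 mul1r -unitmxE.
- rewrite rhoE -[W in LHS]hsubmxK mul_row_block mulmx0 addr0 row_mxKl mulmx1 //.
- rewrite -[A](mulKVmx Wu) -/C; apply: eqm_mull.
  apply: (@eqm_trans _ _ _ C0); last first.
    by apply: eqm_dvd CC0; rewrite /M exprS dvdz_mulr.
  by apply: eqm_block; rewrite // ; apply: eqm_refl.
Qed.

Lemma diag_split k q (d : seq int) : sorted dvdz d -> exists s t, [/\ k = (s + t)%N,
  forall i, (i < s)%N -> d`_i != 0 /\ (i < q)%N &
  forall i j, (s <= i < k)%N -> (j < q)%N -> d`_i *+ (i == j) = 0].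
Proof.
move=> d_sorted; pose P i := (d`_i == 0) || (q <= i)%N.
pose s := find P (iota 0 k).
have le_s : (s <= k)%N by have := find_size P (iota 0 k); rewrite size_iota.
exists s, (k - s)%N; split; first by rewrite subnKC.
  move=> i lt_i; have := before_find 0%N lt_i.
  rewrite nth_iota ?(leq_trans lt_i le_s) // /P add0n => /negbT; rewrite negb_or.
  by rewrite -ltnNge => /andP[].
move=> i j /andP[le_i lt_i] lt_j; case: eqP => [ij|_]; last by rewrite mulr0n.
have lt_sk : (s < k)%N := leq_ltn_trans le_i lt_i.
have: P (nth 0%N (iota 0 k) s).
  by apply: nth_find; rewrite has_find size_iota.
rewrite nth_iota // /P add0n leqNgt (leq_ltn_trans le_i) ?ij // orbF => /eqP ds0.
rewrite mulr1n -ij; have [lt_id|] := ltnP i (size d); last by move/(nth_default 0).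
have := sorted_leq_nth (@dvdz_trans) dvdzz 0 d_sorted.
move=> /(_ s i); rewrite !inE ds0 dvd0z lt_id (leq_ltn_trans le_i) //.
by move=> /(_ isT isT le_i) /eqP.
Qed.

(** Exact equations prescribe, up to a unimodular change of basis, the first
    columns of the unknown matrix, and the congruences can be kept. *)
Lemma solve_columns s t q (m : nat) (d : nat -> int) (eta : 'M[int]_(s + t, q))
    (P : 'M[int]_(s + t) -> Prop) : (0 < m)%N ->
  (forall i, (i < s)%N -> d i != 0 /\ (i < q)%N) ->
  (forall M : nat, (0 < M)%N -> exists A, [/\ unit_mod M (\det A),
     eqm M (A *m col_mx (\matrix_(i, j) (d i *+ (i == j :> nat))) 0) eta &
     (m %| M)%N -> P A]) ->
  (forall A B, P A -> eqm m B A -> P B) ->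
  exists A, [/\ A \in unitmx,
    A *m col_mx (\matrix_(i, j) (d i *+ (i == j :> nat))) 0 = eta & P A].
Proof.
set D := \matrix_(i, j) _ => m_gt0 dP loc Pm.
pose inj (i : 'I_s) : 'I_q := Ordinal (dP i (ltn_ord i)).2.
have d0 (i : 'I_s) : d i != 0 by have [] := dP i (ltn_ord i).
pose rho : 'M[int]_(s + t, s) := \matrix_(c, i) (eta c (inj i) %/ d i)%Z.
have ADE (A : 'M[int]_(s + t)) : A *m col_mx D 0 = lsubmx A *m D.
  by rewrite -{1}[A]hsubmxK mul_row_col mulmx0 addr0.
have entry (B : 'M[int]_(s + t, s)) c i : (B *m D) c (inj i) = B c i * d i.
  rewrite mxE (bigD1 i) //= mxE eqxx mulr1n big1 ?addr0 // => k nk.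
  by rewrite mxE (negbTE (_ : k != i :> nat)) ?mulr0n ?mulr0.
have etaE c i : eta c (inj i) = rho c i * d i.
  rewrite mxE divzK //.
  have [|A [_ AE _]] := loc (absz (d i)); first by rewrite absz_gt0.
  have := AE c (inj i); rewrite ADE entry dvdzE /= -dvdzE => h.
  have -> : eta c (inj i) = lsubmx A c i * d i - (lsubmx A c i * d i - eta c (inj i)).
    by rewrite subKr.
  by apply: rpredB; rewrite ?dvdz_mull.
have rhoD : rho *m D = eta.
  apply/matrixP => c j; have [lt_j|le_j] := ltnP j s.
    have -> : j = inj (Ordinal lt_j) by apply: val_inj.
    by rewrite entry -etaE.
  have D0 (B : 'M[int]_(s + t, s)) : (B *m D) c j = 0.
    rewrite mxE big1 // => k _; rewrite mxE ltn_eqF ?mulr0n ?mulr0 //.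
    exact: leq_trans (ltn_ord k) le_j.
  rewrite D0; apply/esym/dvdz_all0 => M M_gt0; have [A [_ AE _]] := loc M M_gt0.
  by have := AE c j; rewrite ADE D0 sub0r rpredN.
pose N := (\prod_(i < s) absz (d i))%N.
have N_gt0 : (0 < N)%N by apply: prodn_gt0 => i; rewrite absz_gt0.
have lsubE (M : nat) (A : 'M[int]_(s + t)) : eqm (M * N)%N (A *m col_mx D 0) eta -> eqm M (lsubmx A) rho.
  move=> AE c i; have := AE c (inj i); rewrite (ADE A) entry etaE -mulrBl => h.
  rewrite -(dvdz_mul2r (d0 i)); apply: dvdz_trans h.
  by rewrite PoszM dvdz_mul // dvdzE /= /N (bigD1 i) //= dvdn_mulr.
have loc' (M : nat) : (0 < M)%N -> exists2 A : 'M[int]_(s + t),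
    unit_mod M (\det A) & eqm M (lsubmx A) rho.
  move=> M_gt0; have [|A [dA AE _]] := loc (M * N)%N; first by rewrite muln_gt0 M_gt0.
  exists A; last exact: lsubE.
  by apply: unit_mod_dvd dA; rewrite PoszM dvdz_mulr.
have [|A [dA AE PA]] := loc (m ^ t.+1 * N)%N; first by rewrite muln_gt0 expn_gt0 m_gt0.
have expE : (m ^ t.+1)%N%:Z = m%:Z ^+ t.+1 by rewrite -natz natrX natz.
have [||B [Bu Brho BA]] := lift_columns m_gt0 loc' (A := A).
- by apply: unit_mod_dvd dA; rewrite PoszM expE dvdz_mulr.
- by rewrite -expE; apply: lsubE.
exists B; split=> //; first by rewrite ADE Brho.
by apply: Pm BA; apply: PA; rewrite expnS -mulnA dvdn_mulr.
Qed.

(** The modulus 0 stands for an exact equation. The Smith form of the exact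
    columns leads to [solve_columns], and one modulus divisible by all the
    others preserves the congruences. *)
Lemma solve_mixed k q (z eta : 'M[int]_(k, q)) (g : 'I_q -> nat) :
  (forall M : nat, (0 < M)%N -> exists2 A : 'M[int]_k, unit_mod M (\det A) &
     forall c j, (gcdn (g j) M %| (A *m z - eta) c j)%Z) ->
  exists2 A : 'M[int]_k, A \in unitmx & forall c j, (g j %| (A *m z - eta) c j)%Z.
Proof.
move=> loc.
pose z0 : 'M[int]_(k, q) := \matrix_(c, j) (if g j == 0%N then z c j else 0).
pose eta0 : 'M[int]_(k, q) := \matrix_(c, j) (if g j == 0%N then eta c j else 0).
have col0 (A : 'M[int]_k) c j :
    (A *m z0 - eta0) c j = if g j == 0%N then (A *m z - eta) c j else 0.
  rewrite !mxE; case: ifP => gj.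
    by congr (_ - _); apply: eq_bigr => i _; rewrite mxE gj.
  by rewrite subr0 big1 // => i _; rewrite mxE gj mulr0.
pose m := (\prod_(j < q | g j != 0) g j)%N.
have m_gt0 : (0 < m)%N by apply: prodn_cond_gt0 => j; rewrite lt0n.
have gm j : g j != 0%N -> (g j %| m)%N.
  by move=> gj; rewrite /m (bigD1 j) //= dvdn_mulr.
have [L Lu [R Ru [d d_sorted z0E]]] := int_Smith_normal_form z0.
have [s [t [kE dP dS]]] := diag_split k q d_sorted; subst k.
pose D : 'M[int]_(s, q) := \matrix_(i, j) (d`_i *+ (i == j :> nat)).
have {}z0E : z0 = L *m col_mx D 0 *m R.
  rewrite z0E; congr (_ *m _ *m _); apply/matrixP => i j; rewrite !mxE.
  case: splitP => i' ii'; rewrite !mxE ii' //; apply: dS => //.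
  by rewrite leq_addr ltn_add2l ltn_ord.
pose P (A : 'M[int]_(s + t)) := forall c j, g j != 0%N ->
  (g j %| (A *m invmx L *m z - eta) c j)%Z.
have [|A B PA AB c j gj|A [Au AE PA]] :=
    @solve_columns s t q m (nth 0 d) (eta0 *m invmx R) P m_gt0 dP.
- move=> M M_gt0; have [A dA Acong] := loc M M_gt0; exists (A *m L); split.
  + by rewrite det_mulmx mulrC; apply: unit_modM dA; apply: unitmx_det_unit.
  + rewrite -mulmxA -/D (_ : L *m col_mx D 0 = z0 *m invmx R); last by rewrite z0E mulmxK.
    rewrite mulmxA; apply: eqm_mulr => c j.
    have := col0 A c j; rewrite mx_subE => ->.
    by case: eqP => [gj|_]; rewrite ?dvdz0 //; have := Acong c j; rewrite gj gcd0n.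
  + move=> mM c j gj; rewrite mulmxK //.
    have := Acong c j; suff -> : gcdn (g j) M = g j by [].
    by apply/gcdn_idPl; apply: dvdn_trans mM; apply: gm.
- have BA : eqm (g j) (B *m invmx L *m z) (A *m invmx L *m z).
    by apply/eqm_mulr/eqm_mulr; apply: eqm_dvd AB; apply: gm.
  have := rpredD (PA c j gj) (BA c j); rewrite !mx_subE.
  by rewrite addrC addrA subrK.
exists (A *m invmx L); first by rewrite unitmx_mul Au unitmx_inv.
move=> c j; have [gj|] := eqVneq (g j) 0%N; last exact: PA.
have : (A *m invmx L *m z0 - eta0) c j = 0.
  rewrite z0E !mulmxA mulmxKV // AE -mulmxA mulVmx // mulmx1.
  by rewrite mx_subE subrr.
by rewrite col0 gj eqxx dvd0z => ->.
Qed.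

(** The Smith form of [y] eliminates the arbitrary matrix: its columns turn the
    equations into congruences modulo the elementary divisors of [y], exact
    where there is none. *)
Theorem local_global k p q (z : 'M[int]_(k, q)) (y : 'M[int]_(p, q))
    (eta : 'M[int]_(k, q)) :
  (forall M : nat, (0 < M)%N -> exists2 AT : 'M[int]_k * 'M[int]_(k, p),
     unit_mod M (\det AT.1) & eqm M (AT.1 *m z + AT.2 *m y) eta) ->
  exists2 AT : 'M[int]_k * 'M[int]_(k, p),
    AT.1 \in unitmx & AT.1 *m z + AT.2 *m y = eta.
Proof.
move=> loc; have [S Su [Q Qu [f _ yE]]] := int_Smith_normal_form y.
set Y := \matrix_(i, j) _ in yE.
pose g (j : 'I_q) := if (j < p)%N then absz f`_j else 0%N.
have TY (T : 'M[int]_(k, p)) c (j : 'I_q) (lt_j : (j < p)%N) :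
    (T *m Y) c j = T c (Ordinal lt_j) * f`_j.
  rewrite mxE (bigD1 (Ordinal lt_j)) //= mxE eqxx mulr1n big1 ?addr0 // => i ni.
  by rewrite mxE (negbTE (_ : i != j :> nat)) ?mulr0n ?mulr0.
have TY0 (T : 'M[int]_(k, p)) c (j : 'I_q) : (p <= j)%N -> (T *m Y) c j = 0.
  move=> le_j; rewrite mxE big1 // => i _; rewrite mxE ltn_eqF ?mulr0n ?mulr0 //.
  exact: leq_trans (ltn_ord i) le_j.
have [|A Au Acong] := @solve_mixed k q (z *m invmx Q) (eta *m invmx Q) g.
  move=> M M_gt0; have [[A T] /= dA AE] := loc M M_gt0; exists A => // c j.
  rewrite mx_subE; have := eqm_mulr (invmx Q) AE; rewrite yE mulmxDl !mulmxA mulmxK // => /(_ c j).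
  rewrite ?mx_subE mx_addE => h.
  set x := (_ *m _ *m _) c j in h *; set e := (eta *m _) c j in h *.
  have -> : x - e = (x + (T *m S *m Y) c j - e) - (T *m S *m Y) c j by ring.
  apply: rpredB; first by apply: dvdz_trans h; rewrite dvdzE /= dvdn_gcdr.
  have [lt_j|le_j] := ltnP j p; last by rewrite TY0 // dvdz0.
  by rewrite TY dvdz_mull // /g lt_j dvdzE /= dvdn_gcdl.
pose T : 'M[int]_(k, p) := \matrix_(c, i)
  (if insub (i : nat) is Some j then
     ((eta *m invmx Q - A *m (z *m invmx Q)) c j %/ f`_i)%Z else 0).
exists (A, T *m invmx S) => //=.
have key : A *m (z *m invmx Q) + T *m Y = eta *m invmx Q.
  apply/matrixP => c j; rewrite mxE.
  have := Acong c j; rewrite -[X in (_ %| X)%Z -> _]opprK.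
  have -> : - (A *m (z *m invmx Q) - eta *m invmx Q) c j =
    (eta *m invmx Q - A *m (z *m invmx Q)) c j.
    by rewrite !mx_subE opprB.
  rewrite rpredN; have [lt_j|le_j] := ltnP j p; last first.
    rewrite TY0 // addr0 /g ltnNge le_j /= dvd0z => /eqP.
    by rewrite mx_subE => /eqP; rewrite subr_eq0 => /eqP ->.
  have TE : T c (Ordinal lt_j) = ((eta *m invmx Q - A *m (z *m invmx Q)) c j %/ f`_j)%Z.
    by rewrite mxE /= valK.
  rewrite TY TE /g lt_j => h; rewrite divzK; last by move: h; rewrite !dvdzE.
  by rewrite mx_subE addrC subrK.
rewrite yE !mulmxA mulmxKV // -[eta](mulmxKV Qu) -key mulmxDl !mulmxA.
by rewrite mulmxKV.
Qed.

End LocalGlobal.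

(** * Computability of the certificates *)

Section ConjugacyAlgorithm.
Variable G : sgraph.

Lemma crot1 (C T : countType) (s : C -> seq T) :
  computable s -> computable (fun c => rot 1 (s c)).
Proof.
move=> cs; apply: computable_ext (computable_match
  (f := fun q : C * (T * seq T) => rcons q.2.2 q.2.1) (g := fun _ => [::]) cs _
  (computable_const _ _)) _.
  by apply: crcons; comp_proj.
by move=> c; case: (s c) => [|x t] //; rewrite rot1_cons.
Qed.

Lemma cfin2 (C T : countType) (F1 F2 : finType) (f : F1 -> F2 -> T)
    (x : C -> F1) (y : C -> F2) :
  computable x -> computable y -> computable (fun c => f (x c) (y c)).
Proof.
move=> cx cy; apply: (computable_comp2 (F := f)) cx cy.
exact: (computable_fin (F := (F1 * F2)%type)).
Qed.

Lemma cmoves : computable (@moves G).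
Proof.
have cm : computable (fun w : word G => if w is x :: w' then if w' is y :: r then
    (if com x y then [:: y :: x :: r] else [::]) ++
    (if y == linv x then [:: r] else [::]) else [::] else [::]).
  apply: (computable_match (s := fun w : word G => w) (f := fun q =>
    if q.2.2 is y :: r then
    (if com q.2.1 y then [:: y :: q.2.1 :: r] else [::]) ++
    (if y == linv q.2.1 then [:: r] else [::]) else [::])).
  - exact: computable_id.
  - apply: (computable_match (s := fun q : word G * ((vertex G * bool) * word G) => q.2.2)
      (f := fun r => (if com r.1.2.1 r.2.1 then [:: r.2.1 :: r.1.2.1 :: r.2.2] else [::]) ++
        (if r.2.1 == linv r.1.2.1 then [:: r.2.2] else [::]))).
    + by comp_proj.
    + apply: ccat; apply: computable_if; try exact: computable_const.
      * by apply: cfin2; comp_proj.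
      * apply: computable_cons; last exact: computable_const.
        by do 2![apply: computable_cons; first by comp_proj]; comp_proj.
      * apply: computable_eq; first by comp_proj.
        apply: computable_comp (computable_fin (@linv G)) _; by comp_proj.
      * by apply: computable_cons; comp_proj.
    + exact: computable_const.
  - exact: computable_const.
exact: computable_cons (crot1 (computable_id _)) cm.
Qed.

Lemma cwords_upto : computable (@words_upto G).
Proof.
apply: cflatten; apply: (cmap (s := fun n => iota 0 n.+1)
  (f := fun q : nat * nat => lists (enum {: vertex G * bool}) q.2)).
  by apply: ciota0; apply: csucc; apply: computable_id.
by apply: clists; [apply: computable_const | comp_proj].
Qed.

Lemma cdescendants : computable (@descendants G).
Proof.
apply: (computable_iter (f := fun q : word G * seq (word G) => expand q.2)
  (n := fun u => size (words_upto G (size u))) (a := fun u => [:: u])).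
- apply: csize; apply: computable_comp cwords_upto _; apply: csize; exact: computable_id.
- apply: ccat; first by comp_proj.
  apply: cflatten; apply: (cmap (s := fun q : word G * seq (word G) => q.2)
    (f := fun r => moves r.2)); first by comp_proj.
  by apply: computable_comp cmoves _; comp_proj.
- by apply: computable_cons; [apply: computable_id | apply: computable_const].
Qed.

Lemma cmem (C T : countType) (x : C -> T) (s : C -> seq T) :
  computable x -> computable s -> computable (fun c => x c \in s c).
Proof.
move=> cx cs; apply: computable_ext (chas (p := fun q : C * T => q.2 == x q.1) cs _) _.
  by apply: computable_eq; [comp_proj | apply: computable_comp cx _; comp_proj].
by move=> c; rewrite -has_pred1.
Qed.

Lemma cconjb (C : countType) (u v : C -> word G) :
  computable u -> computable v -> computable (fun c => conjb (u c) (v c)).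
Proof.
move=> cu cv; apply: (chas (s := fun c => descendants (u c))
  (p := fun q : C * word G => q.2 \in descendants (v q.1))).
  exact: computable_comp cdescendants cu.
apply: cmem; first by comp_proj.
by apply: computable_comp cdescendants _; apply: computable_comp cv _; comp_proj.
Qed.

Lemma cshortest : computable (@shortest G).
Proof.
have cW (C : countType) (u : C -> word G) : computable u ->
    computable (fun c => words_upto G (size (u c))).
  by move=> cu; apply: computable_comp cwords_upto _; apply: csize.
apply: computable_ext (computable_match
  (s := fun u : word G => [seq w <- words_upto G (size u) | conjb u w &&
    all (fun v => conjb u v ==> (size w <= size v)) (words_upto G (size u))])
  (f := fun q => q.2.1) (g := fun u => u) _ _ _) _.
- apply: (cfilter (p := fun q : word G * word G => conjb q.1 q.2 &&
    all (fun v => conjb q.1 v ==> (size q.2 <= size v)) (words_upto G (size q.1)))).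
    by apply: cW; apply: computable_id.
  apply: cand; first by apply: cconjb; comp_proj.
  apply: (call (s := fun q : word G * word G => words_upto G (size q.1))
    (p := fun r => conjb r.1.1 r.2 ==> (size r.1.2 <= size r.2))).
    by apply: cW; comp_proj.
  apply: cimp; first by apply: cconjb; comp_proj.
  by apply: cleq; apply: csize; comp_proj.
- by comp_proj.
- exact: computable_id.
- by move=> u; rewrite /shortest; case: filter.
Qed.

End ConjugacyAlgorithm.

Section Labels.
Variables (G : sgraph) (a : G).
Local Notation K := (star_class a).
Local Notation letter := (vertex G * bool)%type.

Lemma cskel : computable (@skel G a).
Proof.
apply: (cfilter (s := fun w : word G => w) (p := fun q => ~~ isK a q.2)).
  exact: computable_id.
by apply: computable_comp (computable_fin (fun l : letter => ~~ isK a l)) _; comp_proj.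
Qed.

Lemma cnN : computable (@nN G a).
Proof.
apply: computable_ext (csize (cfilter (s := fun w : word G => w)
  (p := fun q => isN a q.2) (computable_id _) _)) _.
  by apply: computable_comp (computable_fin (isN a)) _; comp_proj.
by move=> w; rewrite size_filter.
Qed.

Lemma cgapcount (l : letter) (C : countType) (i : C -> nat) (w : C -> word G) :
  computable i -> computable w -> computable (fun c => gapcount a l (i c) (w c)).
Proof.
move=> ci cw.
pose step (q : C * ((nat * nat) * letter)) : nat * nat :=
  if isN a q.2.2 then (q.2.1.1.+1, q.2.1.2)
  else (q.2.1.1, q.2.1.2 + ((q.2.1.1 == i q.1) && (q.2.2 == l))).
have cs : computable step.
  apply: computable_if.
  - by apply: computable_comp (computable_fin (isN a)) _; comp_proj.
  - by apply: computable_pair; [apply: csucc|]; comp_proj.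
  - apply: computable_pair; first by comp_proj.
    apply: cadd; first by comp_proj.
    apply: computable_comp (computable_fin nat_of_bool) _; apply: cand.
      apply: computable_eq; first by comp_proj.
      by apply: computable_comp ci _; comp_proj.
    by apply: computable_eq; comp_proj.
apply: computable_ext (csnd (computable_foldl cw cs (computable_const _ (0, 0)))) _.
move=> c; suff key v k acc : (foldl (fun y x => step (c, (y, x))) (k, acc) v).2 =
    acc + (if k <= i c then gapcount a l (i c - k) v else 0).
  by rewrite key subn0.
elim: v k acc => [|y v IHv] k acc /=; first by case: ifP; rewrite addn0.
rewrite {2}/step /=; case: (isN a y); rewrite IHv.
  case: (ltngtP k (i c)) => [lt|//|->]; last by rewrite subnn.
  by rewrite -(subnSK lt).
rewrite -addnA; congr (_ + _); rewrite subn_eq0.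
by case: (ltngtP k (i c)) => _.
Qed.

Local Open Scope ring_scope.

Lemma icomp_gsum (d : G) (C : countType) (i : C -> nat) (w : C -> word G) :
  computable i -> computable w -> icomputable (fun c => gsum a d (i c) (w c)).
Proof. by move=> ci cw; apply: icomp_sub; apply/icomp_nat/cgapcount. Qed.

Lemma icomp_if (C : countType) (b : C -> bool) (f g : C -> int) :
  computable b -> icomputable f -> icomputable g ->
  icomputable (fun c => if b c then f c else g c).
Proof.
move=> cb [p [n [cp cn fE]]] [q [m [cq cm gE]]].
exists (fun c => if b c then p c else q c), (fun c => if b c then n c else m c).
by split; [exact: computable_if | exact: computable_if | move=> c; case: (b c)].
Qed.

Lemma icomp_label (d : G) (C : countType) (i : C -> nat) (w : C -> word G) :
  computable i -> computable w -> icomputable (fun c => label a d (i c) (w c)).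
Proof.
move=> ci cw; have cn : computable (fun c => nN a (w c)).
  exact: computable_comp cnN cw.
have c0 := computable_const C 0%N.
apply: icomp_ext (icomp_if (b := fun c => i c == 0%N) (computable_eq ci c0)
  (icomp_if (computable_eq cn c0) (icomp_gsum d c0 cw) (icomp_const C 0))
  (icomp_add (icomp_gsum d ci cw)
    (icomp_if (computable_eq ci cn) (icomp_gsum d c0 cw) (icomp_const C 0)))) _.
by move=> c; rewrite /label; case: (i c).
Qed.

(** Indices beyond the number of gaps have label 0. *)
Definition eqlab_mod (m : nat) (w v : word G) : bool :=
  (skel a w == skel a v) && all (fun i => all (fun d =>
    (m %| label a d i w - label a d i v)%Z) (enum K)) (iota 0 (nN a w).+1).

Lemma ceqlab_mod (C : countType) (m : C -> nat) (w v : C -> word G) :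
  computable m -> computable w -> computable v ->
  computable (fun c => eqlab_mod (m c) (w c) (v c)).
Proof.
move=> cm cw cv; apply: cand.
  by apply: computable_eq; apply: computable_comp cskel _.
apply: (call (s := fun c => iota 0 (nN a (w c)).+1) (p := fun q => all (fun d =>
    (m q.1 %| label a d q.2 (w q.1) - label a d q.2 (v q.1))%Z) (enum K))).
  by apply: ciota0; apply: csucc; apply: computable_comp cnN cw.
apply: call_fin => d; apply: cdvdz.
  by apply: icomp_sub; apply: icomp_label; first [by comp_proj |
     by apply: computable_comp cw _; comp_proj | by apply: computable_comp cv _; comp_proj].
by apply: computable_comp cm _; comp_proj.
Qed.

Lemma eqlab_mod0 w v : eqlab_mod 0 w v -> eqlab a w v.
Proof.
case/andP=> /eqP sk /allP h; split=> // d i dK.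
have nE : nN a v = nN a w by rewrite -nN_skel -sk nN_skel.
have [le_i|lt_i] := leqP i (nN a w); last first.
  rewrite /label nE; case: i lt_i => // i lt_i.
  by rewrite (gsum_gt d lt_i) (@gsum_gt _ _ d _ v) ?nE // (gtn_eqF lt_i).
have /allP hd : all (fun d => (0%N %| label a d i w - label a d i v)%Z) (enum K).
  by apply: h; rewrite mem_iota ltnS.
by have := hd d; rewrite mem_enum => /(_ dK); rewrite dvd0z subr_eq0 => /eqP.
Qed.

(** Integers are listed as numbers in a fixed order, so that recursive functions
    can search for them. *)
Definition coef_index := (G * bool * G * bool)%type.
Definition coefs_list (M : seq nat) : coefs G := fun b s c t =>
  nth 0%N M (index (b, s, c, t) (enum {: coef_index})).
Definition list_coefs (mu : coefs G) : seq nat :=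
  [seq mu k.1.1.1 k.1.1.2 k.1.2 k.2 | k <- enum {: coef_index}].

Lemma list_coefsK mu b s c t : coefs_list (list_coefs mu) b s c t = mu b s c t.
Proof.
rewrite /coefs_list /list_coefs (nth_map (b, s, c, t)) ?nth_index ?index_mem
  ?mem_enum //.
Qed.

Lemma size_list_coefs mu : size (list_coefs mu) = size (enum {: coef_index}).
Proof. by rewrite size_map. Qed.

Section Coefs.
Variables (C : countType) (M : C -> seq nat).
Hypothesis cM : computable M.

Lemma cpart b s c t : computable (fun x => coefs_list (M x) b s c t).
Proof. by apply: cnth cM (computable_const _ _). Qed.

Lemma icomp_coef b s c : icomputable (fun x => coef (coefs_list (M x)) b s c).
Proof. by apply: icomp_sub; apply/icomp_nat/cpart. Qed.

Lemma cnseq (T : countType) (n : C -> nat) (x : T) :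
  computable n -> computable (fun c => nseq (n c) x).
Proof.
move=> cn; apply: computable_ext (computable_iter (f := fun q : C * seq T => x :: q.2)
  cn _ (computable_const _ [::])) _.
  by apply: computable_cons; [apply: computable_const | comp_proj].
by move=> c; elim: (n c) => //= n' ->.
Qed.

Lemma cvword b s : computable (fun x => vword a (coefs_list (M x)) b s).
Proof.
apply: cflatten; elim: (enum K) => [|c r IHr]; first exact: computable_const.
by apply: computable_cons IHr; apply: ccat; apply: cnseq; apply: cpart.
Qed.

Lemma cgimg b : computable (fun x => gimg a (coefs_list (M x)) b).
Proof.
rewrite /gimg; case: (b \in K); first exact: cvword.
apply: ccat; first exact: cvword.
by apply: computable_cons; [apply: computable_const | apply: cvword].
Qed.

Lemma cwinv (w : C -> word G) : computable w -> computable (fun x => winv (w x)).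
Proof.
move=> cw; apply: crev; apply: (cmap (f := fun q : C * letter => linv q.2)) => //.
by apply: computable_comp (computable_fin (@linv G)) _; comp_proj.
Qed.

Lemma cunimodular (m : C -> nat) : computable m ->
  computable (fun x => unimodular a (coefs_list (M x)) (m x)).
Proof.
move=> cm; have cd : icomputable (fun x => \det (class_mx a (coefs_list (M x)))).
  apply: icomp_det => i j; apply: icomp_ext (icomp_coef _ _ _) _ => x.
  by rewrite mxE.
by apply: cor; apply: cdvdz => //; [apply: icomp_sub | apply: icomp_add] => //;
  apply: icomp_const.
Qed.

Lemma ccomm_eqs (m : C -> nat) : computable m ->
  computable (fun x => comm_eqs a (coefs_list (M x)) (m x)).
Proof.
move=> cm; apply: call_fin => b; apply: call_fin => c.
apply: cimp; first exact: computable_const.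
apply: call_fin => d; apply: cand.
  by apply: cdvdz cm; apply: icomp_add; apply: icomp_coef.
apply: cimp; first exact: computable_const.
by apply: cdvdz cm; apply: icomp_sub; apply: icomp_coef.
Qed.

End Coefs.

Lemma cwsub (C : countType) (M : C -> seq nat) (w : C -> word G) :
  computable M -> computable w ->
  computable (fun x => wsub (gimg a (coefs_list (M x))) (w x)).
Proof.
move=> cM cw; apply: cflatten.
apply: (cmap (f := fun q : C * letter => lsub (gimg a (coefs_list (M q.1))) q.2)) => //.
have cM1 : computable (fun q : C * letter => M q.1).
  by apply: computable_comp cM _; comp_proj.
apply: computable_ext (computable_fin_case (F := letter)
  (f := fun l q => lsub (gimg a (coefs_list (M q.1))) l) (a := fun q => q.2) _ _) _ => //.
- move=> [b t]; rewrite /lsub /=; case: t; first exact: cgimg.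
  by apply: cwinv; apply: cgimg.
- by comp_proj.
Qed.

Definition accepts (M : seq nat) (U V : seq (word G)) : bool :=
  [&& comm_eqs a (coefs_list M) 0, unimodular a (coefs_list M) 0, size U == size V &
    all (fun i => conjb (wsub (gimg a (coefs_list M)) (nth [::] U i)) (nth [::] V i))
      (iota 0 (size U))].

(** The representatives of the classes in [U] are replaced by shortest ones, for
    which suitable targets are no longer than the words of [V]. *)
Definition refutes (m : nat) (U V : seq (word G)) : bool :=
  (size U != size V) ||
  all (fun M => comm_eqs a (coefs_list M) m && unimodular a (coefs_list M) m ==>
    ~~ all (fun i => has (fun v => conjb v (nth [::] V i) &&
      eqlab_mod m (wsub (gimg a (coefs_list M)) (shortest (nth [::] U i))) v)
        (words_upto G (size (nth [::] V i)))) (iota 0 (size U)))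
    (lists (iota 0 m) (size (enum {: coef_index}))).

Lemma caccepts (C : countType) (M : C -> seq nat) (U V : C -> seq (word G)) :
  computable M -> computable U -> computable V ->
  computable (fun c => accepts (M c) (U c) (V c)).
Proof.
move=> cM cU cV; have c0 := computable_const C 0%N.
apply: cand; first exact: ccomm_eqs.
apply: cand; first exact: cunimodular.
apply: cand; first by apply: computable_eq; apply: csize.
apply: (call (s := fun c => iota 0 (size (U c))) (p := fun q =>
  conjb (wsub (gimg a (coefs_list (M q.1))) (nth [::] (U q.1) q.2)) (nth [::] (V q.1) q.2))).
  by apply: ciota0; apply: csize.
have c1 (T : countType) (f : C -> T) : computable f ->
    computable (fun q : C * nat => f q.1).
  by move=> cf; apply: computable_comp cf _; comp_proj.
apply: cconjb; first apply: cwsub; try exact: c1.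
  by apply: cnth; [apply: c1 | comp_proj].
by apply: cnth; [apply: c1 | comp_proj].
Qed.

Lemma crefutes (C : countType) (m : C -> nat) (U V : C -> seq (word G)) :
  computable m -> computable U -> computable V ->
  computable (fun c => refutes (m c) (U c) (V c)).
Proof.
move=> cm cU cV; apply: cor.
  by apply: cneg; apply: computable_eq; apply: csize.
apply: (call (s := fun c => lists (iota 0 (m c)) (size (enum {: coef_index})))
  (p := fun q => comm_eqs a (coefs_list q.2) (m q.1) && unimodular a (coefs_list q.2) (m q.1) ==>
    ~~ all (fun i => has (fun v => conjb v (nth [::] (V q.1) i) &&
      eqlab_mod (m q.1) (wsub (gimg a (coefs_list q.2)) (shortest (nth [::] (U q.1) i))) v)
        (words_upto G (size (nth [::] (V q.1) i)))) (iota 0 (size (U q.1))))).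
  by apply: clists; [apply: ciota0 | apply: computable_const].
apply: cimp.
  by apply: cand; [apply: ccomm_eqs | apply: cunimodular]; first [by comp_proj | by apply: computable_comp cm _; comp_proj].
apply: cneg; apply: (call (s := fun q : C * seq nat => iota 0 (size (U q.1)))
  (p := fun r => has (fun v => conjb v (nth [::] (V r.1.1) r.2) &&
      eqlab_mod (m r.1.1) (wsub (gimg a (coefs_list r.1.2))
        (shortest (nth [::] (U r.1.1) r.2))) v)
        (words_upto G (size (nth [::] (V r.1.1) r.2))))).
  by apply: ciota0; apply: csize; apply: computable_comp cU _; comp_proj.
apply: (chas (s := fun r : (C * seq nat) * nat => words_upto G (size (nth [::] (V r.1.1) r.2)))
  (p := fun t => conjb t.2 (nth [::] (V t.1.1.1) t.1.2) &&
      eqlab_mod (m t.1.1.1) (wsub (gimg a (coefs_list t.1.1.2))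
        (shortest (nth [::] (U t.1.1.1) t.1.2))) t.2)).
  apply: computable_comp (cwords_upto G) _; apply: csize; apply: cnth; last by comp_proj.
  by apply: computable_comp cV _; comp_proj.
apply: cand.
  apply: cconjb; first by comp_proj.
  by apply: cnth; [apply: computable_comp cV _; comp_proj | comp_proj].
apply: ceqlab_mod; [by apply: computable_comp cm _; comp_proj | | by comp_proj].
apply: cwsub; first by comp_proj.
apply: computable_comp (cshortest G) _; apply: cnth; last by comp_proj.
by apply: computable_comp cU _; comp_proj.
Qed.


End Labels.

(** * Correctness of the certificates *)

Section ClassLength.
Variable G : sgraph.
Implicit Types (u v w : word G).
Local Open Scope group_scope.

Lemma mem_cclass (g h : raag G) : cclass g h <-> exists k, h = g ^ k.
Proof. by split=> [[k _ <-]|[k ->]]; [exists k | exists k]. Qed.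

Lemma cclass_conjw u v : cclass (wval u) = cclass (wval v) <-> conjw u v.
Proof.
split=> [e|[h vE]].
  have: cclass (wval v) (wval v) by apply/mem_cclass; exists 1; rewrite conjg1.
  by rewrite -e => /mem_cclass.
apply/seteqP; split=> g /mem_cclass[k gE]; apply/mem_cclass.
  by exists (h^-1 * k); rewrite vE -conjgM mulVKg.
by exists (h * k); rewrite conjgM -vE.
Qed.

Lemma min_natE (S : set nat) n : S n -> (forall k, S k -> n <= k) -> min_nat S = n.
Proof.
move=> Sn Smin; rewrite /min_nat; case: pselect => [neS|[]]; last first.
  by exists n; apply: mem_set.
case: ex_minnP => m /set_mem Sm mmin; apply/eqP; rewrite eqn_leq Smin // andbT.
by apply: mmin; apply: mem_set.
Qed.

Lemma len_attained (g : raag G) : exists2 w, wval w = g & len g = size w.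
Proof.
rewrite /len /min_nat; case: pselect => [neS|[]]; last first.
  by exists (size (repr g)); apply: mem_set; exists (repr g) => //; apply: wval_repr.
by case: ex_minnP => m /set_mem[w /= wg <-] _; exists w.
Qed.

Lemma class_lenE w : class_len (cclass (wval w)) = size (shortest w).
Proof.
have [wc cmin] := shortestP w.
have lenP g : cclass (wval w) g -> size (shortest w) <= len g.
  have [v vg ->] := len_attained g; rewrite -vg => /mem_cclass[k vE].
  by apply: cmin; exists k.
apply: min_natE => [|_ [g gw <-]]; last exact: lenP.
exists (wval (shortest w)); first by case: wc => k ->; apply/mem_cclass; exists k.
apply: min_natE => [|_ [v /= vE <-]]; first by exists (shortest w).
by apply: cmin; case: wc => k kE; exists k; rewrite vE.
Qed.

Lemma tuple_lenE (U : seq (word G)) :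
  tuple_len (classes_of U) = sumn [seq size (shortest w) | w <- U].
Proof.
rewrite /tuple_len /classes_of big_map sumnE big_map.
by apply: eq_bigr => w _; apply: class_lenE.
Qed.

Lemma aut_act_classes (alpha : raag G -> raag G) (f : G -> word G) U :
  automorphism alpha -> (forall b, alpha (gen b) = wval (f b)) ->
  aut_act alpha (classes_of U) = classes_of [seq wsub f u | u <- U].
Proof.
move=> [alphaM [beta alphaK betaK]] alphaf.
rewrite /aut_act /classes_of -!map_comp; apply: eq_map => u /=.
rewrite -(morph_wval alphaM alphaf).
have alphaJ := gmorphJ alphaM.
apply/seteqP; split=> [_ [g /mem_cclass[k ->] <-]|g /mem_cclass[k ->]].
  by apply/mem_cclass; exists (alpha k).
exists (wval u ^ beta k); first by apply/mem_cclass; exists (beta k).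
by rewrite alphaJ betaK.
Qed.

Lemma classes_of_eq (U V : seq (word G)) : classes_of U = classes_of V <->
  size U = size V /\ forall i, i < size U -> conjw (nth [::] U i) (nth [::] V i).
Proof.
split=> [e|[sUV UV]].
  have sUV : size U = size V by have := congr1 size e; rewrite !size_map.
  split=> // i lt_i; apply/cclass_conjw.
  have := congr1 (fun s => nth set0 s i) e.
  by rewrite !(nth_map [::]) // -sUV.
apply: (@eq_from_nth _ set0); rewrite !size_map // => i lt_i.
by rewrite !(nth_map [::]) // -?sUV //; apply/cclass_conjw/UV.
Qed.

End ClassLength.

Section Correctness.
Variables (G : sgraph) (a : G).
Local Notation K := (star_class a).
Implicit Types (U V : seq (word G)) (mu : coefs G).

Lemma wsub_conjw mu u v : comm_eqs a mu 0 -> conjw u v ->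
  conjw (wsub (gimg a mu) u) (wsub (gimg a mu) v).
Proof.
move=> cmu [h vE]; have P := gimg_preserving cmu.
by exists (induced (gimg a mu) h); rewrite -!induced_wval // vE (gmorphJ (inducedM P)).
Qed.

Lemma accepts_sound M U V : accepts a M U V ->
  exists alpha, [/\ Omega a alpha, represents [ffun b => gimg a (coefs_list M) b] alpha &
    aut_act alpha (classes_of U) = classes_of V].
Proof.
case/and4P=> cM dM /eqP sUV /allP UV; set mu := coefs_list M in cM dM UV *.
have P := gimg_preserving cM; have Om := Omega_induced cM dM.
exists (induced (gimg a mu)); split=> //.
  by move=> b; rewrite ffunE induced_gen.
rewrite (@aut_act_classes _ _ (gimg a mu)); last by move=> b; rewrite induced_gen.
  apply/classes_of_eq; rewrite size_map; split=> // i lt_i.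
  rewrite (nth_map [::]) //; apply/conjbP; apply: UV.
  by rewrite mem_iota.
by case: Om.
Qed.

Local Open Scope ring_scope.

(** The linear gaps 0 and [nN a w] are merged as in [label]. *)
Definition label_coef w j (k : G * bool) : int :=
  if j is 0 then (if nN a w == 0%N then gap_coef a w 0 k else 0)
  else gap_coef a w j k + (if j == nN a w then gap_coef a w 0 k else 0).

Lemma label_wsub mu w j d : d \in K -> label a d j (wsub (gimg a mu) w) =
  \sum_k label_coef w j k * coef mu k.1 k.2 d.
Proof.
move=> dK; rewrite /label /label_coef nN_wsub !(gsum_wsub _ _ _ dK); case: j => [|j].
  by case: ifP => _ //; rewrite big1 // => k _; rewrite mul0r.
under [in RHS]eq_bigr do rewrite mulrDl.
rewrite big_split /=; congr (_ + _); case: ifP => _ //.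
by rewrite big1 // => k _; rewrite mul0r.
Qed.

(** Residues are nonnegative, hence numbers below [m] in the entries for
    positive letters: a finite list of possibilities. *)
Definition residue mu (m : nat) : coefs G := fun b s c t =>
  if t then absz (coef mu b s c %% m%:Z)%Z else 0%N.

Lemma residueP mu m b s c : (0 < m)%N ->
  (m %| coef (residue mu m) b s c - coef mu b s c)%Z.
Proof.
move=> m_gt0; rewrite {1}/coef /residue subr0 gez0_abs ?modz_ge0 ?eqz_nat -?lt0n //.
rewrite {2}(divz_eq (coef mu b s c) m%:Z) opprD addrCA subrr addr0 rpredN.
by rewrite dvdz_mull.
Qed.

Lemma comm_eqs_residue mu m : (0 < m)%N -> comm_eqs a mu 0 -> comm_eqs a (residue mu m) m.
Proof.
move=> m_gt0 /comm_eqsP cP; apply/comm_eqsP => b c d bc cN bK dK.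
have [] := cP _ _ _ bc cN bK dK; rewrite !dvd0z => /eqP e1 e2; split.
  have := rpredD (residueP mu b true d m_gt0) (residueP mu b false d m_gt0).
  by rewrite addrACA -opprD e1 subr0.
move=> /e2 /eqP {}e2.
have shift (p q r s : int) : r - s = 0 -> p - q = (p - r) - (q - s).
  by move/subr0_eq=> ->; ring.
by rewrite (shift _ _ _ _ e2); apply: rpredB; apply: residueP.
Qed.

Lemma unimodular_residue mu m : (0 < m)%N -> unimodular a mu 0 -> unimodular a (residue mu m) m.
Proof.
move=> m_gt0 d0; apply: (@unit_mod_eq m (\det (class_mx a mu))); last first.
  by move: d0; apply: unit_mod_dvd; apply: dvdz0.
by apply/eqm_det/eqm_sym => i j; rewrite !mxE; apply: residueP.
Qed.

Lemma coefs_listK mu : coefs_list (list_coefs mu) = mu.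
Proof.
apply: funext => b; apply: funext => s; apply: funext => c; apply: funext => t.
exact: list_coefsK.
Qed.

(** The residues of the integers of an automorphism pass the tests, the targets
    being provided by [exists_min_image]. *)
Lemma refutes_sound m U V alpha : (0 < m)%N -> refutes a m U V -> Omega a alpha ->
  aut_act alpha (classes_of U) = classes_of V -> False.
Proof.
move=> m_gt0 nUV Om act; have [mu [cmu dmu muE]] := Omega_coefs Om.
have [aut _ _] := Om; move: act; rewrite (aut_act_classes _ aut muE).
move/classes_of_eq; rewrite size_map => -[sUV UV].
case/orP: nUV => [|/allP/(_ (list_coefs (residue mu m)))]; first by rewrite sUV eqxx.
rewrite coefs_listK.
have inL : list_coefs (residue mu m) \in lists (iota 0 m) (size (enum {: coef_index G})).
  rewrite mem_lists size_list_coefs eqxx /=; apply/allP => x /mapP[k _ ->].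
  rewrite mem_iota /= /residue; case: k.2 => //.
  by rewrite -ltz_nat gez0_abs ?modz_ge0 ?ltz_pmod ?ltz_nat // eqz_nat -lt0n.
have ok : comm_eqs a (residue mu m) m && unimodular a (residue mu m) m.
  by rewrite comm_eqs_residue ?unimodular_residue.
move=> /(_ inL) /implyP /(_ ok) /negP; apply.
apply/allP => i; rewrite mem_iota add0n => /andP[_ lt_i].
set u := nth [::] U i; have [uc cmin] := shortestP u.
have free : forall r, ~ cancels (shortest u) r.
  by apply: min_cancel_free => v cv; apply: cmin; apply: conjw_trans cv.
have [v [vu vmin]] := exists_min_image cmu dmu free.
have vV : conjw v (nth [::] V i).
  apply: conjw_trans (eqlab_conjw vu) _.
  apply: conjw_trans (wsub_conjw cmu (conjw_sym uc)) _.
  by have := UV i lt_i; rewrite (nth_map [::]).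
apply/hasP; exists v; first by rewrite mem_words_upto; apply: vmin.
apply/andP; split; first exact/conjbP.
apply/andP; split; first by rewrite skel_wsub (vu.1) skel_wsub.
apply/allP => j _; apply/allP => d; rewrite mem_enum => dK.
rewrite (vu.2 d j dK) !label_wsub // -sumrB; apply: rpred_sum => k _.
by rewrite -mulrBr dvdz_mull //; apply: residueP.
Qed.

(** If every candidate failed modulo some number, then all of them would fail
    modulo the product of these numbers. *)
Lemma pigeonhole_mod (T : eqType) (P : nat -> T -> Prop) (C : seq T) :
  (forall m n x, (m %| n)%N -> P n x -> P m x) ->
  (forall m, (0 < m)%N -> exists2 x, x \in C & P m x) ->
  exists2 x, x \in C & forall m, (0 < m)%N -> P m x.
Proof.
move=> Pdvd; elim: C => [|x C IHC] loc; first by have [] := loc 1%N isT.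
have [allx|] := pselect (forall m, (0 < m)%N -> P m x).
  by exists x => //; apply: mem_head.
move/existsNP => [m0 /not_implyP[m0_gt0 nP]].
have [|y yC Py] := IHC; last by exists y => //; rewrite inE yC orbT.
move=> m m_gt0; have [|y] := loc (m * m0)%N; first by rewrite muln_gt0 m_gt0.
rewrite inE => /orP[/eqP ->|yC] Py.
  by case: nP; apply: Pdvd Py; apply: dvdn_mull.
by exists y => //; apply: Pdvd Py; apply: dvdn_mulr.
Qed.

Section Solve.
Variables (I : eqType) (r : seq I) (lhs : I -> G * bool -> int) (rhs : I -> G -> int).

Definition solves mu (m : nat) := forall e, e \in r -> forall d, d \in K ->
  (m %| \sum_k lhs e k * coef mu k.1 k.2 d - rhs e d)%Z.

(** Each equation, taken at every vertex of the class, is a column of a matrix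
    equation whose unknowns are the matrix on the class and the matrix of all
    the other vectors. *)
Lemma solve_system :
  (forall m, (0 < m)%N -> exists2 mu, unimodular a mu m & solves mu m) ->
  exists2 mu, unimodular a mu 0 & solves mu 0.
Proof.
move=> loc; pose e_ (j : 'I_(size r)) := tnth (in_tuple r) j.
pose Kt (k : G * bool) := (k.1 \in K) && k.2.
pose z : 'M[int]_(#|K|, size r) := \matrix_(i, j) lhs (e_ j) (enum_val i, true).
pose y : 'M[int]_(#|{: G * bool}|, size r) := \matrix_(i, j)
  (if Kt (enum_val i) then 0 else lhs (e_ j) (enum_val i)).
pose eta : 'M[int]_(#|K|, size r) := \matrix_(i, j) rhs (e_ j) (enum_val i).
pose Tmx mu : 'M[int]_(#|K|, #|{: G * bool}|) :=
  \matrix_(i, j) coef mu (enum_val j).1 (enum_val j).2 (enum_val i).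
have sysE mu i j : (class_mx a mu *m z + Tmx mu *m y) i j =
    \sum_k lhs (e_ j) k * coef mu k.1 k.2 (enum_val i).
  rewrite mx_addE !mxE [RHS](bigID Kt) /=; congr (_ + _).
    rewrite (reindex_onto (fun d : G => (d, true)) fst) /=; last first.
      by move=> [d s] /andP[_ /= ->].
    rewrite (eq_bigl [in K]); last first.
      by move=> d; rewrite /Kt /= andbT eqxx andbT.
    by rewrite [RHS]big_enum_val /=; apply: eq_bigr => l _; rewrite !mxE mulrC.
  rewrite [RHS]big_mkcond [RHS](reindex_onto enum_val enum_rank) /=; last first.
    by move=> k _; rewrite enum_rankK.
  apply: eq_big => [l|l _]; first by rewrite enum_valK eqxx.
  by rewrite !mxE; case: (Kt _); rewrite /= ?mulr0 // mulrC.
have [|[A T] /= Au AE] := @local_global _ _ _ z y eta.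
  move=> M M_gt0; have [mu dmu smu] := loc M M_gt0; exists (class_mx a mu, Tmx mu) => //.
  by move=> i j; rewrite sysE mxE; apply: smu; [apply: mem_tnth | apply: enum_valP].
have aK : a \in K by rewrite inE eqxx.
pose rk := enum_rank_in aK.
have rK i : rk (enum_val i) = i by exact: enum_valK_in.
pose mu := coefs_of (fun b s c =>
  if Kt (b, s) then A (rk c) (rk b) else T (rk c) (enum_rank (b, s))).
have class_mxE : class_mx a mu = A.
  by apply/matrixP => i j; rewrite mxE coef_of /Kt enum_valP /= !rK.
have TmxE : Tmx mu *m y = T *m y.
  apply/matrixP => i j; rewrite !mxE; apply: eq_bigr => l _; rewrite !mxE.
  have [Kl|Kl] := boolP (Kt (enum_val l)); first by rewrite !mulr0.
  by rewrite coef_of -surjective_pairing (negbTE Kl) rK enum_valK.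
exists mu; first by rewrite unimodular_unit class_mxE.
move=> e er d dK; have /tnthP[j ->] : e \in in_tuple r by [].
have := congr1 (fun B : 'M[int]_(_, _) => B (rk d) j) AE.
by rewrite /= -class_mxE -TmxE sysE mxE !enum_rankK_in // => ->; rewrite subrr.
Qed.

End Solve.

Lemma head_filter (T : Type) (x0 : T) (p : pred T) s :
  has p s -> p (head x0 (filter p s)).
Proof. by elim: s => //= x s IHs; case px: (p x). Qed.

Lemma leq_sumn (s : seq nat) x : x \in s -> (x <= sumn s)%N.
Proof.
elim: s => //= y s IHs; rewrite inE => /orP[/eqP ->|/IHs le_x].
  exact: leq_addr.
exact: leq_trans le_x (leq_addl _ _).
Qed.

(** The system is indexed by the commutation equations of both kinds, and by
    pairs of a word and one of its gaps. *)
Definition sys_index := ((bool * (G * G)) + (nat * nat))%type.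

Definition sys_seq (us : seq (word G)) : seq sys_index :=
  [seq inl x | x <- enum {: bool * (G * G)}] ++
  [seq inr x | x <- [seq (i, j) | i <- iota 0 (size us),
                       j <- iota 0 (nN a (nth [::] us i)).+1]].

(** Equations that do not apply are replaced by 0 = 0. *)
Definition sys_lhs (us : seq (word G)) (e : sys_index) (k : G * bool) : int :=
  match e with
  | inl (t, (b, c)) => if [&& adj b c, c \notin star a & b \notin K] then
      (if t then (if b \notin star a then (k == (b, true))%:R - (k == (c, true))%:R else 0)
       else (k.1 == b)%:R) else 0
  | inr (i, j) => label_coef (nth [::] us i) j k
  end.

Definition sys_rhs (vs : seq (word G)) (e : sys_index) (d : G) : int :=
  if e is inr (i, j) then label a d j (nth [::] vs i) else 0.

Lemma sum_pick1 mu k0 d :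
  \sum_k (k == k0 :> G * bool)%:R * coef mu k.1 k.2 d = coef mu k0.1 k0.2 d.
Proof.
rewrite (bigD1 k0) //= eqxx mul1r big1 ?addr0 // => k /negbTE ->.
by rewrite mul0r.
Qed.

Lemma sum_pick2 mu b d : \sum_(k : G * bool) (k.1 == b)%:R * coef mu k.1 k.2 d =
  coef mu b true d + coef mu b false d.
Proof.
rewrite -(sum_pick1 mu (b, true)) -(sum_pick1 mu (b, false)) -big_split /=.
apply: eq_bigr => -[c s] _; rewrite !xpair_eqE -mulrDl; congr (_ * _).
by case: s; case: (c == b).
Qed.

Lemma sys_solves us vs mu m : size us = size vs ->
  comm_eqs a mu m -> (forall i, (i < size us)%N ->
    eqlab_mod a m (wsub (gimg a mu) (nth [::] us i)) (nth [::] vs i)) ->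
  solves (sys_seq us) (sys_lhs us) (sys_rhs vs) mu m.
Proof.
move=> s_uv /comm_eqsP cP sm e; rewrite mem_cat => /orP[] /mapP[x].
  case: x => t [b c] _ -> d dK; rewrite /sys_lhs /sys_rhs subr0.
  case: (boolP [&& adj b c, c \notin star a & b \notin K]) => [/and3P[bc cN bK]|_]; last first.
    by rewrite big1 ?dvdz0 // => k _; rewrite mul0r.
  have [c1 c2] := cP b c d bc cN bK dK.
  case: t; last by rewrite sum_pick2.
  case: (boolP (b \notin star a)) => [/c2 {}c2|_]; last by rewrite big1 ?dvdz0 // => k _; rewrite mul0r.
  under eq_bigr do rewrite mulrBl.
  by rewrite sumrB !sum_pick1.
move/allpairsPdep => [i [j [iU jU ->]]] -> d dK; rewrite /sys_lhs /sys_rhs -label_wsub //.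
have /andP[_ /allP h] : eqlab_mod a m (wsub (gimg a mu) (nth [::] us i)) (nth [::] vs i).
  by apply: sm; rewrite mem_iota in iU.
have /allP : all (fun d => (m %| label a d j (wsub (gimg a mu) (nth [::] us i)) -
    label a d j (nth [::] vs i))%Z) (enum K) by apply: h; rewrite nN_wsub.
by apply; rewrite mem_enum.
Qed.

Lemma solves_sys us vs mu m : size us = size vs ->
  solves (sys_seq us) (sys_lhs us) (sys_rhs vs) mu m ->
  (forall i, (i < size us)%N -> skel a (nth [::] us i) = skel a (nth [::] vs i)) ->
  comm_eqs a mu m /\ forall i, (i < size us)%N ->
    eqlab_mod a m (wsub (gimg a mu) (nth [::] us i)) (nth [::] vs i).
Proof.
move=> s_uv sol sk; split.
  apply/comm_eqsP => b c d bc cN bK dK.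
  have inI t : inl (t, (b, c)) \in sys_seq us.
    by rewrite mem_cat map_f // mem_enum.
  split=> [|bN].
    have := sol _ (inI false) d dK; rewrite /sys_lhs /sys_rhs subr0 bc cN bK /=.
    by rewrite sum_pick2.
  have := sol _ (inI true) d dK; rewrite /sys_lhs /sys_rhs subr0 bc cN bK /= bN.
  by under eq_bigr do rewrite mulrBl; rewrite sumrB !sum_pick1.
move=> i lt_i; apply/andP; split; first by rewrite skel_wsub sk.
apply/allP => j; rewrite nN_wsub => jU; apply/allP => d; rewrite mem_enum => dK.
have inI : inr (i, j) \in sys_seq us.
  rewrite mem_cat; apply/orP; right; apply: map_f; apply/allpairsPdep.
  by exists i, j; rewrite mem_iota.
by have := sol _ inI d dK; rewrite /sys_lhs /sys_rhs -label_wsub.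
Qed.

(** If no modulus excludes all targets, one tuple of targets survives modulo
    every number, and its system has an integer solution. *)
Lemma accepts_or_refutes U V : exists n, accepts a (CodeSeq.decode n) U V || refutes a n.+1 U V.
Proof.
apply: contrapT => /forallNP no.
have no_refutes m : (0 < m)%N -> ~~ refutes a m U V.
  by case: m => // m _; apply/negP => h; case: (no m); rewrite h orbT.
have sUV : size U = size V.
  by have := no_refutes 1%N isT; rewrite negb_or negbK => /andP[/eqP].
pose us := [seq shortest u | u <- U].
have usE i : (i < size U)%N -> nth [::] us i = shortest (nth [::] U i).
  by move=> lt_i; rewrite (nth_map [::]).
have s_us : size us = size U by rewrite size_map.
pose P m vs := size vs = size U /\ exists mu, [/\ comm_eqs a mu m, unimodular a mu m &
  forall i, (i < size U)%N -> conjw (nth [::] vs i) (nth [::] V i) /\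
    eqlab_mod a m (wsub (gimg a mu) (nth [::] us i)) (nth [::] vs i)].
pose C := lists (words_upto G (sumn [seq size v | v <- V])) (size U).
have [|m m_gt0|vs _ Pvs] := @pigeonhole_mod _ P C.
- move=> m n vs dvd_mn [svs [mu [cmu dmu h]]]; split=> //; exists mu.
  have mn : (m%:Z %| n%:Z)%Z by rewrite dvdzE.
  split.
  + apply/comm_eqsP => b c d bc cN bK dK; have [c1 c2] := (comm_eqsP _ _ _).1 cmu b c d bc cN bK dK.
    by split=> [|/c2 c3]; [apply: dvdz_trans mn c1 | apply: dvdz_trans mn c3].
  + exact: unit_mod_dvd mn dmu.
  + move=> i lt_i; have [cv /andP[sk /allP sm]] := h i lt_i; split=> //.
    apply/andP; split=> //; apply/allP => j jU; have /allP smj := sm j jU.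
    by apply/allP => d dK; apply: dvdz_trans mn (smj d dK).
- have := no_refutes m m_gt0; rewrite negb_or => /andP[_ /allPn[M _]].
  rewrite negb_imply negbK => /andP[/andP[cM dM] /allP h].
  pose f i := head [::] [seq v <- words_upto G (size (nth [::] V i)) | conjb v (nth [::] V i) &&
     eqlab_mod a m (wsub (gimg a (coefs_list M)) (shortest (nth [::] U i))) v].
  have fP i : (i < size U)%N -> [/\ conjw (f i) (nth [::] V i),
      eqlab_mod a m (wsub (gimg a (coefs_list M)) (nth [::] us i)) (f i) &
      (size (f i) <= size (nth [::] V i))%N].
    move=> lt_i; have iU : i \in iota 0 (size U) by rewrite mem_iota.
    have hi := h i iU.
    rewrite usE //; have /andP[/conjbP ? ?] := head_filter [::] hi; split=> //.
    rewrite -mem_words_upto /f; move: hi; rewrite has_filter.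
    case e: filter => [|v s] //= _; have: v \in v :: s by rewrite mem_head.
    by rewrite -e mem_filter => /andP[].
  exists (mkseq f (size U)).
    rewrite mem_lists size_mkseq eqxx; apply/allP => w /(nthP [::])[i].
    rewrite size_mkseq => lt_i; rewrite nth_mkseq // => <-; rewrite -[_ \in _]/(f i \in words_upto G _) mem_words_upto.
    have [_ _ le_f] := fP i lt_i; apply: leq_trans le_f _; apply: leq_sumn.
    by apply: map_f; apply: mem_nth; rewrite -sUV.
  split; first exact: size_mkseq.
  exists (coefs_list M); split=> // i lt_i; rewrite nth_mkseq //.
  by have [] := fP i lt_i.
have [svs _] := Pvs 1%N isT.
have s_uv : size us = size vs by rewrite s_us svs.
have [|mu dmu smu] := @solve_system _ (sys_seq us) (sys_lhs us) (sys_rhs vs).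
  move=> m m_gt0; have [_ [mu [cmu dmu h]]] := Pvs m m_gt0; exists mu => //.
  by apply: sys_solves => // i; rewrite s_us => /h[].
have [_ [mu1 [_ _ h1]]] := Pvs 1%N isT.
have [cmu sm] : comm_eqs a mu 0 /\ forall i, (i < size us)%N ->
    eqlab_mod a 0 (wsub (gimg a mu) (nth [::] us i)) (nth [::] vs i).
  apply: solves_sys => // i; rewrite s_us => /h1[_ /andP[/eqP <- _]].
  by rewrite skel_wsub.
case: (no (CodeSeq.code (list_coefs mu))); apply/orP; left.
rewrite CodeSeq.codeK /accepts coefs_listK cmu dmu sUV eqxx /=; apply/allP => i.
rewrite mem_iota /= => lt_i; rewrite -sUV in lt_i; apply/conjbP.
apply: conjw_trans (wsub_conjw cmu (shortestP _).1) _.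
apply: conjw_trans (h1 i lt_i).1; apply: eqlab_conjw; apply: eqlab_mod0.
by rewrite -usE //; apply: sm; rewrite s_us.
Qed.

(** The least number that is either the code of integers defining a suitable
    automorphism, or the predecessor of a modulus excluding all of them. *)
Definition certificate (x : seq (word G) * seq (word G)) : nat :=
  ex_minn (accepts_or_refutes x.1 x.2).

Definition solve_at (x : seq (word G) * seq (word G)) : option {ffun G -> word G} :=
  let M := CodeSeq.decode (certificate x) in
  if accepts a M x.1 x.2 then Some [ffun b => gimg a (coefs_list M) b] else None.

Lemma ccertificate : computable certificate.
Proof.
have [r cr rK] : decodable (seq (word G) * seq (word G))%type.
  have dw := decodable_seq (decodable_fin (a, true)).
  by apply: decodable_pair; apply: decodable_seq.
apply: (csearch (p := fun q => accepts a (CodeSeq.decode q.2) q.1.1 q.1.2 ||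
  refutes a q.2.+1 q.1.1 q.1.2) (fun x => accepts_or_refutes x.1 x.2) cr rK).
apply: cor; first by apply: caccepts; [apply: ccode | |]; comp_proj.
by apply: crefutes; [apply: csucc | |]; comp_proj.
Qed.

Lemma csolve_at : computable solve_at.
Proof.
have cM := ccode ccertificate.
apply: computable_if; last exact: computable_const.
  by apply: caccepts cM _ _; [apply: computable_fst | apply: computable_snd].
by apply: csome; apply: cffun => b; apply: cgimg.
Qed.

Lemma solve_atP U V : match solve_at (U, V) with
  | Some phi => exists alpha, [/\ Omega a alpha, represents phi alpha &
                  aut_act alpha (classes_of U) = classes_of V]
  | None => ~ exists alpha, Omega a alpha /\
                  aut_act alpha (classes_of U) = classes_of V
  end.
Proof.
rewrite /solve_at /=; case: ifP => [/accepts_sound //|no [alpha [Om act]]].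
have: accepts a (CodeSeq.decode (certificate (U, V))) U V || refutes a (certificate (U, V)).+1 U V.
  by rewrite /certificate; case: ex_minnP.
rewrite no => /= refuted; exact: refutes_sound refuted Om act.
Qed.

End Correctness.

(** * The algorithms *)

Section Algorithms.
Variable G : sgraph.

Definition solve (x : seq (word G) * seq (word G) * G) := solve_at x.2 x.1.

Lemma csolve : computable solve.
Proof.
apply: (computable_fin_case (f := fun a (x : seq (word G) * seq (word G) * G) =>
  solve_at a x.1) (a := snd)); last exact: computable_snd.
by move=> a; apply: computable_comp (csolve_at a) (computable_fst _ _).
Qed.

Definition min_length (U : seq (word G)) := sumn [seq size (shortest u) | u <- U].

Lemma cmin_length : computable min_length.
Proof.
apply: csumn; apply: (cmap (s := fun U => U)
  (f := fun q : seq (word G) * word G => size (shortest q.2))).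
  exact: computable_id.
by apply: csize; apply: computable_comp (cshortest G) _; comp_proj.
Qed.

(** A tuple can be shortened exactly if a tuple of words with smaller total
    length is in its orbit. *)
Definition shortens (x : seq (word G) * G) : bool :=
  has (fun V => (sumn (map size V) < min_length x.1) && (solve (x.1, V, x.2) != None))
    (lists (words_upto G (min_length x.1)) (size x.1)).

Lemma cshortens : computable shortens.
Proof.
have cml (C : countType) (f : C -> seq (word G)) : computable f ->
    computable (fun c => min_length (f c)) by exact: computable_comp cmin_length.
apply: (chas (s := fun x : seq (word G) * G => lists (words_upto G (min_length x.1)) (size x.1))
  (p := fun q => (sumn (map size q.2) < min_length q.1.1) &&
          (solve (q.1.1, q.2, q.1.2) != None))).
  apply: clists; last by apply: csize; comp_proj.
  by apply: computable_comp (cwords_upto G) _; apply: cml; comp_proj.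
apply: cand.
  apply: cleq; last by apply: cml; comp_proj.
  apply: csucc; apply: csumn; apply: (cmap (s := fun q => q.2)
   (f := fun r : (seq (word G) * G * seq (word G)) * word G => size r.2)).
    by comp_proj.
  by apply: csize; comp_proj.
apply: cneg; apply: computable_eq; last exact: computable_const.
apply: computable_comp csolve _; apply: computable_pair; last by comp_proj.
by apply: computable_pair; comp_proj.
Qed.

Lemma shortensP (U : seq (word G)) (a : G) : shortens (U, a) <->
  exists alpha, Omega a alpha /\
    tuple_len (aut_act alpha (classes_of U)) < tuple_len (classes_of U).
Proof.
split.
  case/hasP => V _ /andP[lt_V]; have := solve_atP a U V.
  rewrite /solve /=; case: (solve_at a (U, V)) => //= phi [alpha [Om _ act]] _.
  exists alpha; split=> //; rewrite act !tuple_lenE; apply: leq_ltn_trans lt_V.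
  rewrite !sumnE !big_map; apply: leq_sum => w _; have [_] := shortestP w.
  by apply; apply: conjw_refl.
move=> [alpha [Om lt_U]]; have [aut _ _] := Om; have [mu [_ _ muE]] := Omega_coefs Om.
have act := aut_act_classes U aut muE.
move: (map _ U) act (size_map (wsub (gimg a mu)) U) => W act sW; pose V := [seq shortest w | w <- W].
have actV : aut_act alpha (classes_of U) = classes_of V.
  rewrite act; apply/classes_of_eq; split=> [|i lt_i]; first by rewrite size_map.
  by rewrite (nth_map [::]) //; exact: (shortestP _).1.
have sV : sumn (map size V) < min_length U.
  by move: lt_U; rewrite act !tuple_lenE -map_comp.
apply/hasP; exists V.
  rewrite mem_lists size_map sW eqxx; apply/allP => w wV.
  rewrite -[_ \in _]/(w \in words_upto G _) mem_words_upto.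
  by apply: leq_trans (ltnW sV); apply: leq_sumn; apply: map_f.
rewrite sV /=; have := solve_atP a U V; rewrite /solve /=.
by case: (solve_at a (U, V)) => // -[]; exists alpha.
Qed.

End Algorithms.

Theorem proposition1p4 (G : sgraph) :
  (exists2 solve : seq (word G) * seq (word G) * G -> option {ffun G -> word G},
     computable solve &
     forall (U V : seq (word G)) (a : G),
       match solve (U, V, a) with
       | Some phi => exists alpha, [/\ Omega a alpha, represents phi alpha &
                       aut_act alpha (classes_of U) = classes_of V]
       | None => ~ exists alpha, Omega a alpha /\
                       aut_act alpha (classes_of U) = classes_of V
       end) /\
  (exists2 shortens : seq (word G) * G -> bool,
     computable shortens &
     forall (U : seq (word G)) (a : G),
       shortens (U, a) <->
       exists alpha, Omega a alpha /\
         tuple_len (aut_act alpha (classes_of U)) < tuple_len (classes_of U)).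
Proof.
split; first by exists (@solve G) => [|U V a]; [apply: csolve | apply: solve_atP].
by exists (@shortens G) => [|U a]; [apply: cshortens | apply: shortensP].
Qed.
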